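(* Let $d,n$ be positive integers. The set $$\left\{\phi_\mu(b_1b_2\cdots b_d\,M_{k,l})\;\middle|\;\mu\in{\rm Comp}_d(n),\ b_i\in\mathcal{B}_{{\rm TL}_{\mu_i}(q)}\text{ for all }i=1,\dots,d,\ 1\le k,l\le m_\mu\right\}$$ is a basis of ${\rm FTL}_{d,n}(q)$ as a $\mathbb{C}[q,q^{-1}]$-module. In particular, ${\rm FTL}_{d,n}(q)$ is a free $\mathbb{C}[q,q^{-1}]$-module of rank $$\sum_{\mu\in{\rm Comp}_d(n)}m_\mu^2\,C_{\mu_1}C_{\mu_2}\cdots C_{\mu_d}.$$
   Context: Let $q$ be an indeterminate. The Yokonuma--Hecke algebra ${\rm Y}_{d,n}(q)$ is the associative unital $\mathbb{C}[q,q^{-1}]$-algebra generated by $g_1,\dots,g_{n-1},t_1,\dots,t_n$ with relations: $g_ig_j=g_jg_i$ if $|i-j|>1$; $g_ig_{i+1}g_i=g_{i+1}g_ig_{i+1}$ for $1\le i\le n-2$; $t_it_j=t_jt_i$; $t_jg_i=g_it_{s_i(j)}$ where $s_i=(i,i+1)\in\mathfrak{S}_n$; $t_j^d=1$; and $g_i^2=q+(q-1)e_ig_i$, where $e_i=\frac1d\sum_{s=0}^{d-1}t_i^st_{i+1}^{-s}$. For $w\in\mathfrak{S}_n$ with reduced expression $s_{i_1}\cdots s_{i_r}$, $g_w:=g_{i_1}\cdots g_{i_r}$. Let $\ell$ be the length function on $\mathfrak{S}_n$. Framisation of the Temperley--Lieb algebra: ${\rm FTL}_{d,n}(q)={\rm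 Y}_{d,n}(q)/I_{d,n}$, where $I_{d,n}$ is the two-sided ideal generated by $e_1e_2\,g_{1,2}$ with $g_{1,2}=1+g_1+g_2+g_1g_2+g_2g_1+g_1g_2g_1$ (and $I_{d,n}=\{0\}$ if $n\le 2$). The Iwahori--Hecke algebra $\mathcal{H}_n(q)$ is the $\mathbb{C}[q,q^{-1}]$-algebra generated by $G_1,\dots,G_{n-1}$ with the braid relations $G_iG_j=G_jG_i$ ($|i-j|>1$), $G_iG_{i+1}G_i=G_{i+1}G_iG_{i+1}$, and $G_i^2=q+(q-1)G_i$; it is free with basis $G_w:=G_{i_1}\cdots G_{i_r}$, $w\in\mathfrak{S}_n$ ($\mathcal{H}_0(q)=\mathcal{H}_1(q)=\mathbb{C}[q,q^{-1}]$). Put $G_{i,i+1}:=1+G_i+G_{i+1}+G_iG_{i+1}+G_{i+1}G_i+G_iG_{i+1}G_i$. The Temperley--Lieb algebra is ${\rm TL}_n(q)=\mathcal{H}_n(q)/I_n$, with $I_n$ the two-sided ideal generated by $G_{1,2}$ if $n\ge3$ and $I_n=\{0\}$ if $n\le2$. Basis of ${\rm TL}_m(q)$ (Jones): $\mathcal{B}_{{\rm TL}_m(q)}$ is the set of images in ${\rm TL}_m(q)$ of the elements $(G_{i_1}G_{i_1-1}\cdots G_{i_1-k_1})(G_{i_2}G_{i_2-1}\cdots G_{i_2-k_2})\cdots(G_{i_p}G_{i_p-1}\cdots G_{i_p-k_p})$, where $0\le p\le m-1$, the $i_j,k_j$ are non-negative integers, $1\le i_1<i_2<\cdots<i_p\le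 m-1$ and $1\le i_1-k_1<i_2-k_2<\cdots<i_p-k_p\le m-1$ (the empty product, $p=0$, being $1$; for $m\le 1$ the set is $\{1\}$). It is a $\mathbb{C}[q,q^{-1}]$-basis of ${\rm TL}_m(q)$ with $C_m=\frac1{m+1}\binom{2m}{m}$ elements. ${\rm Comp}_d(n)$ is the set of $d$-tuples $\mu=(\mu_1,\dots,\mu_d)$ of non-negative integers with sum $n$. For such $\mu$, let $\mathfrak{S}_\mu=\mathfrak{S}_{\mu_1}\times\cdots\times\mathfrak{S}_{\mu_d}\subseteq\mathfrak{S}_n$ be the Young subgroup (acting on consecutive blocks), generated by the $s_j$ with $j\in J^\mu:=\{1,\dots,n-1\}\setminus\{\mu_1,\mu_1+\mu_2,\dots,\mu_1+\cdots+\mu_{d-1}\}$. $\mathcal{H}^\mu(q)\cong\mathcal{H}_{\mu_1}(q)\otimes\cdots\otimes\mathcal{H}_{\mu_d}(q)$ is the subalgebra of $\mathcal{H}_n(q)$ generated by $\{G_j\mid j\in J^\mu\}$, with basis $\{G_w\mid w\in\mathfrak{S}_\mu\}$. ${\rm TL}^\mu(q):={\rm TL}_{\mu_1}(q)\otimes\cdots\otimes{\rm TL}_{\mu_d}(q)$ (over $\mathbb{C}[q,q^{-1}]$), and $\rho^\mu:\mathcal{H}^\mu(q)\twoheadrightarrow{\rm TL}^\mu(q)$ is the tensor product of the natural surjections $\mathcal{H}_{\mu_i}(q)\twoheadrightarrow{\rm TL}_{\mu_i}(q)$; the induced (entrywise) surjection ${\rm Mat}_{m_\mu}(\mathcal{H}^\mu(q))\twoheadrightarrow{\rm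 Mat}_{m_\mu}({\rm TL}^\mu(q))$ is also denoted $\rho^\mu$. A product $b_1b_2\cdots b_d$ with $b_i\in{\rm TL}_{\mu_i}(q)$ means $b_1\otimes\cdots\otimes b_d\in{\rm TL}^\mu(q)$. Let $\{\xi_1,\dots,\xi_d\}$ be the $d$-th roots of unity in $\mathbb{C}$ (ordered arbitrarily), and $\mathcal{A}_{d,n}\cong(\mathbb{Z}/d\mathbb{Z})^n$ the group generated by $t_1,\dots,t_n$. For an irreducible character $\chi$ of $\mathcal{A}_{d,n}$ let $E_\chi:=\prod_{j=1}^n\bigl(\frac1d\sum_{s=0}^{d-1}\chi(t_j)^st_j^{-s}\bigr)$. $\mathfrak{S}_n$ acts on characters by $w(\chi)(t_j)=\chi(t_{w^{-1}(j)})$. Let $\chi_1^\mu$ be the character with $\chi_1^\mu(t_j)=\xi_i$ for $\mu_1+\cdots+\mu_{i-1}<j\le\mu_1+\cdots+\mu_i$. Let $\pi_{\mu,1}=1,\dots,\pi_{\mu,m_\mu}$, $m_\mu=\frac{n!}{\mu_1!\cdots\mu_d!}$, be the minimal length representatives of the left cosets $\mathfrak{S}_n/\mathfrak{S}_\mu$, and $\chi_k^\mu:=\pi_{\mu,k}(\chi_1^\mu)$. Put $E_\mu:=\sum_{k=1}^{m_\mu}E_{\chi_k^\mu}$. The $E_\mu$ form a complete set of central orthogonal idempotents of ${\rm Y}_{d,n}(q)$; the image of $E_\mu$ in ${\rm FTL}_{d,n}(q)$ is also written $E_\mu$. Let $\theta^\mu:E_\mu{\rm Y}_{d,n}(q)\twoheadrightarrow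 E_\mu{\rm FTL}_{d,n}(q)$ be the natural surjection. Let $M_{k,l}$ be the elementary $m_\mu\times m_\mu$ matrices and $U_\mu:=\sum_kq^{\ell(\pi_{\mu,k})/2}M_{k,k}$. Over $\mathbb{C}[q^{1/2},q^{-1/2}]$ define the linear map $\widetilde{\Psi}_\mu(E_{\chi_k^\mu}g_w):=q^{\frac12(\ell(w)-\ell(\pi_{\mu,k}^{-1}w\pi_{\mu,l}))}G_{\pi_{\mu,k}^{-1}w\pi_{\mu,l}}M_{k,l}$, where $l$ is determined by $w(\chi_l^\mu)=\chi_k^\mu$. The map $\Psi_\mu:E_\mu{\rm Y}_{d,n}(q)\to{\rm Mat}_{m_\mu}(\mathcal{H}^\mu(q))$, $\Psi_\mu(E_\mu a)=U_\mu\widetilde{\Psi}_\mu(E_\mu a)U_\mu^{-1}$, is an isomorphism of $\mathbb{C}[q,q^{-1}]$-algebras; let $\Phi_\mu$ be its inverse. $\phi_\mu:{\rm Mat}_{m_\mu}({\rm TL}^\mu(q))\to E_\mu{\rm FTL}_{d,n}(q)$ is the unique $\mathbb{C}[q,q^{-1}]$-algebra homomorphism with $\phi_\mu\circ\rho^\mu=\theta^\mu\circ\Phi_\mu$ (it exists). *)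

(* Defs.v *)
From HB Require Import structures.
From mathcomp Require Import all_boot all_order all_algebra all_fingroup.
From mathcomp Require Import boolp classical_sets.
From mathcomp Require Import complex monalg zify.

Set Implicit Arguments.
Unset Strict Implicit.
Unset Printing Implicit Defensive.

Import GRing.Theory Num.Theory.
Local Open Scope classical_set_scope.
Local Open Scope quotient_scope.
Local Open Scope ring_scope.


(* [laurent F] is F[q, q^-1], as the subring of F(q) of the fractions p / q^n. *)
Section Laurent.
Variable F : fieldType.

Definition is_laurent : {pred {fraction {poly F}}} :=
  fun x => `[< exists (p : {poly F}) (n : nat), x = tofrac p / tofrac 'X ^+ n >].

Record laurent := Laurent {
  laurent_val : {fraction {poly F}};
  laurentP : laurent_val \in is_laurent }.

HB.instance Definition _ := [isSub for laurent_val].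
HB.instance Definition _ := [Choice of laurent by <:].

Lemma X_neq0 n : tofrac ('X : {poly F}) ^+ n != 0.
Proof. by rewrite expf_neq0 // tofrac_eq0 polyX_eq0. Qed.

Lemma is_laurent_frac p n : tofrac p / tofrac 'X ^+ n \in is_laurent.
Proof. by apply/asboolP; exists p, n. Qed.

Lemma is_laurent_subring : subring_closed is_laurent.
Proof.
split.
- by have := is_laurent_frac 1 0; rewrite expr0 divr1 tofrac1.
- move=> _ _ /asboolP[p [m ->]] /asboolP[r [n ->]].
  rewrite -mulNr addf_div ?X_neq0 // -exprD -!tofracXn -tofracN -!tofracM -tofracD.
  by rewrite tofracXn is_laurent_frac.
- move=> _ _ /asboolP[p [m ->]] /asboolP[r [n ->]].
  by rewrite mulf_div -exprD -tofracM is_laurent_frac.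
Qed.

HB.instance Definition _ :=
  GRing.isSubringClosed.Build {fraction {poly F}} is_laurent is_laurent_subring.
HB.instance Definition _ := [SubChoice_isSubComNzRing of laurent by <:].

Lemma is_laurent_const c : tofrac c%:P \in is_laurent.
Proof. by rewrite -[tofrac _]divr1 -(expr0 (tofrac 'X)) is_laurent_frac. Qed.

Lemma is_laurent_exp (z : int) : tofrac ('X : {poly F}) ^ z \in is_laurent.
Proof.
case: z => n; last by rewrite NegzE -exprnN -[_ ^- _]mul1r -tofrac1 is_laurent_frac.
by rewrite -exprnP -tofracXn -[tofrac _]divr1 -(expr0 (tofrac 'X)) is_laurent_frac.
Qed.

Definition lconst (c : F) : laurent := Laurent (is_laurent_const c).

Lemma lconst_zmod : zmod_morphism lconst.
Proof. by move=> a b; apply/val_inj; rewrite /= polyCB tofracB. Qed.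
HB.instance Definition _ := GRing.isZmodMorphism.Build F laurent lconst lconst_zmod.

Lemma lconst_monoid : monoid_morphism lconst.
Proof.
by split=> [|a b]; apply/val_inj; rewrite /= ?polyC1 ?tofrac1 // polyCM tofracM.
Qed.
HB.instance Definition _ := GRing.isMonoidMorphism.Build F laurent lconst lconst_monoid.

Definition qexp (z : int) : laurent := Laurent (is_laurent_exp z).
Definition qvar : laurent := qexp 1.

Definition laurent_ring : comNzRingType := laurent.

End Laurent.


Section FreeAlgebra.
Variables (K : comNzRingType) (I : choiceType).

Lemma malg_scalerAr (c : K) (x y : {malg K[fmonom I]}) :
  c *: (x * y) = x * (c *: y).
Proof.
apply/malgP => k; apply: etrans (mcoeffZ c (x * y) k) _.
apply: etrans (congr1 ( *%R c) (mcoeffMl x y k)) _.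
rewrite (mcoeffMlw _ (finmap.fsubset_refl _) (msuppZ_le c y)) mulr_sumr.
apply: eq_bigr => m1 _; rewrite mulr_sumr; apply: eq_bigr => m2 _.
by rewrite mcoeffZ mulrnAr mulrCA.
Qed.

Definition freealg := {malg K[fmonom I]}.
HB.instance Definition _ := GRing.Lalgebra.on freealg.
HB.instance Definition _ := GRing.Lalgebra_isAlgebra.Build K freealg malg_scalerAr.

Definition gen (i : I) : freealg := << fmu i >>.

Section Eval.
Variables (A : algType K) (f : I -> A).

Definition word_eval (m : fmonom I) : A := \prod_(i <- fmonom_val m) f i.

Lemma word_eval_mmorphism : mmorphism word_eval.
Proof.
split=> [m1 m2|]; first by rewrite /word_eval fmM big_cat.
by rewrite /word_eval fm1 big_nil.
Qed.
HB.instance Definition _ := isMultiplicative.Build _ _ word_eval word_eval_mmorphism.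

Definition freealg_eval : freealg -> A := mmap (in_alg A) word_eval.

Lemma freealg_eval_zmod : zmod_morphism freealg_eval.
Proof. by move=> x y; rewrite /freealg_eval raddfB. Qed.
HB.instance Definition _ :=
  GRing.isZmodMorphism.Build freealg A freealg_eval freealg_eval_zmod.

Lemma freealg_eval_monoid : monoid_morphism freealg_eval.
Proof.
have [|M1 M2] := @commr_mmap_is_multiplicative _ _ _ (in_alg A) word_eval _.
  by move=> g m m'; rewrite /GRing.comm mulr_algl -scalerAr mulr1.
by split.
Qed.
HB.instance Definition _ :=
  GRing.isMonoidMorphism.Build freealg A freealg_eval freealg_eval_monoid.

Lemma freealg_eval_scalable : scalable freealg_eval.
Proof. by move=> c x; rewrite /freealg_eval mmapZ mulr_algl. Qed.
HB.instance Definition _ :=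
  GRing.isScalable.Build K freealg A *:%R freealg_eval freealg_eval_scalable.

Lemma freealg_eval_gen i : freealg_eval (gen i) = f i.
Proof. by rewrite /freealg_eval mmapU /= scale1r mul1r /word_eval fmU big_seq1. Qed.

End Eval.
End FreeAlgebra.

Section QuotientAlgebra.
Variables (K : comNzRingType) (A : algType K).

Definition two_sided (J : set A) : Prop :=
  [/\ J 0, forall x y, J x -> J y -> J (x + y) & forall a x b, J x -> J (a * x * b)].

Definition ideal_gen (X : set A) : {pred A} := fun a => `[< smallest two_sided X a >].

Lemma ideal_gen_two_sided X : two_sided (fun a => a \in ideal_gen X).
Proof.
split.
- by apply/asboolP => J [[J0 _ _] _].
- move=> x y /asboolP Jx /asboolP Jy; apply/asboolP => J JX.
  by case: (JX) => [[_ JD _] _]; apply: JD; [apply: Jx | apply: Jy].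
- move=> a x b /asboolP Jx; apply/asboolP => J JX.
  by case: (JX) => [[_ _ JM] _]; apply: JM; apply: Jx.
Qed.

Lemma ideal_gen_zmod X : zmod_closed (ideal_gen X).
Proof.
have [J0 JD JM] := ideal_gen_two_sided X; split=> // x y Jx Jy.
by apply: JD => //; have := JM (-1) y 1 Jy; rewrite mulN1r mulr1.
Qed.

HB.instance Definition _ X :=
  GRing.isZmodClosed.Build A (ideal_gen X) (ideal_gen_zmod X).

Definition proper_gens (X : set A) : Prop := 1 \notin ideal_gen X.

Variables (X : set A) (X_proper : proper_gens X).

(* The quotient of A by the two-sided ideal generated by X.  The ideal is
   required to be proper because an [algType] is never zero. *)
Definition quotalg of proper_gens X : Type := Quotient.quot (ideal_gen X).
Local Notation Q := (quotalg X_proper).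
HB.instance Definition _ := GRing.Zmodule.on Q.

Definition qproj (a : A) : Q := \pi_(Quotient.quot (ideal_gen X)) a.
Definition qrepr (x : Q) : A := generic_quotient.repr (x : Quotient.quot (ideal_gen X)).

Lemma qreprK : cancel qrepr qproj.
Proof. exact: reprK. Qed.

Lemma qprojP (a b : A) : reflect (qproj a = qproj b) (a - b \in ideal_gen X).
Proof. by rewrite Quotient.idealrBE; apply: eqP. Qed.

Lemma qproj_zmod : zmod_morphism qproj.
Proof. by move=> a b; rewrite /qproj !piE. Qed.
HB.instance Definition _ := GRing.isZmodMorphism.Build A Q qproj qproj_zmod.

Definition qone : Q := qproj 1.
Definition qmul (x y : Q) : Q := qproj (qrepr x * qrepr y).
Definition qscale (c : K) (x : Q) : Q := qproj (c *: qrepr x).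

Lemma qrepr_proj a : a - qrepr (qproj a) \in ideal_gen X.
Proof. by apply/qprojP; rewrite qreprK. Qed.

Lemma qprojM a b : qproj (a * b) = qmul (qproj a) (qproj b).
Proof.
have [_ JD JM] := ideal_gen_two_sided X.
apply/qprojP; set a' := qrepr _; set b' := qrepr _.
have -> : a * b - a' * b' = 1 * (a - a') * b + a' * (b - b') * 1.
  by rewrite mul1r mulr1 mulrBl mulrBr addrA subrK.
by apply: JD; apply: JM; apply: qrepr_proj.
Qed.

Lemma qprojZ c a : qproj (c *: a) = qscale c (qproj a).
Proof.
have [_ _ JM] := ideal_gen_two_sided X.
apply/qprojP; rewrite -scalerBr.
have := JM (c *: 1) _ 1 (qrepr_proj a).
by rewrite mulr1 -scalerAl mul1r.
Qed.

Lemma qind (P : Q -> Prop) : (forall a, P (qproj a)) -> forall x, P x.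
Proof. by move=> PA x; rewrite -[x]qreprK. Qed.

Lemma qmulA : associative qmul.
Proof.
by elim/qind=> a; elim/qind=> b; elim/qind=> c; rewrite -!qprojM mulrA.
Qed.
Lemma qmul1q : left_id qone qmul.
Proof. by elim/qind=> a; rewrite -qprojM mul1r. Qed.
Lemma qmulq1 : right_id qone qmul.
Proof. by elim/qind=> a; rewrite -qprojM mulr1. Qed.
Lemma qmulDl : left_distributive qmul +%R.
Proof.
elim/qind=> a; elim/qind=> b; elim/qind=> c.
by rewrite -raddfD -!qprojM -raddfD mulrDl.
Qed.
Lemma qmulDr : right_distributive qmul +%R.
Proof.
elim/qind=> a; elim/qind=> b; elim/qind=> c.
by rewrite -raddfD -!qprojM -raddfD mulrDr.
Qed.
Lemma qone_neq0 : qone != 0.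
Proof.
by apply: contra X_proper => /eqP; rewrite -(raddf0 qproj) => /qprojP; rewrite subr0.
Qed.
HB.instance Definition _ := GRing.Zmodule_isNzRing.Build Q
  qmulA qmul1q qmulq1 qmulDl qmulDr qone_neq0.

Lemma qscaleA a b x : qscale a (qscale b x) = qscale (a * b) x.
Proof. by elim/qind: x => x; rewrite -!qprojZ scalerA. Qed.
Lemma qscale1 : left_id 1 qscale.
Proof. by elim/qind=> x; rewrite -qprojZ scale1r. Qed.
Lemma qscaleDr : right_distributive qscale +%R.
Proof.
by move=> c; elim/qind=> x; elim/qind=> y; rewrite -raddfD -!qprojZ -raddfD scalerDr.
Qed.
Lemma qscaleDl x : {morph qscale^~ x : a b / a + b}.
Proof. by move=> a b; elim/qind: x => x; rewrite -!qprojZ -raddfD scalerDl. Qed.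
HB.instance Definition _ := GRing.Zmodule_isLmodule.Build K Q
  qscaleA qscale1 qscaleDr qscaleDl.

Lemma quotalg_scalerAl (c : K) (x y : Q) : c *: (x * y) = (c *: x) * y.
Proof.
elim/qind: x => x; elim/qind: y => y.
by rewrite -[LHS]/(qscale c (qmul _ _)) -[RHS]/(qmul (qscale _ _) _)
           -!(qprojM, qprojZ) scalerAl.
Qed.
HB.instance Definition _ := GRing.Lmodule_isLalgebra.Build K Q quotalg_scalerAl.

Lemma quotalg_scalerAr (c : K) (x y : Q) : c *: (x * y) = x * (c *: y).
Proof.
elim/qind: x => x; elim/qind: y => y.
by rewrite -[LHS]/(qscale c (qmul _ _)) -[RHS]/(qmul _ (qscale _ _))
           -!(qprojM, qprojZ) scalerAr.
Qed.
HB.instance Definition _ := GRing.Lalgebra_isAlgebra.Build K Q quotalg_scalerAr.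

Lemma qproj_monoid : monoid_morphism qproj.
Proof. by split=> // a b; rewrite qprojM. Qed.
HB.instance Definition _ := GRing.isMonoidMorphism.Build A Q qproj qproj_monoid.

Lemma qproj_scalable : scalable qproj.
Proof. by move=> c a; rewrite qprojZ. Qed.
HB.instance Definition _ := GRing.isScalable.Build K A Q *:%R qproj qproj_scalable.

Section Lift.
Variables (B : algType K) (f : {lrmorphism A -> B}).
Hypothesis fX : forall x, X x -> f x = 0.

Lemma ideal_gen_ker a : a \in ideal_gen X -> f a = 0.
Proof.
move=> /asboolP aX; apply: (aX (fun x => f x = 0)); split=> //.
split=> [|x y /= fx fy|b x c /= fx].
- exact: raddf0.
- by rewrite raddfD /= fx fy addr0.
- by rewrite !rmorphM /= fx mulr0 mul0r.
Qed.

Lemma quotalg_lift : exists g : {lrmorphism Q -> B}, forall a, g (qproj a) = f a.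
Proof.
pose g (x : Q) := f (qrepr x).
have gE a : g (qproj a) = f a.
  apply/eqP; rewrite eq_sym -subr_eq0 -raddfB /=; apply/eqP/ideal_gen_ker.
  exact: qrepr_proj.
have gB : zmod_morphism g.
  by elim/qind=> a; elim/qind=> b; rewrite -raddfB !gE raddfB.
have gM : monoid_morphism g.
  split; first by rewrite -[1](rmorph1 qproj) gE rmorph1.
  by elim/qind=> a; elim/qind=> b; rewrite -rmorphM !gE rmorphM.
have gZ : scalable g.
  by move=> c; elim/qind=> a; rewrite -[c *: _]linearZ !gE linearZ.
pose m1 := GRing.isZmodMorphism.Build Q B g gB.
pose m2 := GRing.isMonoidMorphism.Build Q B g gM.
pose m3 := GRing.isScalable.Build K Q B *:%R g gZ.
pose G : {lrmorphism Q -> B} := HB.pack g m1 m2 m3.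
by exists G.
Qed.

End Lift.
End QuotientAlgebra.

(* Algebras with a K-valued algebra morphism: this is how all the ideals used
   below are seen to be proper. *)
Definition augmented (K : comNzRingType) (A : algType K) : Prop :=
  exists eps : {lrmorphism A -> K^o}, True.

Lemma proper_augmented (K : comNzRingType) (A : algType K) (X : set A)
  (eps : {lrmorphism A -> K^o}) : (forall x, X x -> eps x = 0) -> proper_gens X.
Proof.
by move=> epsX; apply/negP => /(ideal_gen_ker epsX)/eqP; rewrite rmorph1 oner_eq0.
Qed.

(* The tensor product over K of algebras A_0, ..., A_(d-1).  It is generated by
   the symbols [a] for a in the product of the A_i; the first two families of
   relations turn the free algebra into the algebra of the multiplicative monoid
   of the product of the A_i, in which the multilinearity relations span a
   two-sided ideal, with quotient the usual tensor product. *)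
Section Tensor.
Variables (K : comNzRingType) (d : nat) (A : 'I_d -> algType K).

Definition tens_gen : choiceType := forall i, A i.

Inductive tens_rel : set (freealg K tens_gen) :=
| TensOne : tens_rel (gen K ((fun i => 1) : tens_gen) - 1)
| TensMul (a b : tens_gen) :
    tens_rel (gen K ((fun i => a i * b i) : tens_gen) - gen K a * gen K b)
| TensLin (a : tens_gen) (i : 'I_d) (c : K) (x y : A i) :
    tens_rel (gen K (dfwith a (c *: x + y) : tens_gen)
      - (c *: gen K (dfwith a x : tens_gen) + gen K (dfwith a y : tens_gen))).

Hypothesis augA : forall i, augmented (A i).

Lemma tens_aug : exists eps : {lrmorphism freealg K tens_gen -> K^o},
  forall x, tens_rel x -> eps x = 0.
Proof.
pose eps i : {lrmorphism A i -> K^o} := sval (cid (augA i)).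
pose f (a : tens_gen) : K^o := \prod_i eps i (a i).
exists (freealg_eval f) => _ [|a b|a i c x y];
  rewrite raddfB /= ?rmorphM ?rmorph1 /= ?freealg_eval_gen; apply/eqP; rewrite subr_eq0.
- by apply/eqP/big1 => i _; rewrite rmorph1.
- by rewrite /f -big_split; apply/eqP/eq_bigr => i _; rewrite rmorphM.
- have fE z : f (dfwith a z) = eps i z * \prod_(j | j != i) eps j (a j).
    rewrite /f (bigD1 i) //= dfwith_in; congr (_ * _).
    by apply: eq_bigr => j ji; rewrite dfwith_out // eq_sym.
  by rewrite (linearP (freealg_eval f) c) /= !freealg_eval_gen !fE linearP mulrDl scalerAl.
Qed.

Lemma tens_proper : proper_gens tens_rel.
Proof. by have [eps /proper_augmented] := tens_aug. Qed.

Definition tens : Type := quotalg tens_proper.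
HB.instance Definition _ := GRing.Algebra.on tens.

Definition ptens (a : forall i, A i) : tens :=
  qproj tens_proper (gen K (a : tens_gen)).

End Tensor.

Lemma quotalg_aug (K : comNzRingType) (A : algType K) (X : set A)
  (X_proper : proper_gens X) (eps : {lrmorphism A -> K^o}) :
  (forall x, X x -> eps x = 0) -> augmented (quotalg X_proper).
Proof. by move=> /(quotalg_lift X_proper)[e _]; exists e. Qed.

Definition is_subalg (K : comNzRingType) (A : algType K) (S : set A) : Prop :=
  [/\ S 1, forall (c : K) x y, S x -> S y -> S (c *: x + y)
    & forall x y, S x -> S y -> S (x * y)].


Section SymmetricGroup.
Variable n : nat.

(* The indices are 0-based: i : 'I_n.-1 and j : 'I_n stand for the indices i + 1
   of s, g, G and j + 1 of t. *)
Definition pos_lo (i : 'I_n.-1) : 'I_n := widen_ord (leq_pred n) i.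

Lemma pos_hi_subproof (i : 'I_n.-1) : (i.+1 < n)%N.
Proof. by case: i; case: n. Qed.
Definition pos_hi (i : 'I_n.-1) : 'I_n := Ordinal (pos_hi_subproof i).

Definition simple_refl (i : 'I_n.-1) : 'S_n := tperm (pos_lo i) (pos_hi i).

(* [u * v] in ['S_n] maps x to v (u x); here products are composed from right to
   left, so that permutations act on the left. *)
Definition pcomp (u v : 'S_n) : 'S_n := (v * u)%g.

Definition word_perm (s : seq 'I_n.-1) : 'S_n :=
  foldr (fun i w => pcomp (simple_refl i) w) 1%g s.

Lemma word_perm_cat s1 s2 : word_perm (s1 ++ s2) = pcomp (word_perm s1) (word_perm s2).
Proof.
by elim: s1 => [|i s1 /= ->]; rewrite /= /pcomp ?mulg1 ?mulgA.
Qed.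

Lemma word_tperm k (x y : 'I_n) : y = (x + k.+1)%N :> nat ->
  exists s, word_perm s = tperm x y.
Proof.
elim: k y => [|k IH] y yE.
  have xP : (x < n.-1)%N by move: (ltn_ord y); rewrite yE; lia.
  exists [:: Ordinal xP]; rewrite /= /pcomp mul1g /simple_refl.
  by rewrite (_ : pos_lo _ = x) 1?(_ : pos_hi _ = y) //; apply/val_inj; rewrite //= yE addn1.
have zP : (x + k.+1 < n.-1)%N by move: (ltn_ord y); rewrite yE; lia.
pose i := Ordinal zP.
have [s sE] := IH (pos_lo i) erefl.
exists (i :: s ++ [:: i]); rewrite /= word_perm_cat /= /pcomp mul1g sE.
have hiE : pos_hi i = y by apply: val_inj; rewrite /= yE; lia.
have sV : (simple_refl i)^-1%g = simple_refl i by rewrite /simple_refl tpermV.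
rewrite -{1}sV -mulgA -conjgE tpermJ /simple_refl tpermL hiE tpermD //.
- by rewrite -val_eqE /=; lia.
- by rewrite -val_eqE /= yE; lia.
Qed.

Lemma word_exists (w : 'S_n) : exists s, word_perm s = w.
Proof.
have tP x y : exists s, word_perm s = tperm x y.
  have [xy|yx|/val_inj->] := ltngtP x y.
  - by apply: (@word_tperm (y - x).-1); lia.
  - by rewrite tpermC; apply: (@word_tperm (x - y).-1); lia.
  - by exists [::]; rewrite tperm1.
have [ts -> _] := prod_tpermP w.
elim: ts => [|[x y] ts [s sE]]; first by exists [::]; rewrite big_nil.
have [s' s'E] := tP x y.
by exists (s ++ s'); rewrite word_perm_cat sE s'E big_cons.
Qed.

Definition has_word (w : 'S_n) (r : nat) : bool :=
  [exists s : r.-tuple 'I_n.-1, word_perm s == w].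

Lemma has_word_exists w : exists r, has_word w r.
Proof.
have [s sE] := word_exists w.
by exists (size s); apply/existsP; exists (in_tuple s); apply/eqP.
Qed.

Definition perm_length (w : 'S_n) : nat := ex_minn (has_word_exists w).

Lemma reduced_word_exists (w : 'S_n) :
  exists s : (perm_length w).-tuple 'I_n.-1, word_perm s == w.
Proof. by rewrite /perm_length; case: ex_minnP => r /existsP. Qed.

(* A reduced expression of w; by Matsumoto's theorem the elements g_w and G_w
   defined below do not depend on its choice. *)
Definition reduced_word (w : 'S_n) : seq 'I_n.-1 := xchoose (reduced_word_exists w).

Lemma odd_perm_length w : odd (perm_length w) = odd_perm w.
Proof.
have oddE s : odd_perm (word_perm s) = odd (size s).
  elim: s => [|i s IH] /=; first by rewrite odd_perm1.
  have lo_hi : pos_lo i != pos_hi i by rewrite -val_eqE /= neq_ltn ltnSn.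
  by rewrite /pcomp odd_permM IH odd_tperm lo_hi addbT.
rewrite /perm_length; case: ex_minnP => r /existsP[s /eqP<-] _.
by rewrite oddE size_tuple.
Qed.

End SymmetricGroup.


(* The element G_{1,2} or g_{1,2}. *)
Definition steinberg (A : nzRingType) (g1 g2 : A) : A :=
  1 + g1 + g2 + g1 * g2 + g2 * g1 + g1 * g2 * g1.

Section Augmentations.
Variables (K : comNzRingType) (A : algType K) (eps : {lrmorphism A -> K^o}).

Lemma augC x y : eps x * eps y = eps y * eps x.
Proof. exact: (@mulrC K). Qed.

Lemma aug_comm x y : eps (x * y - y * x) = 0.
Proof. by rewrite raddfB /= !rmorphM /= augC subrr. Qed.

Lemma aug_swap x y z : eps y = eps z -> eps (y * x - x * z) = 0.
Proof. by move=> yz; rewrite raddfB /= !rmorphM /= yz augC subrr. Qed.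

Lemma aug_braid x y : eps x = eps y -> eps (x * y * x - y * x * y) = 0.
Proof. by move=> xy; rewrite raddfB /= !rmorphM /= xy subrr. Qed.

Lemma aug_quad (q : K) (x e : A) : eps x = -1 -> eps e = 1 ->
  eps (x ^+ 2 - (q%:A + (q - 1) *: (e * x))) = 0.
Proof.
move=> x1 e1; rewrite raddfB /= raddfD /= rmorphXn /= !linearZ /= rmorphM /= rmorph1 x1 e1.
rewrite sqrrN expr1n mul1r /GRing.scale /= mulr1 mulrN1 opprB.
by rewrite addrCA -opprB addNr.
Qed.

Lemma aug_steinberg x y : eps x = -1 -> eps y = -1 -> eps (steinberg x y) = 0.
Proof.
move=> x1 y1; rewrite /steinberg !raddfD /= !rmorphM /= x1 y1 rmorph1.
by rewrite mulrNN !mulr1 mul1r subrr add0r addNr add0r subrr.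
Qed.

End Augmentations.

Section HeckeTL.
Variables (K : comNzRingType) (q : K) (m : nat).
Local Notation G := (@gen K ('I_m.-1)).

Inductive hecke_rel : set (freealg K 'I_m.-1) :=
| HeckeComm (i j : 'I_m.-1) : (i.+1 < j)%N || (j.+1 < i)%N ->
    hecke_rel (G i * G j - G j * G i)
| HeckeBraid (i j : 'I_m.-1) : j = i.+1 :> nat ->
    hecke_rel (G i * G j * G i - G j * G i * G j)
| HeckeQuad (i : 'I_m.-1) :
    hecke_rel (G i ^+ 2 - (q%:A + (q - 1) *: G i)).

Lemma free_sgn : exists eps : {lrmorphism freealg K 'I_m.-1 -> K^o},
  (forall i, eps (G i) = -1) /\ forall x, hecke_rel x -> eps x = 0.
Proof.
have [eps epsG] : exists eps : {lrmorphism freealg K 'I_m.-1 -> K^o},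
    forall i, eps (G i) = -1.
  by exists (freealg_eval (fun=> -1 : K^o)) => i; apply: freealg_eval_gen.
exists eps; split=> // _ [i j _|i j _|i].
- exact: aug_comm.
- by apply: aug_braid; rewrite !epsG.
- by have := aug_quad q (epsG i) (rmorph1 eps); rewrite mul1r.
Qed.

Lemma hecke_proper : proper_gens hecke_rel.
Proof. by have [eps [_ /proper_augmented]] := free_sgn. Qed.

Definition Hecke : Type := quotalg hecke_proper.
HB.instance Definition _ := GRing.Algebra.on Hecke.

Definition hgen (i : 'I_m.-1) : Hecke := qproj hecke_proper (G i).

Lemma hecke_sgn : exists eps : {lrmorphism Hecke -> K^o}, forall i, eps (hgen i) = -1.
Proof.
have [f [fG /(quotalg_lift hecke_proper)[e eE]]] := free_sgn.
by exists e => i; rewrite eE fG.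
Qed.

Lemma hecke_aug : augmented Hecke.
Proof. by have [e _] := hecke_sgn; exists e. Qed.

(* [hgenn j] is the generator G_j, with 1 <= j <= m - 1; other indices are not
   used. *)
Definition hgenn (j : nat) : Hecke := oapp hgen 1 (insub j.-1).

(* The relation exists only if m >= 3. *)
Inductive tl_rel : set Hecke :=
| TLrel (i j : 'I_m.-1) : i = 0%N :> nat -> j = 1%N :> nat ->
    tl_rel (steinberg (hgen i) (hgen j)).

Lemma tl_eps : exists eps : {lrmorphism Hecke -> K^o}, forall x, tl_rel x -> eps x = 0.
Proof.
have [e eE] := hecke_sgn; exists e => _ [i j _ _].
exact: aug_steinberg.
Qed.

Lemma tl_proper : proper_gens tl_rel.
Proof. by have [eps /proper_augmented] := tl_eps. Qed.

Definition TL : Type := quotalg tl_proper.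
HB.instance Definition _ := GRing.Algebra.on TL.

Lemma tl_aug : augmented TL.
Proof. by have [eps /(quotalg_aug tl_proper)] := tl_eps. Qed.

(* The sequence s lists the pairs (i_1, k_1), ..., (i_p, k_p). *)
Definition jones_seq (s : seq (nat * nat)) : bool :=
  [&& (size s <= m.-1)%N,
      all (fun x => (x.2 < x.1)%N && (x.1 <= m.-1)%N) s,
      sorted ltn [seq x.1 | x <- s]
    & sorted ltn [seq (x.1 - x.2)%N | x <- s]].

Definition jones_elt (s : seq (nat * nat)) : Hecke :=
  \prod_(x <- s) \prod_(t < x.2.+1) hgenn (x.1 - t)%N.

Definition jones_basis : set TL :=
  [set qproj tl_proper (jones_elt s) | s in [set s | jones_seq s]].

End HeckeTL.

Definition catalan (m : nat) : nat := ('C(m.*2, m) %/ m.+1)%N.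

Section YokonumaHecke.
(* [dinv] is 1 / d. *)
Variables (K : comNzRingType) (q : K) (d n : nat) (dinv : K).
Hypothesis dinvP : dinv * d%:R = 1.

(* [inl i] and [inr j] are the generators g_i and t_j. *)
Definition ygen : choiceType := ('I_n.-1 + 'I_n)%type.
Local Notation g i := (gen K (inl i : ygen)).
Local Notation t j := (gen K (inr j : ygen)).

(* As t_j ^ d = 1, t_j ^ (-s) is written t_j ^ (d - s). *)
Definition idem_e (A : algType K) (u : 'I_n -> A) (i : 'I_n.-1) : A :=
  dinv *: \sum_(s < d) u (pos_lo i) ^+ s * u (pos_hi i) ^+ (d - s).

Inductive yh_rel : set (freealg K ygen) :=
| YHcomm (i j : 'I_n.-1) : (i.+1 < j)%N || (j.+1 < i)%N ->
    yh_rel (g i * g j - g j * g i)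
| YHbraid (i j : 'I_n.-1) : j = i.+1 :> nat ->
    yh_rel (g i * g j * g i - g j * g i * g j)
| YHtt (i j : 'I_n) : yh_rel (t i * t j - t j * t i)
| YHtg (i : 'I_n.-1) (j : 'I_n) :
    yh_rel (t j * g i - g i * t (simple_refl i j))
| YHtd (j : 'I_n) : yh_rel (t j ^+ d - 1)
| YHquad (i : 'I_n.-1) :
    yh_rel (g i ^+ 2 - (q%:A + (q - 1) *: (idem_e (fun j => t j) i * g i))).

Lemma idem_e_morph (A B : algType K) (f : {lrmorphism A -> B}) u i :
  f (idem_e u i) = idem_e (fun j => f (u j)) i.
Proof.
rewrite /idem_e linearZ raddf_sum /=; congr (_ *: _); apply: eq_bigr => s _.
by rewrite rmorphM !rmorphXn.
Qed.

Lemma idem_e1 (i : 'I_n.-1) : idem_e (fun=> 1 : K^o) i = 1.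
Proof.
rewrite /idem_e (eq_bigr (fun=> 1)) => [|s _]; last by rewrite !expr1n mulr1.
rewrite sumr_const card_ord.
exact: dinvP.
Qed.

Lemma yh_sgn : exists eps : {lrmorphism freealg K ygen -> K^o},
  [/\ forall i, eps (g i) = -1, forall j, eps (t j) = 1
    & forall x, yh_rel x -> eps x = 0].
Proof.
pose f (x : ygen) : K^o := if x is inl _ then -1 else 1.
have [eps epsE] : exists eps : {lrmorphism freealg K ygen -> K^o},
    forall x, eps (gen K x) = f x.
  by exists (freealg_eval f) => x; apply: freealg_eval_gen.
have epsg i : eps (g i) = -1 := epsE (inl i).
have epst j : eps (t j) = 1 := epsE (inr j).
exists eps; split=> // _ [i j _|i j _|i j|i j|j|i].
- exact: aug_comm.
- by apply: aug_braid; rewrite !epsg.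
- exact: aug_comm.
- by apply: aug_swap; rewrite !epst.
- by rewrite raddfB /= rmorphXn /= epst expr1n rmorph1 subrr.
- apply: aug_quad => //; rewrite idem_e_morph -(idem_e1 i).
  by congr idem_e; apply/funext => j.
Qed.

Lemma yh_proper : proper_gens yh_rel.
Proof. by have [eps [_ _ /proper_augmented]] := yh_sgn. Qed.

Definition YH : Type := quotalg yh_proper.
HB.instance Definition _ := GRing.Algebra.on YH.

Definition yg (i : 'I_n.-1) : YH := qproj yh_proper (g i).
Definition yt (j : 'I_n) : YH := qproj yh_proper (t j).
Definition ye (i : 'I_n.-1) : YH := idem_e yt i.
Definition ygw (w : 'S_n) : YH := \prod_(i <- reduced_word w) yg i.

(* The relation exists only if n >= 3. *)
Inductive ftl_rel : set YH :=
| FTLrel (i j : 'I_n.-1) : i = 0%N :> nat -> j = 1%N :> nat ->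
    ftl_rel (ye i * ye j * steinberg (yg i) (yg j)).

Lemma ftl_proper : proper_gens ftl_rel.
Proof.
have [e [eg _ /(quotalg_lift yh_proper)[eps epsE]]] := yh_sgn.
apply: (@proper_augmented _ _ _ eps) => _ [i j _ _].
by rewrite rmorphM /= aug_steinberg ?mulr0 // epsE eg.
Qed.

Definition FTL : Type := quotalg ftl_proper.
HB.instance Definition _ := GRing.Algebra.on FTL.

(* The idempotent E_chi of the character chi with chi(t_j) = chi j. *)
Definition idem_chi (chi : 'I_n -> K) : YH :=
  \prod_(j < n) (dinv *: \sum_(s < d) chi j ^+ s *: yt j ^+ (d - s)).

End YokonumaHecke.


Definition Comp (d n : nat) : finType :=
  {mu : {ffun 'I_d -> 'I_n.+1} | (\sum_i mu i == n)%N}.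

Section Composition.
Variables (d n : nat) (mu : Comp d n).

Definition part (i : 'I_d) : nat := val mu i.

(* mu_1 + ... + mu_k *)
Definition psum (k : nat) : nat := (\sum_(i < d | i < k) part i)%N.

Definition nb_cosets : nat := (n`! %/ \prod_(i < d) (part i)`!)%N.

(* J^mu; the element i : 'I_n.-1 stands for i + 1 *)
Definition young_gens : {set 'I_n.-1} :=
  [set i : 'I_n.-1 | i.+1 \notin [seq psum k | k <- iota 1 d.-1]]%SET.

Definition young : {set 'S_n} := <<[set simple_refl i | i in young_gens]%SET>>%g.

Definition min_coset_reps : {set 'S_n} :=
  [set w | [forall u in young, (perm_length w <= perm_length (pcomp w u))%N]]%SET.

(* pi_1 = 1, pi_2, ... are the minimal length representatives of the left cosets
   of the Young subgroup, in any order. *)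
Definition coset_enum (pi : 'I_nb_cosets -> 'S_n) : Prop :=
  [/\ injective pi, forall w, w \in min_coset_reps <-> exists k, pi k = w
    & forall k : 'I_nb_cosets, k = 0%N :> nat -> pi k = 1%g].

End Composition.


Lemma laurent_dinvP (F : numFieldType) (d : nat) : (0 < d)%N ->
  (lconst d%:R^-1 : laurent_ring F) * d%:R = 1.
Proof.
move=> d_gt0; rewrite -(rmorph_nat (@lconst F)) -rmorphM mulVf ?rmorph1 //.
by rewrite pnatr_eq0 -lt0n.
Qed.

Section Morphisms.
Variables (F : numFieldType) (d n : nat) (d_gt0 : (0 < d)%N).
Local Notation K := (laurent_ring F).
Local Notation q := (qvar F : laurent_ring F).
Local Notation dinvP := (laurent_dinvP F d_gt0).

Definition Yq : Type := YH q n dinvP.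
HB.instance Definition _ := GRing.Algebra.on Yq.
Definition FTLq : Type := FTL q n dinvP.
HB.instance Definition _ := GRing.Algebra.on FTLq.
Definition ftl_proj (y : Yq) : FTLq := qproj (ftl_proper q n dinvP) y.
Definition Hq (m : nat) : Type := Hecke q m.
HB.instance Definition _ m := GRing.Algebra.on (Hq m).
Definition TLq (m : nat) : Type := TL q m.
HB.instance Definition _ m := GRing.Algebra.on (TLq m).
Definition tl_proj (m : nat) (h : Hq m) : TLq m := qproj (tl_proper q m) h.
Local Notation H := (Hq n).

Variables (xi : 'I_d -> F) (mu : Comp d n).
Local Notation m_mu := (nb_cosets mu).
Variable pi : 'I_m_mu -> 'S_n.

Definition Hgen (i : 'I_n.-1) : H := hgen q i.
Definition Hw (w : 'S_n) : H := \prod_(i <- reduced_word w) Hgen i.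

Definition Hmu : set H :=
  smallest (@is_subalg K H) [set Hgen i | i in [set i | i \in young_gens mu]].

Definition Hpart (i : 'I_d) : algType K := Hq (part mu i).
Definition TLpart (i : 'I_d) : algType K := TLq (part mu i).

Lemma Hpart_aug i : augmented (Hpart i).
Proof. exact: hecke_aug. Qed.
Lemma TLpart_aug i : augmented (TLpart i).
Proof. exact: tl_aug. Qed.

Definition Htens : Type := tens Hpart_aug.
HB.instance Definition _ := GRing.Algebra.on Htens.
Definition TLmu : Type := tens TLpart_aug.
HB.instance Definition _ := GRing.Algebra.on TLmu.

(* b_1 b_2 ... b_d in TL^mu *)
Definition TLtens (b : forall i, TLpart i) : TLmu := ptens TLpart_aug b.

Definition TLpart_basis (i : 'I_d) : set (TLpart i) := @jones_basis K q (part mu i).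

(* The morphism from the Hecke algebra of the i-th factor of the Young subgroup
   to H, shifting the indices of the generators. *)
Definition block_embed (i : 'I_d) (x : Hpart i) : H :=
  freealg_eval (fun j : 'I_(part mu i).-1 => hgenn q n (psum mu i + j.+1)%N : H)
    (qrepr (X_proper := hecke_proper q _) x).

(* The isomorphism from the tensor product of the Hecke algebras onto H^mu. *)
Definition Htens_iso (x : Htens) : H :=
  freealg_eval (fun b : tens_gen Hpart => \prod_(i < d) block_embed (b i))
    (qrepr (X_proper := tens_proper Hpart_aug) x).

Definition tens_proj (x : Htens) : TLmu :=
  freealg_eval (fun b : tens_gen Hpart => TLtens (fun i => tl_proj (b i)))
    (qrepr (X_proper := tens_proper Hpart_aug) x).

Definition rho (h : H) : TLmu := tens_proj (xget 0 [set x | Htens_iso x = h]).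

(* Characters of the group generated by the t_j, as functions j |-> chi(t_j). *)
Definition chi1 (j : 'I_n) : F :=
  if [pick i : 'I_d | (psum mu i <= j < psum mu i.+1)%N] is Some i then xi i else 1.

Definition act_chi (w : 'S_n) (chi : 'I_n -> F) : 'I_n -> F :=
  fun j => chi ((w^-1)%g j).

Definition chi (k : 'I_m_mu) : 'I_n -> F := act_chi (pi k) chi1.

Definition E_ (k : 'I_m_mu) : Yq :=
  idem_chi q dinvP (fun j => lconst (chi k j) : K).

Definition Emu : Yq := \sum_k E_ k.

Definition EmuY : set Yq := [set Emu * y | y in setT].

Definition EmuFTL : set FTLq := [set ftl_proj Emu * y | y in setT].

(* The exponent of q in the image of E_(chi_k) g_w by
   Psi_mu = U_mu tilde(Psi)_mu U_mu^-1: the conjugation by the diagonal matrix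
   U_mu multiplies the (k, l) entry by
   q^((perm_length (pi k) - perm_length (pi l)) / 2). *)
Definition conj_perm (k l : 'I_m_mu) (w : 'S_n) : 'S_n :=
  pcomp (pcomp (pi k)^-1%g w) (pi l).
Definition dbl_exponent (k l : 'I_m_mu) (w : 'S_n) : int :=
  (perm_length w)%:Z - (perm_length (conj_perm k l w))%:Z
  + ((perm_length (pi k))%:Z - (perm_length (pi l))%:Z).
Definition psi_exponent (k l : 'I_m_mu) (w : 'S_n) : int :=
  (dbl_exponent k l w %/ 2)%Z.

Lemma psi_exponentE k l w : dbl_exponent k l w = psi_exponent k l w * 2.
Proof.
rewrite /psi_exponent divzK // /dbl_exponent.
have := odd_perm_length (conj_perm k l w).
rewrite /conj_perm /pcomp !odd_permM odd_permV -!odd_perm_length.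
set a := perm_length w; set b := perm_length _; set c := perm_length (pi k).
set e := perm_length (pi l).
move=> bE; have : odd (a + b + c + e) = false.
  by rewrite !oddD bE; case: (odd a) (odd c) (odd e) => [] [] [].
by lia.
Qed.

Definition Mat (A : algType K) := 'M[A]_m_mu.

Definition scale_mat (A : algType K) (c : K) (M : Mat A) : Mat A :=
  map_mx (fun x => c *: x) M.

Definition is_Psi (f : Yq -> Mat H) : Prop :=
  (forall (c : K) x y, EmuY x -> EmuY y ->
     f (c *: x + y) = scale_mat c (f x) + f y)
  /\ (forall k l w, act_chi w (chi l) = chi k ->
        f (E_ k * (ygw q dinvP w : Yq)) =
        ((qexp F (psi_exponent k l w) : K) *: Hw (conj_perm k l w)) *: delta_mx k l).

(* The unique linear map on E_mu Y with the given values on the elements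
   E_(chi_k) g_w; its values outside E_mu Y are irrelevant. *)
Definition Psi : Yq -> Mat H := xget (fun=> 0) [set f | is_Psi f].

Definition Phi (M : Mat H) : Yq := xget 0 [set y | EmuY y /\ Psi y = M].

(* The unit of the algebra E_mu FTL is E_mu, and theta^mu is the restriction of
   [ftl_proj]. *)
Definition is_phi (f : Mat TLmu -> FTLq) : Prop :=
  [/\ forall M, EmuFTL (f M),
      forall (c : K) M N, f (scale_mat c M + N) = c *: f M + f N,
      f 1%:M = ftl_proj Emu,
      forall M N, f (M *m N) = f M * f N
    & forall M : Mat H, (forall k l, Hmu (M k l)) ->
        f (map_mx rho M) = ftl_proj (Phi M)].

Definition phi : Mat TLmu -> FTLq := xget (fun=> 0) [set f | is_phi f].

End Morphisms.

Definition is_basis (K : nzRingType) (V : lmodType K) (S : set V) : Prop :=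
  (forall v, exists (s : seq V) (c : V -> K),
     (forall x, x \in s -> S x) /\ v = \sum_(x <- s) c x *: x)
  /\ (forall (s : seq V) (c : V -> K), uniq s -> (forall x, x \in s -> S x) ->
        \sum_(x <- s) c x *: x = 0 -> forall x, x \in s -> c x = 0).

Definition free_of_rank (K : nzRingType) (V : lmodType K) (N : nat) : Prop :=
  exists e : N.-tuple V, uniq e /\ is_basis [set x | x \in e].

(* Main.v *)
Require Import Defs.
From HB Require Import structures.
From mathcomp Require Import all_boot all_order all_algebra all_fingroup.
From mathcomp Require Import boolp classical_sets reals complex monalg.
From mathcomp Require Import zify ring.

(* The idempotent E_1 of the character chi_1^mu commutes with the g_j, j in J^mu, and
   the g_j E_1 satisfy the Hecke relations; multiplying by the g_(pi_k) E_1 on the left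
   and by the E_1 g_(pi_k)^-1 on the right gives a map from the matrices over the tensor
   product of the H_(mu_i) to Y.  Conversely Y acts on the free module over this tensor
   product with basis the colorings of {1, ..., n} having mu_i points of color i.  These
   two maps are inverse isomorphisms between E_mu Y and the matrices, the second one
   being Psi_mu.  The generator e_1 e_2 g_{1,2} of the ideal kills a coloring unless it is
   constant on {1, 2, 3}, in which case it acts by the Steinberg element of one factor;
   hence both maps descend to E_mu FTL and the matrices over TL^mu.  As 1 is the sum of
   the orthogonal E_mu, the algebra FTL is the direct sum of these matrix algebras, and
   its basis comes from the bases of the TL_m.
   The Jones elements span TL_m because a word which is not in Jones normal form can be
   shortened; they are independent because in the action of TL_m on words of particles
   and holes their matrices are triangular for a suitable choice of one entry each. *)

Set Implicit Arguments.
Unset Strict Implicit.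
Unset Printing Implicit Defensive.

Import GRing.Theory.
Local Open Scope classical_set_scope.
Local Open Scope quotient_scope.
Local Open Scope ring_scope.
(* not the composition of partial functions of ssrfun *)
Local Notation pcomp := Defs.pcomp.

(** * Lengths and reduced words *)

(** The Hecke algebra of a block is unital, while the elements [g_j E_1] live in the corner cut out
    by [E_1]; the map from the tensor product to Y is made unital by letting the generators act by
    -1 on the complement [1 - E_1]. The sign is the right choice because the Steinberg element
    vanishes there, so the map can descend to TL^mu. The weights q (increasing colors) and 1
    (decreasing colors) in the action on colorings are those that conjugation by U_mu produces, and
    they avoid the square root of q. The maps [rho], [Psi], [Phi] and [phi] of the statement are
    defined by a choice among the objects with given properties, so each is identified by an
    existence and a uniqueness argument: [rho] needs the injectivity of the map from the tensor
    product to H_n, obtained from an action of H_n on the module induced from the blocks; [Psi]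
    needs that the products [E_chi g_w] span Y; [phi] needs that every matrix over TL^mu lifts to
    H^mu. The actions of Y and H_n on colorings, and of H_n on particles and holes, are instances of
    one computation with a parameter [c]. *)

Section Length.
Variable n : nat.
Implicit Types (u w : 'S_n) (i j : 'I_n.-1) (s : seq 'I_n.-1).
Local Notation sr := (@simple_refl n).
Local Notation plen := (@perm_length n).

Lemma simple_reflE i (x : 'I_n) :
  sr i x = (if x == i :> nat then i.+1 else if x == i.+1 :> nat then nat_of_ord i else x) :> nat.
Proof.
by rewrite /simple_refl permE /= -!val_eqE /=; case: ifP => // ?; case: ifP.
Qed.

Lemma simple_refl_lt i (u v : 'I_n) : (sr i u < sr i v)%N =
  (u < v)%N && ~~ ((u == pos_lo i) && (v == pos_hi i))
  || (u == pos_hi i) && (v == pos_lo i).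
Proof.
rewrite !simple_reflE -!val_eqE /=.
by do ![case: ifP]; lia.
Qed.

Lemma pcompw1 w : pcomp w 1%g = w. Proof. by rewrite /pcomp mul1g. Qed.
Lemma pcompA : associative (@pcomp n).
Proof. by move=> u v w; rewrite /pcomp mulgA. Qed.
Lemma pcompE u w (x : 'I_n) : pcomp u w x = u (w x).
Proof. by rewrite /pcomp permM. Qed.
Lemma pcompV u w : (pcomp u w)^-1%g = pcomp w^-1%g u^-1%g.
Proof. by rewrite /pcomp invMg. Qed.
Lemma simple_reflV i : (sr i)^-1%g = sr i.
Proof. exact: tpermV. Qed.
Lemma pcompsK i : involutive (pcomp (sr i)).
Proof. by move=> w; rewrite pcompA /pcomp /simple_refl tperm2 mulg1. Qed.

Lemma simple_refl_far i j : (i.+1 < j)%N || (j.+1 < i)%N ->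
  pcomp (sr i) (sr j) = pcomp (sr j) (sr i).
Proof.
move=> ij; apply/permP => x; apply/val_inj; rewrite /= !pcompE !simple_reflE.
by do ![case: ifP]; lia.
Qed.

Lemma simple_refl_braid i j : j = i.+1 :> nat ->
  pcomp (sr i) (pcomp (sr j) (sr i)) = pcomp (sr j) (pcomp (sr i) (sr j)).
Proof.
move=> ij; apply/permP => x; apply/val_inj; rewrite /= !pcompE !simple_reflE.
by do ![case: ifP]; lia.
Qed.

Definition inversions w : {set 'I_n * 'I_n} :=
  [set p : 'I_n * 'I_n | (p.1 < p.2)%N && (w p.2 < w p.1)%N]%SET.
Definition ninv w : nat := #|inversions w|.

(** The values [i] and [i + 1] of [w] stand in their natural order. By [ninv_asc] this is the
    condition under which left multiplication by [s_i] lengthens [w], which is why the inverse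
    occurs. *)
Definition asc i w : bool := (w^-1%g (pos_lo i) < w^-1%g (pos_hi i))%N.

Lemma ascNE i w : asc i w = false -> (w^-1%g (pos_hi i) < w^-1%g (pos_lo i))%N.
Proof.
move=> /negbT; rewrite -leqNgt leq_eqVlt => /orP[/eqP/val_inj/perm_inj|//].
by move/(congr1 val) => /=; lia.
Qed.

Lemma asc_simple i w : asc i (pcomp (sr i) w) = ~~ asc i w.
Proof.
rewrite /asc pcompV simple_reflV !pcompE /simple_refl tpermL tpermR.
case: ltngtP => // /val_inj/perm_inj/(congr1 val) /=; lia.
Qed.

Lemma inv_eq w (x y : 'I_n) : (w x == y) = (x == w^-1%g y).
Proof. by apply/eqP/eqP => [<-|->]; rewrite ?permK ?permKV. Qed.

(** Left multiplication by [s_i] exchanges two consecutive values, so the only pair of positions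
    whose order changes is [p0], the pair where these values are taken. *)
Lemma ninv_asc i w : asc i w -> ninv (pcomp (sr i) w) = (ninv w).+1.
Proof.
move=> ai; set p0 := (w^-1%g (pos_lo i), w^-1%g (pos_hi i)).
have -> : ninv (pcomp (sr i) w) = #|p0 |: inversions w|.
  apply: eq_card => -[x y]; rewrite !inE !pcompE /= simple_refl_lt xpair_eqE !inv_eq.
  move: ai; rewrite /asc.
  case: eqP => [->|_]; case: eqP => [->|_];
  case: eqP => [->|_]; case: eqP => [->|_] /=; rewrite ?andbT ?andbF ?orbT ?orbF //; lia.
move: ai; rewrite /asc cardsU1 inE /p0 /= !permKV /= => ->; by rewrite ltnNge leqnSn.
Qed.

(** The inverse of [w] is then strictly increasing, and an increasing map of an interval to itself
    is squeezed: [lo] bounds it below by induction from the left end, [hi] bounds it above by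
    induction from the right end. *)
Lemma asc_all_id w : (forall i, asc i w) -> w = 1%g.
Proof.
move=> aw; rewrite -[w]invgK; suff -> : w^-1%g = 1%g by rewrite invg1.
move: aw; rewrite /asc; set v := w^-1%g => aw.
have step (x y : 'I_n) : y = x.+1 :> nat -> (v x < v y)%N.
  move=> yx; have xP : (x < n.-1)%N by move: (ltn_ord y); lia.
  have := aw (Ordinal xP); congr (v _ < v _)%N; apply/val_inj => //=.
have lo : forall k (x : 'I_n), x = k :> nat -> (x <= v x)%N.
  elim=> [|k IH] x xk; first by rewrite xk.
  have kn : (k < n)%N by move: (ltn_ord x); lia.
  have := IH (Ordinal kn) erefl; have := step (Ordinal kn) x xk; rewrite /=; lia.
have hi : forall k (x : 'I_n), (x + k = n.-1)%N -> (v x + k <= n.-1)%N.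
  elim=> [|k IH] x xk; first by move: (ltn_ord (v x)); lia.
  have kn : (x.+1 < n)%N by lia.
  have := IH (Ordinal kn); have := step x (Ordinal kn) erefl; rewrite /=; lia.
apply/permP => x; rewrite perm1; apply/val_inj.
have := lo x x erefl; have := hi (n.-1 - x)%N x; move: (ltn_ord x) => /=; lia.
Qed.

(** Bubble sort: each descent that is removed lowers the number of inversions by exactly one. *)
Lemma word_of_inversions w : exists s, word_perm s = w /\ size s = ninv w.
Proof.
move: {2}(ninv w) (leqnn (ninv w)) => r; elim: r w => [|r IH] w wr.
  exists [::]; suff -> : w = 1%g.
    split=> //; apply/esym/eqP; rewrite cards_eq0; apply/eqP/setP => -[x y].
    by rewrite !inE !perm1 /=; lia.
  apply: asc_all_id => i; case: (boolP (asc i w)) => //.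
  by rewrite -asc_simple => /ninv_asc; rewrite pcompsK; lia.
case: (pselect (forall i, asc i w)) => [/asc_all_id->|].
  exists [::]; split=> //; apply/esym/eqP; rewrite cards_eq0; apply/eqP/setP => -[x y].
  by rewrite !inE !perm1 /=; lia.
move/existsNP => [i /negP]; rewrite -asc_simple => /ninv_asc; rewrite pcompsK => wE.
have [|s [sE ss]] := IH (pcomp (sr i) w); first by lia.
by exists (i :: s); rewrite /= sE pcompsK ss wE.
Qed.

Lemma ninv_word s : (ninv (word_perm s) <= size s)%N.
Proof.
elim: s => [|i s IH] /=.
  rewrite leqn0 cards_eq0; apply/eqP/setP => -[x y]; rewrite !inE !perm1 /=; lia.
case: (boolP (asc i (word_perm s))) => [/ninv_asc->//|].
by rewrite -asc_simple => /ninv_asc; rewrite pcompsK; lia.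
Qed.

Lemma perm_lengthE w : plen w = ninv w.
Proof.
rewrite /perm_length; case: ex_minnP => r /existsP[t /eqP tw] min.
apply/eqP; rewrite eqn_leq andbC.
have := ninv_word t; rewrite tw size_tuple => -> /=.
have [s [sw <-]] := word_of_inversions w; apply: min.
by apply/existsP; exists (in_tuple s); apply/eqP.
Qed.

Lemma perm_length_asc i w : asc i w -> plen (pcomp (sr i) w) = (plen w).+1.
Proof. by rewrite !perm_lengthE => /ninv_asc. Qed.

Lemma perm_length_desc i w : ~~ asc i w -> plen w = (plen (pcomp (sr i) w)).+1.
Proof. by rewrite -asc_simple => /perm_length_asc; rewrite pcompsK. Qed.

Lemma perm_length1 : plen 1%g = 0%N.
Proof. by apply/eqP; rewrite perm_lengthE -leqn0; apply: (ninv_word [::]). Qed.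

Definition reduced s : bool := size s == plen (word_perm s).

Lemma reduced_wordP w : reduced (reduced_word w) /\ word_perm (reduced_word w) = w.
Proof.
have /eqP E := xchooseP (reduced_word_exists w).
by rewrite /reduced /reduced_word E size_tuple eqxx.
Qed.

Lemma perm_length_word s : (plen (word_perm s) <= size s)%N.
Proof. by rewrite perm_lengthE ninv_word. Qed.

Lemma word_perm_rev s : word_perm (rev s) = (word_perm s)^-1%g.
Proof.
elim: s => [|i s IH]; first by rewrite invg1.
rewrite rev_cons -cats1 word_perm_cat IH /= /pcomp invMg mul1g.
by rewrite -[in LHS]simple_reflV.
Qed.

Lemma perm_lengthV w : plen w^-1%g = plen w.
Proof.
suff le v : (plen v^-1%g <= plen v)%N by apply/eqP; rewrite eqn_leq le -{1}(invgK w) le.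
have [rv vE] := reduced_wordP v.
rewrite -{1}vE -word_perm_rev; apply: leq_trans (perm_length_word _) _.
by rewrite size_rev (eqP rv) vE.
Qed.

Lemma reduced_cons i s : reduced (i :: s) -> reduced s && asc i (word_perm s).
Proof.
rewrite /reduced /=; case: (boolP (asc i _)) => [/perm_length_asc->|/perm_length_desc E].
  by rewrite eqSS andbT.
by move/eqP => E'; move: (perm_length_word s); lia.
Qed.

Lemma cons_reduced i s : reduced s -> asc i (word_perm s) -> reduced (i :: s).
Proof. by rewrite /reduced /= => /eqP-> /perm_length_asc->. Qed.

(** * Matsumoto's theorem *)

Section Matsumoto.
Variables (A : nzRingType) (f : 'I_n.-1 -> A).
Hypothesis f_far : forall i j, (i.+1 < j)%N || (j.+1 < i)%N -> f i * f j = f j * f i.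
Hypothesis f_braid : forall i j, j = i.+1 :> nat ->
  f i * f j * f i = f j * f i * f j.

(** Two left descents can be removed together. If the letters are adjacent, the three values
    concerned occur in decreasing order in [w], so that three letters can be stripped; otherwise the
    two descents do not interact. *)
Lemma asc_word_braid i j w : i != j -> ~~ asc i w -> ~~ asc j w ->
  if (i.+1 < j)%N || (j.+1 < i)%N then ~~ asc j (pcomp (sr i) w)
  else ~~ asc j (pcomp (sr i) w) && ~~ asc i (pcomp (sr j) (pcomp (sr i) w)).
Proof.
rewrite -val_eqE /= => ij /negPf/ascNE di /negPf/ascNE dj.
rewrite /asc !pcompV !simple_reflV !pcompE; case: ifP => far.
  have E x : (x == pos_lo j) || (x == pos_hi j) -> sr i x = x.
    move=> xj; apply/val_inj; rewrite /simple_refl permE /= -!val_eqE /=.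
    by move: xj; rewrite -!val_eqE /=; do 2?[case: ifP => /= ?]; lia.
  by rewrite !E ?eqxx ?orbT // -leqNgt ltnW.
have [ji|ji] : j = i.+1 :> nat \/ i = j.+1 :> nat by lia.
  have hl : pos_hi i = pos_lo j by apply/val_inj.
  have E1 : sr i (pos_lo j) = pos_lo i by rewrite -hl /simple_refl tpermR.
  have E2 : sr i (pos_hi j) = pos_hi j.
    by rewrite /simple_refl tpermD // -val_eqE /=; lia.
  have E3 : sr j (pos_lo i) = pos_lo i.
    by rewrite /simple_refl tpermD // -val_eqE /=; lia.
  have E4 : sr j (pos_hi i) = pos_hi j by rewrite hl /simple_refl tpermL.
  rewrite E1 E2 E3 E4 E2 /simple_refl tpermL hl; move: di dj; rewrite hl; lia.
have hl : pos_hi j = pos_lo i by apply/val_inj.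
have E1 : sr i (pos_hi j) = pos_hi i by rewrite hl /simple_refl tpermL.
have E2 : sr i (pos_lo j) = pos_lo j.
  by rewrite /simple_refl tpermD // -val_eqE /=; lia.
have E3 : sr j (pos_hi i) = pos_hi i.
  by rewrite /simple_refl tpermD // -val_eqE /=; lia.
have E4 : sr j (pos_lo i) = pos_lo j by rewrite -hl /simple_refl tpermR.
rewrite E1 E2 E3 E4 E2 /simple_refl tpermR; move: di dj; rewrite -hl; lia.
Qed.

(** Induction on the length. If the first letters [i] and [j] differ, both are descents of the
    common permutation, which therefore has reduced words beginning with the two sides of the
    relation between [s_i] and [s_j]; the induction hypothesis compares each given word with one of
    them. *)
Lemma matsumoto s s' : reduced s -> reduced s' -> word_perm s = word_perm s' ->
  \prod_(i <- s) f i = \prod_(i <- s') f i.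
Proof.
move: {2}(size s) (leqnn (size s)) => r; elim: r s s' => [|r IH] s s' sr_ rs rs' ss'.
  move: sr_; rewrite leqn0 => /nilP E; move: rs'; rewrite /reduced -ss' E /=.
  by rewrite perm_length1 => /nilP->.
case: s s' => [|i u] [|j v] // in sr_ rs rs' ss' *.
- by move: rs'; rewrite /reduced -ss' /= perm_length1.
- by move: rs; rewrite /reduced ss' /= perm_length1.
have /andP[ru ai] := reduced_cons rs; have /andP[rv aj] := reduced_cons rs'.
have sizeuv : size u = size v.
  by move: rs rs'; rewrite /reduced -ss' => /eqP<- /eqP[].
have uE : word_perm u = pcomp (sr i) (word_perm (i :: u)) by rewrite /= pcompsK.
have vE : word_perm v = pcomp (sr j) (word_perm (i :: u)) by rewrite ss' /= pcompsK.
rewrite !big_cons; case: (eqVneq i j) => [ij|ij].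
  rewrite ij; congr (_ * _); apply: IH => //; rewrite ?uE ?vE ?ij //; apply: sr_.
set w := word_perm (i :: u) in uE vE.
have di : ~~ asc i w by rewrite -asc_simple -uE.
have dj : ~~ asc j w by rewrite -asc_simple -vE.
have := asc_word_braid ij di dj; rewrite eq_sym in ij.
have := asc_word_braid ij dj di; rewrite orbC; case: ifP => far.
  move=> dji dij; set w' := pcomp (sr j) (pcomp (sr i) w).
  have [rw wE] := reduced_wordP w'; set t := reduced_word w' in rw wE.
  have rj : reduced (j :: t) by apply: cons_reduced rw _; rewrite wE asc_simple.
  have w'E : w' = pcomp (sr i) (pcomp (sr j) w).
    by rewrite /w' !pcompA simple_refl_far // orbC.
  have ri : reduced (i :: t) by apply: cons_reduced rw _; rewrite wE w'E asc_simple.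
  rewrite (IH u (j :: t)) //; last by rewrite uE /= wE /w' pcompsK.
  rewrite (IH v (i :: t)) //; first 1 last.
  - by rewrite -sizeuv.
  - by rewrite vE /= wE w'E pcompsK.
  by rewrite !big_cons !mulrA f_far // orbC.
move=> /andP[dji dj'] /andP[dij di'].
have near : j = i.+1 :> nat \/ i = j.+1 :> nat by move: ij far; rewrite -val_eqE /=; clear; lia.
(* What remains when the longest element of the subgroup generated by [s_i] and [s_j] is removed on
   the left. *)
set w' := pcomp (sr i) (pcomp (sr j) (pcomp (sr i) w)).
have w'E : w' = pcomp (sr j) (pcomp (sr i) (pcomp (sr j) w)).
  have E : pcomp (sr i) (pcomp (sr j) (sr i)) = pcomp (sr j) (pcomp (sr i) (sr j)).
    by case: near => /simple_refl_braid.
  by rewrite /w' (pcompA (sr j)) pcompA E !pcompA.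
have [rw wE] := reduced_wordP w'; set t := reduced_word w' in rw wE.
have rjt : reduced (j :: i :: t).
  apply: cons_reduced; first by apply: cons_reduced rw _; rewrite wE asc_simple.
  by rewrite /= wE /w' pcompsK asc_simple.
have rit : reduced (i :: j :: t).
  apply: cons_reduced; first by apply: cons_reduced rw _; rewrite wE w'E asc_simple.
  by rewrite /= wE w'E pcompsK asc_simple.
rewrite (IH u (j :: i :: t)) //; last by rewrite uE /= wE /w' !pcompsK.
rewrite (IH v (i :: j :: t)) //; first 1 last.
- by rewrite -sizeuv.
- by rewrite vE /= wE w'E !pcompsK.
by rewrite !big_cons !mulrA; case: near => /f_braid->.
Qed.

(** With the generators of Y or of H_n as [f] this unfolds to [ygw] or [Hw]; independence of the
    reduced word is [wprod_reduced]. *)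
Definition wprod w : A := \prod_(i <- reduced_word w) f i.

Lemma wprod_reduced s : reduced s -> wprod (word_perm s) = \prod_(i <- s) f i.
Proof.
by have [? ?] := reduced_wordP (word_perm s) => ?; apply: matsumoto.
Qed.

Lemma wprod1 : wprod 1%g = 1.
Proof.
have := @wprod_reduced [::]; rewrite big_nil; apply.
by rewrite /reduced /= perm_length1.
Qed.

Lemma wprod_asc i w : asc i w -> wprod (pcomp (sr i) w) = f i * wprod w.
Proof.
have [rw wE] := reduced_wordP w => ai.
have := @wprod_reduced (i :: reduced_word w); rewrite /= wE big_cons; apply.
by apply: cons_reduced rw _; rewrite wE.
Qed.

Lemma wprod_asc_right i w : (w (pos_lo i) < w (pos_hi i))%N ->
  wprod (pcomp w (sr i)) = wprod w * f i.
Proof.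
have [rw wE] := reduced_wordP w => ai.
have wsE : word_perm (reduced_word w ++ [:: i]) = pcomp w (sr i).
  by rewrite word_perm_cat wE /= pcompw1.
rewrite -wsE wprod_reduced ?big_cat ?big_seq1 //.
rewrite /reduced wsE size_cat addn1 -perm_lengthV pcompV simple_reflV.
rewrite perm_length_asc /asc ?invgK // perm_lengthV eqSS.
by move: rw; rewrite /reduced wE.
Qed.

End Matsumoto.
End Length.

(** * Blocks and coset representatives *)

Section Blocks.
Variables (d n : nat) (mu : Comp d n).
Local Notation sr := (@simple_refl n).
Local Notation psum := (psum mu).
Local Notation part := (part mu).

Lemma psumS (i : 'I_d) : psum i.+1 = (psum i + part i)%N.
Proof.
rewrite /Defs.psum (bigD1 i) //= addnC; congr (_ + _)%N; apply: eq_bigl => j.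
by rewrite ltnS ltn_neqAle andbC.
Qed.

Lemma psum_le a b : (a <= b)%N -> (psum a <= psum b)%N.
Proof.
move=> ab; rewrite /Defs.psum [leqRHS](bigID (fun i : 'I_d => i < a)%N) /=.
apply: leq_trans (leq_addr _ _); rewrite leq_eqVlt; apply/orP; left; apply/eqP.
by apply: eq_bigl => i; rewrite andbC; case: ltnP => //= ia; rewrite (leq_trans ia).
Qed.

Lemma psum0 : psum 0 = 0%N.
Proof. by rewrite /Defs.psum big_pred0. Qed.

Lemma psum_d : psum d = n.
Proof.
rewrite /Defs.psum (eq_bigl predT) => [|i]; last by rewrite ltn_ord.
exact/eqP/(valP mu).
Qed.

Lemma psum_le_n a : (psum a <= n)%N.
Proof.
case: (leqP a d) => [/psum_le|da]; first by rewrite psum_d.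
rewrite -[leqRHS]psum_d leq_eqVlt; apply/orP; left; apply/eqP; apply: eq_bigl => i.
by rewrite ltn_ord (ltn_trans _ da).
Qed.

Lemma blk_exists (j : 'I_n) : exists i : 'I_d, (psum i <= j < psum i.+1)%N.
Proof.
have H : exists k, (j < psum k)%N by exists d; rewrite psum_d.
case: (ex_minnP H) => -[|k] jk min; first by move: jk; rewrite psum0.
have kd : (k < d)%N by apply: min; rewrite psum_d.
exists (Ordinal kd); rewrite jk andbT /= leqNgt; apply/negP => /min.
by rewrite ltnn.
Qed.

Definition blk (j : 'I_n) : 'I_d := xchoose (blk_exists j).

Lemma blkP j : (psum (blk j) <= j < psum (blk j).+1)%N.
Proof. exact: xchooseP (blk_exists j). Qed.

Lemma blk_unique (i : 'I_d) (j : 'I_n) : (psum i <= j < psum i.+1)%N -> blk j = i.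
Proof.
move=> /andP[ij ji]; have /andP[bj jb] := blkP j; apply/val_inj => /=.
case: (ltngtP (blk j) i) => // lt.
  by have := leq_trans jb (psum_le lt); rewrite ltnNge ij.
by have := leq_trans ji (psum_le lt); rewrite ltnNge bj.
Qed.

Lemma blk_le (j j' : 'I_n) : (j <= j')%N -> (blk j <= blk j')%N.
Proof.
move=> jj'; have /andP[bj jb] := blkP j; have /andP[bj' jb'] := blkP j'.
rewrite leqNgt; apply/negP => /psum_le lt.
by have := leq_trans jb' (leq_trans lt bj); rewrite ltnNge jj'.
Qed.

Lemma blk_between (x y z : 'I_n) : (x <= y <= z)%N -> blk x = blk z -> blk y = blk z.
Proof.
move=> /andP[/blk_le xy /blk_le yz] xz; apply/val_inj/eqP => /=.
by rewrite eqn_leq yz -xz.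
Qed.

Lemma chi1E (F : numFieldType) (xi : 'I_d -> F) j : chi1 xi mu j = xi (blk j).
Proof.
rewrite /chi1; case: pickP => [i /blk_unique->//|/(_ (blk j))].
by rewrite blkP.
Qed.

Lemma young_gensE (i : 'I_n.-1) :
  (i \in young_gens mu) = (blk (pos_lo i) == blk (pos_hi i)).
Proof.
have /andP[bl lb] := blkP (pos_lo i); have /andP[bh hb] := blkP (pos_hi i).
rewrite inE; apply/idP/eqP => [/mapP H|E]; last first.
  apply/mapP => -[k _ ik]; move: hb; rewrite /= ik -E.
  case: (leqP k (blk (pos_lo i))) => [/psum_le|/psum_le].
    by move: bl => /=; lia.
  by rewrite ltnNge => ->.
apply/val_inj/eqP; rewrite eqn_leq blk_le /= ?leqnSn // leqNgt; apply/negP => lt.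
apply: H; exists (blk (pos_lo i)).+1.
  by rewrite mem_iota; have := ltn_ord (blk (pos_hi i)); lia.
by apply/eqP; rewrite eqn_leq lb /= (leq_trans (psum_le lt)).
Qed.

Lemma young_blk u x : u \in young mu -> blk (u x) = blk x.
Proof.
pose S := [set u : 'S_n | [forall x, blk (u x) == blk x]]%SET.
have gS : group_set S.
  apply/group_setP; split=> [|v w]; first by rewrite inE; apply/forallP => y; rewrite perm1.
  rewrite !inE => /forallP Sv /forallP Sw; apply/forallP => y.
  by rewrite permM (eqP (Sw _)) Sv.
have : young mu \subset group gS.
  rewrite gen_subG; apply/fintype.subsetP => v vY.
  have [i + ->] := @finset.imsetP _ _ _ _ _ vY; rewrite young_gensE => /eqP bi.
  rewrite inE; apply/forallP => y; rewrite /simple_refl.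
  by case: tpermP => [->|->|_ _]; rewrite ?bi.
by move=> /fintype.subsetP H /H; rewrite inE => /forallP/(_ x)/eqP.
Qed.

Definition block_increasing (w : 'S_n) : Prop :=
  forall x y : 'I_n, blk x = blk y -> (x < y)%N -> (w x < w y)%N.

(** If [w] decreased at two neighboring points of a block, right multiplication by the corresponding
    [s_i] of the Young subgroup would shorten it. Blocks being intervals, neighbors give all pairs
    by induction on the distance. *)
Lemma min_coset_rep_increasing w : w \in min_coset_reps mu -> block_increasing w.
Proof.
rewrite inE => /forallP min.
have adj i : blk (pos_lo i) = blk (pos_hi i) -> (w (pos_lo i) < w (pos_hi i))%N.
  move=> bi; have iY : sr i \in young mu.
    by apply/mem_gen/imset_f; rewrite young_gensE bi.
  have := min (sr i); rewrite iY /= -[X in (X <= _)%N]perm_lengthV.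
  rewrite -[X in (_ <= X)%N]perm_lengthV pcompV simple_reflV.
  case: (boolP (asc i w^-1%g)); first by rewrite /asc invgK.
  by move/perm_length_desc => ->; rewrite ltnn.
move=> x y; move: {2}(y - x)%N (erefl (y - x)%N) => r; elim: r y => [|r IH] y yx bxy xy.
  by move: xy; rewrite -subn_gt0 yx.
have iP : (y.-1 < n.-1)%N by move: (ltn_ord y) xy; clear; lia.
pose i := Ordinal iP.
have yE : y = pos_hi i by apply/val_inj; rewrite /=; move: xy; clear; lia.
have bi : blk (pos_lo i) = blk (pos_hi i).
  rewrite -yE; apply: (@blk_between x); rewrite //=; move: xy; clear; lia.
have := adj i bi; rewrite -yE.
case: (ltngtP x (pos_lo i)) => [lt|gt|/val_inj <- //].
  by apply: ltn_trans; apply: IH => //; rewrite ?bi -?yE //=; move: yx; clear; lia.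
by move: gt xy => /=; clear; lia.
Qed.

(** The permutation [v] with [w v = w'] preserves the blocks and is increasing on each of them; as
    the blocks are consecutive intervals, [v] is increasing everywhere and hence the identity. *)
Lemma block_increasing_unique w w' :
  block_increasing w -> block_increasing w' ->
  (forall x, blk (w^-1%g x) = blk (w'^-1%g x)) -> w = w'.
Proof.
move=> iw iw' bb; pose v := pcomp w^-1%g w'.
have bv x : blk (v x) = blk x by rewrite pcompE bb permK.
have wv x : w (v x) = w' x by rewrite pcompE permKV.
suff v1 : v = 1%g by apply/permP => x; rewrite -wv v1 perm1.
apply: (can_inj (@invgK _)); rewrite invg1; apply: asc_all_id => i; rewrite /asc invgK.
have lh : (pos_lo i < pos_hi i)%N by [].
case: (eqVneq (blk (pos_lo i)) (blk (pos_hi i))) => [bi|bi].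
  have := iw' _ _ bi lh; rewrite -!wv; case: (ltngtP (v (pos_lo i)) (v (pos_hi i))) => //.
    by move=> gt; have := iw (v (pos_hi i)) (v (pos_lo i)); rewrite !bv bi gt => /(_ erefl erefl); lia.
  by move=> /val_inj ->; rewrite ltnn.
rewrite ltnNge; apply/negP => /blk_le; rewrite !bv => le.
by case/negP: bi; apply/eqP/val_inj/eqP; rewrite eqn_leq le blk_le //= leqnSn.
Qed.

Lemma one_min_coset_rep : 1%g \in min_coset_reps mu.
Proof. by rewrite inE; apply/forallP => u; rewrite perm_length1; apply/implyP. Qed.

(** * Cosets of the Young subgroup as colorings *)

Section Enum.
Variables (pi : 'I_(nb_cosets mu) -> 'S_n) (pi_enum : coset_enum pi).
Implicit Types (k l : 'I_(nb_cosets mu)) (i : 'I_n.-1) (j : 'I_n).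

Lemma pi_increasing k : block_increasing (pi k).
Proof. by apply: min_coset_rep_increasing; have [_ H _] := pi_enum; apply/H; exists k. Qed.

Lemma nb_cosets_gt0 : (0 < nb_cosets mu)%N.
Proof.
have [_ H _] := pi_enum; have [[k kP] _] := (H 1%g).1 one_min_coset_rep.
exact: leq_ltn_trans kP.
Qed.

Definition coset0 : 'I_(nb_cosets mu) := Ordinal nb_cosets_gt0.

Lemma pi_coset0 : pi coset0 = 1%g.
Proof. by have [_ _ ->] := pi_enum. Qed.

(** The character [chi_k] takes the value [xi (col k j)] at [t_j]. Cosets are handled through these
    colorings from here on: [col_inj] makes the encoding faithful, and the symmetric group acts on
    it by relabelling the points. *)
Definition col k j : 'I_d := blk ((pi k)^-1%g j).

Lemma col_coset0 j : col coset0 j = blk j.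
Proof. by rewrite /col pi_coset0 invg1 perm1. Qed.

Lemma col_inj k l : col k =1 col l -> k = l.
Proof.
have [inj _ _] := pi_enum => kl; apply: inj.
by apply: block_increasing_unique kl; apply: pi_increasing.
Qed.

(** An element of least length in the coset of [w] belongs to the enumeration, and right
    multiplication by the Young subgroup does not change the coloring. *)
Lemma col_surj (w : 'S_n) : exists k, [forall j, col k j == blk (w^-1%g j)].
Proof.
have y1 : 1%g \in young mu by rewrite group1.
case: (arg_minnP (fun u => perm_length (pcomp w u)) y1) => u uY min.
have : pcomp w u \in min_coset_reps mu.
  rewrite inE; apply/forallP => v; apply/implyP => vY.
  by rewrite -pcompA; apply: min; rewrite /pcomp; apply: groupM.
have [_ H _] := pi_enum => /H[k kE]; exists k; apply/forallP => j; rewrite /col kE.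
by rewrite pcompV pcompE young_blk // /young groupV.
Qed.

Definition pact (w : 'S_n) k : 'I_(nb_cosets mu) := xchoose (col_surj (pcomp w (pi k))).

Lemma col_pact w k j : col (pact w k) j = col k (w^-1%g j).
Proof.
have /forallP/(_ j)/eqP-> := xchooseP (col_surj (pcomp w (pi k))).
by rewrite pcompV pcompE.
Qed.

Lemma pact_comp u w k : pact (pcomp u w) k = pact u (pact w k).
Proof. by apply: col_inj => j; rewrite !col_pact pcompV pcompE. Qed.

Lemma pact1 k : pact 1%g k = k.
Proof. by apply: col_inj => j; rewrite col_pact invg1 perm1. Qed.

(** The only pair of values that [s_i] reorders comes from two different blocks, so [s_i pi_k] is
    still increasing on blocks and is itself the representative of its coset. *)
Lemma pi_pact_ne i k : col k (pos_lo i) != col k (pos_hi i) ->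
  pi (pact (sr i) k) = pcomp (sr i) (pi k).
Proof.
move=> ne; apply: block_increasing_unique => [||j]; first exact: pi_increasing.
  move=> x y bxy xy; rewrite !pcompE simple_refl_lt (@pi_increasing k x y bxy xy) /=.
  apply/orP; left; apply/andP => -[/eqP xi /eqP yi]; case/negP: ne.
  by rewrite /col -xi -yi !permK bxy.
by rewrite pcompV pcompE -[LHS]/(col _ j) col_pact.
Qed.

(** A position strictly between the two would lie in the same block and, [pi_k] being increasing
    there, would be sent strictly between two consecutive values. *)
Lemma pi_col_eq i k : col k (pos_lo i) = col k (pos_hi i) ->
  (pi k)^-1%g (pos_hi i) = ((pi k)^-1%g (pos_lo i)).+1 :> nat.
Proof.
rewrite /col; set x := _ (pos_lo i); set y := _ (pos_hi i) => bxy.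
have xE : pi k x = pos_lo i by rewrite permKV.
have yE : pi k y = pos_hi i by rewrite permKV.
have xy : (x < y)%N.
  case: (ltngtP x y) => // [/(@pi_increasing k y x (esym bxy))|/val_inj E].
    by rewrite xE yE /=; lia.
  by move: yE; rewrite -E xE => /(congr1 val) /=; lia.
case: (eqVneq (y : nat) x.+1) => // ne.
have zP : (x.+1 < n)%N by move: (ltn_ord y) xy; clear; lia.
pose z := Ordinal zP.
have bz : blk z = blk y by apply: (@blk_between x); rewrite //= leqnSn.
have := @pi_increasing k x z; rewrite bz bxy => /(_ erefl (ltnSn _)); rewrite xE.
have zy : (z < y)%N by rewrite ltn_neqAle eq_sym ne.
by have := @pi_increasing k z y bz zy; rewrite yE /=; clear; lia.
Qed.

Lemma pact_eq i k : col k (pos_lo i) = col k (pos_hi i) -> pact (sr i) k = k.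
Proof.
move=> ki; apply: col_inj => j; rewrite col_pact simple_reflV /simple_refl.
by case: tpermP => [->|->|//].
Qed.

(* Deodhar's lemma: [s_i pi_k = pi_k s_r] when [s_i] fixes the coset of [pi_k]. *)
Lemma pi_simple_eq i k : col k (pos_lo i) = col k (pos_hi i) ->
  exists2 r : 'I_n.-1, r \in young_gens mu &
  [/\ pos_lo r = (pi k)^-1%g (pos_lo i), pos_hi r = (pi k)^-1%g (pos_hi i)
    & pcomp (sr i) (pi k) = pcomp (pi k) (sr r)].
Proof.
move=> ki; have E := pi_col_eq ki.
have rP : ((pi k)^-1%g (pos_lo i) < n.-1)%N.
  by move: (ltn_ord ((pi k)^-1%g (pos_hi i))); rewrite E; clear; lia.
pose r : 'I_n.-1 := Ordinal rP.
have rl : pos_lo r = (pi k)^-1%g (pos_lo i) by apply/val_inj.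
have rh : pos_hi r = (pi k)^-1%g (pos_hi i) by apply/val_inj; rewrite /= E.
exists r; first by rewrite young_gensE rl rh -/(col k _) ki.
split=> //; rewrite /pcomp /simple_refl rl rh -tpermJ /conjg.
by rewrite invgK -!mulgA mulVg mulg1.
Qed.

Lemma asc_col_lt i k : (col k (pos_lo i) < col k (pos_hi i))%N -> asc i (pi k).
Proof. by move=> lt; rewrite /asc ltnNge; apply/negP => /blk_le; rewrite leqNgt lt. Qed.

Lemma asc_col_le i k : (col k (pos_lo i) <= col k (pos_hi i))%N -> asc i (pi k).
Proof.
rewrite leq_eqVlt => /orP[/eqP/val_inj ki|]; last exact: asc_col_lt.
by rewrite /asc pi_col_eq.
Qed.

End Enum.
End Blocks.

(** * Matrix algebras and representations on colorings *)

Section MatrixAlgebra.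
Variables (K : comNzRingType) (A : algType K) (m : nat).

(* [m] is positive because an [algType] is nonzero. *)
Definition matalg of (0 < m)%N : Type := 'M[A]_m.
Variable m_gt0 : (0 < m)%N.
Local Notation M := (matalg m_gt0).
HB.instance Definition _ := GRing.PzRing.on M.

Definition mx_scale (c : K) (X : M) : M := map_mx (fun a : A => c *: a) X.

Lemma mx_one_neq0 : (1 : M) != 0.
Proof.
apply/eqP => /matrixP/(_ (Ordinal m_gt0) (Ordinal m_gt0))/eqP.
by rewrite !mxE eqxx mulr1n oner_eq0.
Qed.
HB.instance Definition _ := GRing.PzSemiRing_isNonZero.Build M mx_one_neq0.

Fact mx_scaleA a b X : mx_scale a (mx_scale b X) = mx_scale (a * b) X.
Proof. by apply/matrixP => i j; rewrite !mxE scalerA. Qed.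
Fact mx_scale1 : left_id 1 mx_scale.
Proof. by move=> X; apply/matrixP => i j; rewrite !mxE scale1r. Qed.
Fact mx_scaleDr : right_distributive mx_scale +%R.
Proof. by move=> a X Y; apply/matrixP => i j; rewrite !mxE scalerDr. Qed.
Fact mx_scaleDl X : {morph mx_scale^~ X : a b / a + b}.
Proof. by move=> a b; apply/matrixP => i j; rewrite !mxE scalerDl. Qed.
HB.instance Definition _ := GRing.Zmodule_isLmodule.Build K M
  mx_scaleA mx_scale1 mx_scaleDr mx_scaleDl.

Fact mx_scaleAl (c : K) (X Y : M) : c *: (X * Y) = (c *: X) * Y.
Proof.
apply/matrixP => i j; rewrite !mxE scaler_sumr; apply: eq_bigr => k _.
by rewrite mxE scalerAl.
Qed.
HB.instance Definition _ := GRing.Lmodule_isLalgebra.Build K M mx_scaleAl.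
Fact mx_scaleAr (c : K) (X Y : M) : c *: (X * Y) = X * (c *: Y).
Proof.
apply/matrixP => i j; rewrite !mxE scaler_sumr; apply: eq_bigr => k _.
by rewrite mxE scalerAr.
Qed.
HB.instance Definition _ := GRing.Lalgebra_isAlgebra.Build K M mx_scaleAr.

Lemma matalgZ (c : K) (X : M) i j : (c *: X) i j = c *: X i j.
Proof. by rewrite [LHS]mxE. Qed.

Lemma matalgM (X Y : M) : X * Y = X *m Y :> 'M[A]_m.
Proof. by []. Qed.

(** Matrices act on columns from the left, and equalities of matrices over the noncommutative [A]
    are checked on the columns [ev k 1], by [mx_ev]. *)
Definition ev (k : 'I_m) (a : A) : 'cV[A]_m := \col_l (a *+ (l == k)).

Lemma evD k a b : ev k (a + b) = ev k a + ev k b.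
Proof. by apply/colP => l; rewrite !mxE mulrnDl. Qed.

Lemma ev0 k : ev k 0 = 0.
Proof. by apply/colP => l; rewrite !mxE mul0rn. Qed.

Lemma mulmx_ev (X : 'M[A]_m) k a l : (X *m ev k a) l 0 = X l k * a.
Proof.
rewrite mxE (bigD1 k) //= mxE eqxx mulr1n big1 ?addr0 // => j jk.
by rewrite mxE (negPf jk) mulr0.
Qed.

Lemma ev_inj k : injective (ev k).
Proof. by move=> a b /colP/(_ k); rewrite !mxE eqxx. Qed.

Lemma mx_ev (X Y : 'M[A]_m) : (forall k, X *m ev k 1 = Y *m ev k 1) -> X = Y.
Proof.
by move=> XY; apply/matrixP => l k; have /colP/(_ l) := XY k; rewrite !mulmx_ev !mulr1.
Qed.

End MatrixAlgebra.

(* [c = 0] is used for the action of the Yokonuma-Hecke algebra, [c = q - 1] for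
   those of Hecke and Temperley-Lieb algebras. *)
Section InducedRep.
Variables (K : comNzRingType) (A : algType K) (n N : nat).
Variables (q al be c : K).
Hypotheses (albe : al * be = q) (cq : c = 0 \/ c = q - 1).
Variables (col : 'I_N -> 'I_n -> nat) (s : 'I_n.-1 -> 'I_N -> 'I_N).
Variable (x : 'I_N -> 'I_n.-1 -> A).
Local Notation sr := (@simple_refl n).
Implicit Types (k l : 'I_N) (i j : 'I_n.-1).
Local Notation eqcol k i := (col k (pos_lo i) = col k (pos_hi i)).

Hypothesis col_s : forall i k p, col (s i k) p = col k (sr i p).
Hypothesis sK : forall i, involutive (s i).
Hypothesis s_far : forall i j k, (i.+1 < j)%N || (j.+1 < i)%N -> s i (s j k) = s j (s i k).
Hypothesis s_braid : forall i j k, j = i.+1 :> nat ->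
  s i (s j (s i k)) = s j (s i (s j k)).
Hypothesis x_quad : forall k i, eqcol k i -> x k i * x k i = q%:A + (q - 1) *: x k i.
Hypothesis x_far : forall k i j, eqcol k i -> eqcol k j ->
  (i.+1 < j)%N || (j.+1 < i)%N -> x k i * x k j = x k j * x k i.
Hypothesis x_braid : forall k i j, eqcol k i -> eqcol k j -> j = i.+1 :> nat ->
  x k i * x k j * x k i = x k j * x k i * x k j.
Hypothesis x_s_far : forall k i j, eqcol k i -> (i.+1 < j)%N || (j.+1 < i)%N ->
  col k (pos_lo j) <> col k (pos_hi j) -> x (s j k) i = x k i.
Hypothesis x_s_braid : forall k i j, eqcol k i -> j = i.+1 :> nat ->
  col k (pos_lo j) <> col k (pos_hi j) -> x (s i (s j k)) j = x k i.

(** Model of an induced module with one basis vector for each coloring. A generator acts through the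
    blocks, by [x k i], when its two points have the same color, and moves to another basis vector
    otherwise. The relations depend on [al] and [be] only through their product, which leaves the
    normalization free. *)
Definition rep_mx i : 'M[A]_N := \matrix_(l, k)
  (if col k (pos_lo i) == col k (pos_hi i) then x k i *+ (l == k)
   else if (col k (pos_lo i) < col k (pos_hi i))%N then al%:A *+ (l == s i k)
   else be%:A *+ (l == s i k) + c%:A *+ (l == k)).
Local Notation T := rep_mx.

Lemma T_eq i k a : eqcol k i -> T i *m ev k a = ev k (x k i * a).
Proof.
by move=> ki; apply/colP => l; rewrite mulmx_ev !mxE ki eqxx mulrnAl.
Qed.

Lemma T_lt i k a : (col k (pos_lo i) < col k (pos_hi i))%N ->
  T i *m ev k a = ev (s i k) (al *: a).
Proof.
move=> ki; apply/colP => l; rewrite mulmx_ev !mxE ki ltn_eqF //.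
by rewrite mulrnAl mulr_algl.
Qed.

Lemma T_gt i k a : (col k (pos_hi i) < col k (pos_lo i))%N ->
  T i *m ev k a = ev (s i k) (be *: a) + ev k (c *: a).
Proof.
move=> ki; apply/colP => l; rewrite mulmx_ev !mxE gtn_eqF // ltnNge ltnW //=.
by rewrite mulrDl !mulrnAl !mulr_algl.
Qed.

Lemma col_lo i k : col (s i k) (pos_lo i) = col k (pos_hi i).
Proof. by rewrite col_s /simple_refl tpermL. Qed.
Lemma col_hi i k : col (s i k) (pos_hi i) = col k (pos_lo i).
Proof. by rewrite col_s /simple_refl tpermR. Qed.
Lemma col_far i k (p : 'I_n) : p != pos_lo i -> p != pos_hi i -> col (s i k) p = col k p.
Proof. by move=> *; rewrite col_s /simple_refl tpermD // eq_sym. Qed.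

Lemma rep_quad_eq i k a : eqcol k i -> T i *m (T i *m ev k a) =
  ev k (q *: a) + ev k ((q - 1) *: (x k i * a)).
Proof.
by move=> ki; rewrite !T_eq // mulrA x_quad // mulrDl mulr_algl -scalerAl evD.
Qed.

Lemma rep_quad_ne i k a : ~ eqcol k i -> T i *m (T i *m ev k a) =
  ev k (q *: a) + T i *m ev k (c *: a).
Proof.
move=> ki; case: (ltngtP (col k (pos_lo i)) (col k (pos_hi i))) => // lt.
  by rewrite !(T_lt _ lt) T_gt ?col_lo ?col_hi // sK !scalerA (mulrC be) albe (mulrC c).
by rewrite (T_gt _ lt) mulmxDr T_lt ?col_lo ?col_hi // sK scalerA albe.
Qed.

Lemma rep_far i j : (i.+1 < j)%N || (j.+1 < i)%N -> T i *m T j = T j *m T i.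
Proof.
move=> ij; apply: mx_ev => k; rewrite -!mulmxA.
have D1 : pos_lo i != pos_lo j by rewrite -val_eqE /=; move: ij; clear; lia.
have D2 : pos_lo i != pos_hi j by rewrite -val_eqE /=; move: ij; clear; lia.
have D3 : pos_hi i != pos_lo j by rewrite -val_eqE /=; move: ij; clear; lia.
have D4 : pos_hi i != pos_hi j by rewrite -val_eqE /=; move: ij; clear; lia.
have E1 l := col_far l D1 D2; have E2 l := col_far l D3 D4.
rewrite eq_sym in D1; rewrite eq_sym in D2; rewrite eq_sym in D3; rewrite eq_sym in D4.
have E3 l := col_far l D1 D3; have E4 l := col_far l D2 D4.
have ji : (j.+1 < i)%N || (i.+1 < j)%N by rewrite orbC.
(* Nine cases; in each, the order of the two pairs of colors decides how every generator acts, and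
   both sides are expanded on the column. *)
case: (ltngtP (col k (pos_lo i)) (col k (pos_hi i))) => ci;
case: (ltngtP (col k (pos_lo j)) (col k (pos_hi j))) => cj.
all: do 8! (rewrite ?mulmxDr; first
 [rewrite T_eq; last by rewrite ?E1 ?E2 ?E3 ?E4
 |rewrite T_lt; last by rewrite ?E1 ?E2 ?E3 ?E4
 |rewrite T_gt; last by rewrite ?E1 ?E2 ?E3 ?E4
 | idtac]).
all: rewrite ?(s_far k ij) ?scalerA.
- by rewrite mulrC.
- by rewrite (mulrC al be) (mulrC al c).
- by rewrite x_s_far ?scalerAr //; move: ci; clear; lia.
- by rewrite (mulrC al be) (mulrC al c).
- by rewrite (mulrC c be) addrACA.
- by rewrite x_s_far ?scalerAr //; move: ci; clear; lia.
- by rewrite x_s_far ?scalerAr //; move: cj; clear; lia.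
- by rewrite x_s_far ?scalerAr //; move: cj; clear; lia.
- by rewrite !mulr1 x_far.
Qed.

Lemma rep_braid i j : j = i.+1 :> nat -> T i *m T j *m T i = T j *m T i *m T j.
Proof.
move=> ij; apply: mx_ev => k; rewrite -!mulmxA.
have hl : pos_hi i = pos_lo j by apply/val_inj; rewrite /= ij.
have D1 : pos_lo i != pos_lo j by rewrite -val_eqE /=; move: ij; clear; lia.
have D2 : pos_lo i != pos_hi j by rewrite -val_eqE /=; move: ij; clear; lia.
have D3 : pos_hi j != pos_lo i by rewrite eq_sym.
have D4 : pos_hi j != pos_hi i by rewrite -val_eqE /=; move: ij; clear; lia.
have E1 l := col_far l D1 D2; have E2 l := col_far l D3 D4.
have E3 l := col_lo i l; have E4 l := col_hi i l.
have E5 l := col_lo j l; have E6 l := col_hi j l.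
have Q1 l := @T_eq i l; have Q2 l := @T_lt i l; have Q3 l := @T_gt i l.
rewrite hl in E3 E4 Q1 Q2 Q3.
pose E := (E1, E2, E3, E4, E5, E6).
have B := s_braid k ij.
have X1 : eqcol k i -> col k (pos_lo j) <> col k (pos_hi j) -> x (s i (s j k)) j = x k i.
  by move=> *; apply: x_s_braid.
have X2 : col k (pos_lo j) = col k (pos_hi j) -> ~ eqcol k i -> x (s j (s i k)) i = x k j.
  move=> kj ki; rewrite -[in RHS](sK i k) -[in RHS](sK j (s i k)).
  apply/esym/x_s_braid => //; rewrite ?hl !E //.
  by move: ki; rewrite hl; move=> ? ?; congruence.
have X3 : eqcol k i -> eqcol k j -> x k i * x k j * x k i = x k j * x k i * x k j.
  by move=> *; apply: x_braid.
rewrite hl in X1 X2 X3.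
have X4 : col k (pos_lo i) = col k (pos_hi j) -> col k (pos_lo i) <> col k (pos_lo j) ->
   x (s i k) j = x (s j k) i.
  move=> k02 k01; rewrite -[in LHS](sK j k); apply: x_s_braid; rewrite ?hl ?E //.
  by rewrite -k02.
(* The only use of [cq]: the square of [c] must be [c] times [q - 1]. *)
have XC p : eqcol k p -> (al * c * be)%:A + (c * c) *: x k p = c *: (x k p * x k p).
  move=> kp; rewrite x_quad // scalerDr !scalerA -albe.
  by congr (_ *: _ + _ *: _); case: cq => ->; rewrite -?albe; ring.
(* Three colors have 13 order types; the other combinations of comparisons are contradictory. *)
case: (ltngtP (col k (pos_lo i)) (col k (pos_lo j))) => c01;
case: (ltngtP (col k (pos_lo j)) (col k (pos_hi j))) => c12;
case: (ltngtP (col k (pos_lo i)) (col k (pos_hi j))) => c02; try by move: c01 c12 c02; clear; lia.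
all: do 15! (rewrite ?mulmxDr; first
 [rewrite Q1; last by rewrite ?E
 |rewrite Q2; last by rewrite ?E
 |rewrite Q3; last by rewrite ?E
 |rewrite (@T_eq j); last by rewrite ?E
 |rewrite (@T_lt j); last by rewrite ?E
 |rewrite (@T_gt j); last by rewrite ?E
 | idtac]).
all: rewrite ?B ?sK ?scalerA ?mulr1.
all: rewrite ?X4 ?X1 ?X2 -?scalerAr ?mulr1 ?scalerA;
  try by [move/esym: c02 | move: c01 c12 c02; clear; lia].
all: try by rewrite X3 ?mulrA // mulrA X3 ?mulrA.
all: try by congr (ev _ (_ *: _)); ring.
all: try by congr (_ + _); congr (ev _ (_ *: _)); ring.
- by rewrite addrACA; congr (_ + _ + (_ + _)); congr (ev _ (_ *: _)); ring.
- by rewrite addrACA; congr (_ + _ + (_ + _)); congr (ev _ (_ *: _)); ring.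
(* Strictly decreasing colors: each side has seven terms, matched coloring by coloring. *)
- rewrite [RHS](AC (3*(2*2)) (1*4*3*(2*6*(5*7))))%AC /=.
  by congr (_ + _ + _ + (_ + _ + (_ + _))); congr (ev _ (_ *: _)); ring.
- by rewrite addrACA -evD XC // (mulrC be c).
- by rewrite [RHS]addrACA -evD XC -?hl ?hl // (mulrC be c).
- by rewrite !mulrA X3.
Qed.
End InducedRep.

(** * Free families, quotients and tensor products *)

Section Span.
Variables (K : nzRingType) (V : lmodType K).

Definition lin_closed (P : V -> Prop) : Prop :=
  P 0 /\ forall (c : K) x y, P x -> P y -> P (c *: x + y).

(** Spanning as an induction principle: it is applied with a predicate [P] chosen for the purpose,
    so that linear combinations need not be written out. *)
Definition spans (E : V -> Prop) : Prop :=
  forall P, lin_closed P -> (forall e, E e -> P e) -> forall v, P v.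

Lemma lin_closedD P x y : lin_closed P -> P x -> P y -> P (x + y).
Proof. by move=> [_ H] Px Py; rewrite -[x]scale1r; apply: H. Qed.

Lemma lin_closedZ P c x : lin_closed P -> P x -> P (c *: x).
Proof. by move=> [P0 H] Px; rewrite -[_ *: _]addr0; apply: H. Qed.

Lemma lin_closed_sum P (I : Type) (r : seq I) (Q : pred I) (F : I -> V) :
  lin_closed P -> (forall i, Q i -> P (F i)) -> P (\sum_(i <- r | Q i) F i).
Proof.
move=> lP PF; apply: (big_ind P) => //; first by case: lP.
by move=> x y; apply: lin_closedD.
Qed.

Variables (I : finType) (e : I -> V).

Definition is_free : Prop :=
  forall c : I -> K, \sum_i c i *: e i = 0 -> forall i, c i = 0.

Lemma spans_family : spans (fun v => exists i, v = e i) ->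
  forall v, exists c : I -> K, v = \sum_i c i *: e i.
Proof.
apply; last first.
  move=> _ [i ->]; exists (fun j => (j == i)%:R).
  by rewrite (bigD1 i) //= eqxx scale1r big1 ?addr0 // => j /negPf->; rewrite scale0r.
split=> [|c _ _ [a ->] [b ->]].
  by exists (fun=> 0); rewrite big1 // => i _; rewrite scale0r.
exists (fun i => c * a i + b i); rewrite scaler_sumr -big_split.
by apply: eq_bigr => i _; rewrite scalerDl scalerA.
Qed.

Lemma basis_dual : spans (fun v => exists i, v = e i) -> is_free ->
  exists co : I -> V -> K, (forall i c x y, co i (c *: x + y) = c * co i x + co i y)
    /\ forall i j, co i (e j) = (i == j)%:R.
Proof.
move=> /spans_family sp fr; pose co v := sval (cid (sp v)).
have coE v : v = \sum_i co v i *: e i by exact: svalP (cid (sp v)).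
have uniq v (c : I -> K) i : v = \sum_i c i *: e i -> co v i = c i.
  move=> vc; apply/eqP; rewrite -subr_eq0; apply/eqP/(fr (fun i => co v i - c i)).
  rewrite (eq_bigr (fun i => co v i *: e i - c i *: e i)).
    by rewrite sumrB -coE -vc subrr.
  by move=> j _; rewrite scalerBl.
exists (fun i v => co v i); split=> [i c x y|i j].
  apply: (uniq _ (fun i => c * co x i + co y i)).
  rewrite {1}(coE x) {1}(coE y) scaler_sumr -big_split.
  by apply: eq_bigr => j _; rewrite scalerDl scalerA.
apply: (uniq _ (fun i => (i == j)%:R)).
by rewrite (bigD1 j) //= eqxx scale1r big1 ?addr0 // => k /negPf->; rewrite scale0r.
Qed.

(** [is_basis] speaks of a set of vectors, so a free family must be known to have no repetitions
    before it is turned into one. *)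
Lemma is_free_inj : is_free -> injective e.
Proof.
move=> fr i j ij; apply/eqP; apply/negPn/negP => ne.
pose c k : K := (k == i)%:R - (k == j)%:R.
have /fr/(_ i)/eqP : \sum_k c k *: e k = 0; last first.
  by rewrite /c eqxx (negPf ne) subr0 oner_eq0.
rewrite (bigD1 i) //= (bigD1 j) 1?eq_sym //= /c !eqxx (eq_sym j) (negPf ne) subr0 sub0r.
rewrite scale1r scaleN1r ij addrA subrr add0r big1 // => k /andP[/negPf-> /negPf->].
by rewrite subrr scale0r.
Qed.

Lemma is_basis_family : spans (fun v => exists i, v = e i) -> is_free ->
  is_basis [set v | exists i, v = e i] /\ free_of_rank V #|I|.
Proof.
move=> sp fr; have inj := is_free_inj fr.
have B : is_basis [set v | exists i, v = e i].
  split=> [v|s c us sE s0 x xs].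
    have [a ->] := spans_family sp v.
    exists [seq e i | i <- enum I].
    exists (fun x => if [pick i | e i == x] is Some i then a i else 0); split.
      by move=> _ /mapP[i _ ->]; exists i.
    rewrite big_map big_enum /=; apply: eq_bigr => i _.
    by case: pickP => [j /eqP/inj->|/(_ i)/eqP].
  have : \sum_i (if e i \in s then c (e i) else 0) *: e i = 0.
    rewrite -[RHS]s0 (eq_bigr (fun i => if e i \in s then c (e i) *: e i else 0)).
      rewrite -big_mkcond -(big_map e (fun x => x \in s) (fun x => c x *: x)) /=.
      rewrite -big_filter; apply: perm_big; apply: uniq_perm => //.
        by rewrite filter_uniq // map_inj_uniq // index_enum_uniq.
      move=> y; rewrite mem_filter andbC; case: (boolP (y \in s)) => [ys|]; last by rewrite andbF.
      rewrite andbT; have [i ->] := sE _ ys.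
      by rewrite map_f // mem_index_enum.
    by move=> i _; case: ifP => //; rewrite scale0r.
  have [i xE] := sE _ xs => /fr/(_ i); rewrite -xE xs; apply.
split=> //.
have sz : size [seq e i | i <- enum I] == #|I| by rewrite size_map cardE.
exists (Tuple sz); split; first by rewrite map_inj_uniq // enum_uniq.
congr is_basis: B; apply/seteqP; split=> [_ [i ->]|_ /mapP[i _ ->]]; last by exists i.
by apply/map_f; rewrite mem_enum.
Qed.

End Span.

Section FreeAlgebra.
Variables (K : comNzRingType) (I : choiceType).
Implicit Types (x y : freealg K I).

Lemma freealg_spans : spans (fun x => exists s, x = \prod_(i <- s) gen K i).
Proof.
move=> P lP Pw x; rewrite (monalgE x); apply: lin_closed_sum => // m _.
have -> : << x@_m *g m >> = x@_m *: \prod_(i <- fmonom_val m) gen K i.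
  suff -> : \prod_(i <- fmonom_val m) gen K i = << m >> :> freealg K I.
    by apply/malgP => k; rewrite mcoeffZ !mcoeffU mulr_natr.
  case: m => s; elim: s => [|i s IH] /=.
    by rewrite big_nil -fmoneE.
  rewrite big_cons IH; apply: etrans (fgmulUU _ _ _ _) _; rewrite mulr1.
  by congr (<< 1 *g _ >>); apply/val_inj; rewrite [LHS]fmM fmU.
by apply: lin_closedZ => //; apply: Pw; exists (fmonom_val m).
Qed.

Lemma freealg_eval_word (A : algType K) (f : I -> A) s :
  freealg_eval f (\prod_(i <- s) gen K i) = \prod_(i <- s) f i.
Proof.
by rewrite rmorph_prod /=; apply: eq_bigr => i _; rewrite freealg_eval_gen.
Qed.

End FreeAlgebra.

Section QuotInd.
Variables (K : comNzRingType) (I : choiceType) (X : set (freealg K I)).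
Variable X_proper : proper_gens X.
Local Notation Q := (quotalg X_proper).
Local Notation g i := (qproj X_proper (gen K i)).

Lemma quotalg_spans : spans (fun x : Q => exists s, x = \prod_(i <- s) g i).
Proof.
move=> P [P0 Pl] Pw; apply: qind; apply: freealg_spans => [|_ [s ->]].
  by split=> [|c x y]; rewrite ?raddf0 // linearP; apply: Pl.
by apply: Pw; exists s; rewrite rmorph_prod.
Qed.

Lemma quotalg_ind_left (P : Q -> Prop) : lin_closed P -> P 1 ->
  (forall i x, P x -> P (g i * x)) -> forall x, P x.
Proof.
move=> lP P1 Pg; apply: quotalg_spans => // _ [s ->].
by elim: s => [|i s IH]; rewrite ?big_nil ?big_cons //; apply: Pg.
Qed.

(** Maps of the statement such as [Htens_iso] and [tens_proj] evaluate the chosen representative of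
    a class. Once a morphism [h] of the quotient with the right values on generators is known, it
    agrees with this evaluation, whatever the representative. *)
Lemma freealg_eval_qrepr (B : algType K) (f : I -> B) (h : {lrmorphism Q -> B}) :
  (forall i, h (g i) = f i) -> forall x : Q, freealg_eval f (qrepr x) = h x.
Proof.
move=> hf x; rewrite -[in RHS](qreprK x); move: (qrepr x).
apply: freealg_spans => [|_ [s ->]].
  split=> [|c y z]; first by rewrite !raddf0.
  by move=> Hy Hz; rewrite !linearP /= Hy Hz.
by rewrite freealg_eval_word !rmorph_prod /=; apply: eq_bigr => i _; rewrite hf.
Qed.

End QuotInd.

Section CommProd.
Variables (A : nzRingType) (I : eqType).

Lemma comm_prod (r : seq I) (x : A) (y : I -> A) :
  (forall i, i \in r -> x * y i = y i * x) ->
  x * \prod_(i <- r) y i = \prod_(i <- r) y i * x.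
Proof.
elim: r => [|i r IH] xy; first by rewrite big_nil mulr1 mul1r.
rewrite big_cons mulrA xy ?mem_head // -mulrA IH ?mulrA // => j jr.
by apply: xy; rewrite in_cons jr orbT.
Qed.

Lemma prod_comm_split (r : seq I) (x y : I -> A) : uniq r ->
  (forall i j, i != j -> y i * x j = x j * y i) ->
  \prod_(i <- r) (x i * y i) = \prod_(i <- r) x i * \prod_(i <- r) y i.
Proof.
move=> + xy; elim: r => [|i r IH] /=; first by rewrite !big_nil mulr1.
move=> /andP[ir ur]; rewrite !big_cons IH // -!mulrA; congr (_ * _).
rewrite !mulrA; congr (_ * _); apply: comm_prod => j jr; apply: xy.
by apply: contraNneq ir => ->.
Qed.

End CommProd.

(** The kernel of a linear form is not an ideal in general. The predicate [L (u x v) = 0] for all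
    [u] and [v] is stable under two-sided multiplication by construction, and by linearity it need
    only be tested on spanning [u] and [v]. *)
Lemma linear_form_ker (K : comNzRingType) (F : algType K) (X : set F) (E : F -> Prop)
  (L : F -> K) : (forall c x y, L (c *: x + y) = c * L x + L y) -> spans E ->
  (forall r u v, X r -> E u -> E v -> L (u * r * v) = 0) ->
  forall x, x \in ideal_gen X -> L x = 0.
Proof.
move=> Ll spE LX x /asboolP xX.
have L0 : L 0 = 0 by have := Ll (-1) 0 0; rewrite scaler0 addr0 mulN1r addNr.
have LD y z : L (y + z) = L y + L z by rewrite -[y]scale1r Ll mul1r scale1r.
suff : forall u v, L (u * x * v) = 0 by move=> /(_ 1 1); rewrite mul1r mulr1.
apply: (xX (fun x => forall u v, L (u * x * v) = 0)); split.
  split=> [u v|y z Hy Hz u v|b y c Hy u v].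
  - by rewrite mulr0 mul0r L0.
  - by rewrite mulrDr mulrDl LD (Hy u v) (Hz u v) addr0.
  - by have := Hy (u * b) (c * v); rewrite !mulrA.
move=> r Xr; have spE2 := spE; apply: spE2 => [|u Eu].
  split=> [v|c y z Hy Hz v]; first by rewrite !mul0r L0.
  by rewrite !mulrDl -!scalerAl Ll (Hy v) (Hz v) mulr0 addr0.
apply: spE => [|v Ev]; last exact: LX.
split=> [|c y z Hy Hz]; first by rewrite mulr0 L0.
by rewrite mulrDr -scalerAr Ll Hy Hz mulr0 addr0.
Qed.

Section TensorTheory.
Variables (K : comNzRingType) (d : nat) (A : 'I_d -> algType K).
Hypothesis augA : forall i, augmented (A i).
Local Notation T := (tens augA).
Local Notation pt := (ptens augA).
Implicit Types (a b : forall i, A i).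

Lemma ptens1 : pt (fun=> 1) = 1.
Proof.
rewrite -[RHS](rmorph1 (qproj (tens_proper augA))).
by apply/qprojP; apply/asboolP => J [_]; apply; apply: TensOne.
Qed.

Lemma ptensM a b : pt a * pt b = pt (fun i => a i * b i).
Proof.
rewrite -[LHS]rmorphM; apply/esym/qprojP/asboolP => J [_]; apply; exact: TensMul.
Qed.

Lemma ptens_lin a i c (x y : A i) :
  pt (dfwith a (c *: x + y)) = c *: pt (dfwith a x) + pt (dfwith a y).
Proof.
rewrite -[RHS]linearP; apply/qprojP/asboolP => J [_]; apply; exact: TensLin.
Qed.

Lemma tens_spans : spans (fun x : T => exists a, x = pt a).
Proof.
move=> P lP Pa; apply: quotalg_spans => // _ [s ->].
suff [a ->] : exists a, \prod_(i <- s) qproj (tens_proper augA) (gen K i) = pt a.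
  by apply: Pa; exists a.
elim: s => [|a s [b IH]]; first by exists (fun=> 1); rewrite big_nil ptens1.
by exists (fun i => a i * b i); rewrite big_cons IH -ptensM.
Qed.

Section Multilinear.
Variable Phi : (forall i, A i) -> K.
Hypothesis Phi_lin : forall a i c (x y : A i),
  Phi (dfwith a (c *: x + y)) = c * Phi (dfwith a x) + Phi (dfwith a y).

Let F := freealg K (tens_gen A).
Let word_val (s : seq (tens_gen A)) : K := Phi (fun i => \prod_(a <- s) a i).
Let L0 (x : F) : K := mmap idfun (fun m => word_val (fmonom_val m)) x.

Let L0_lin c x y : L0 (c *: x + y) = c * L0 x + L0 y.
Proof.
rewrite /L0 mmapD; congr (_ + _).
rewrite (mmapEw (msuppZ_le c x)) mmapE mulr_sumr.
by apply: eq_bigr => k _; rewrite mcoeffZ mulrA.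
Qed.

Let L0_word s : L0 (\prod_(a <- s) gen K a) = word_val s.
Proof.
have -> : \prod_(a <- s) gen K a = << FMonom s >> :> F.
  elim: s => [|i s IH] /=; first by rewrite big_nil -fmoneE.
  rewrite big_cons IH; apply: etrans (fgmulUU _ _ _ _) _; rewrite mulr1.
  by congr (<< 1 *g _ >>); apply/val_inj; rewrite [LHS]fmM fmU.
by rewrite /L0 mmapU mul1r.
Qed.

(** The presentation gives algebra morphisms out of the tensor product, whereas independence of pure
    tensors calls for linear forms. On the free algebra a word of tuples is sent to [Phi] of its
    componentwise product, and a relation inserted inside a word gives 0. *)
Lemma multilinear_lift : exists L : T -> K,
  (forall c x y, L (c *: x + y) = c * L x + L y) /\ forall a, L (pt a) = Phi a.
Proof.
have L0B x y : L0 (x - y) = L0 x - L0 y by exact: mmapB.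
have ker x : x \in ideal_gen (@tens_rel K d A) -> L0 x = 0.
  apply: (linear_form_ker L0_lin (@freealg_spans _ _)) => r _ _ Hr [s ->] [t ->].
  have Lw u : L0 (\prod_(a <- s) gen K a * \prod_(a <- u) gen K a * \prod_(a <- t) gen K a)
      = word_val (s ++ u ++ t) by rewrite -L0_word !big_cat /= mulrA.
  have L1 a : L0 (\prod_(a <- s) gen K a * gen K a * \prod_(a <- t) gen K a)
      = word_val (s ++ [:: a] ++ t) by have := Lw [:: a]; rewrite big_seq1.
  case: Hr => [|a b|a i c y z]; rewrite mulrBr mulrBl L0B; apply/eqP; rewrite subr_eq0; apply/eqP.
  - have L2 : L0 (\prod_(a <- s) gen K a * 1 * \prod_(a <- t) gen K a)
      = word_val (s ++ [::] ++ t) by have := Lw [::]; rewrite big_nil.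
    apply: etrans (L1 _) (etrans _ (esym L2)).
    rewrite /word_val; congr Phi; apply/functional_extensionality_dep => i.
    by rewrite !big_cat !big_cons !big_nil /= ?(mul1r, mulr1).
  - have L2 : L0 (\prod_(a <- s) gen K a * (gen K a * gen K b) * \prod_(a <- t) gen K a)
      = word_val (s ++ [:: a; b] ++ t) by have := Lw [:: a; b]; rewrite !big_cons big_nil mulr1.
    apply: etrans (L1 _) (etrans _ (esym L2)).
    rewrite /word_val; congr Phi; apply/functional_extensionality_dep => i.
    by rewrite !big_cat !big_cons !big_nil /= ?(mul1r, mulr1).
  - rewrite mulrDr mulrDl -scalerAr -scalerAl.
    apply: etrans (L1 _) (etrans _ (esym (L0_lin _ _ _))).
    transitivity (c * word_val (s ++ [:: (dfwith a y : tens_gen A)] ++ t)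
        + word_val (s ++ [:: (dfwith a z : tens_gen A)] ++ t)); last first.
      by congr (_ * _ + _); apply/esym/L1.
    rewrite /word_val.
    pose p j := \prod_(b <- s) b j; pose p' j := \prod_(b <- t) b j.
    have E w : (fun j => \prod_(b <- s ++ [:: dfwith a w] ++ t) b j) =
        dfwith (fun j => p j * a j * p' j) (p i * w * p' i).
      apply/functional_extensionality_dep => j; rewrite !big_cat big_seq1 /= mulrA.
      case: dfwithP => [|k ik]; first by rewrite dfwith_in.
      by rewrite dfwith_out.
    by rewrite !E mulrDr mulrDl -scalerAr -scalerAl Phi_lin.
exists (fun x => L0 (qrepr x)).
have LE x : L0 (qrepr (qproj (tens_proper augA) x)) = L0 x.
  apply/esym/eqP; rewrite -subr_eq0 -L0B; apply/eqP/ker; exact: qrepr_proj.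
split=> [c|a].
  by elim/qind=> x; elim/qind=> y; rewrite -[_ *: _ + _]linearP !LE L0_lin.
have := L0_word [:: a]; rewrite big_seq1 LE => ->; congr Phi.
by apply/functional_extensionality_dep => i; rewrite big_seq1.
Qed.

End Multilinear.

Section Lift.
Variables (B : algType K) (beta : forall i, {lrmorphism A i -> B}).
Hypothesis beta_comm : forall i j (x : A i) (y : A j), i != j ->
  beta i x * beta j y = beta j y * beta i x.

Lemma tens_lift : exists al : {lrmorphism T -> B},
  forall a, al (pt a) = \prod_i beta i (a i).
Proof.
pose f (a : tens_gen A) : B := \prod_i beta i (a i).
have [|al alE] := @quotalg_lift K _ (@tens_rel K d A) (tens_proper augA) B
    (freealg_eval f); last first.
  by exists al => a; rewrite alE /= freealg_eval_gen.
move=> _ [|a b|a i c x y]; rewrite raddfB /=; apply/eqP; rewrite subr_eq0; apply/eqP.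
- by rewrite freealg_eval_gen rmorph1 /f big1 // => i _; rewrite rmorph1.
- rewrite rmorphM /= !freealg_eval_gen /f -prod_comm_split ?index_enum_uniq //.
    by apply: eq_bigr => i _; rewrite rmorphM.
  by move=> i j ij; apply: beta_comm.
- rewrite linearP /= !freealg_eval_gen /f.
  have [p [p' E]] : exists p p', forall w, \prod_j beta j (dfwith a w j) = p * beta i w * p'.
    have iE : i \in index_enum 'I_d by rewrite mem_index_enum.
    have := index_enum_uniq 'I_d; case/splitPr: iE => r1 r2.
    rewrite cat_uniq /= negb_or => /and3P[_ /andP[ir1 _] /andP[ir2 _]].
    exists (\prod_(j <- r1) beta j (a j)), (\prod_(j <- r2) beta j (a j)) => w.
    rewrite big_cat big_cons /= dfwith_in mulrA; congr (_ * _ * _).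
      by apply: eq_big_seq => j jr; rewrite dfwith_out //; apply: contraNneq ir1 => ->.
    by apply: eq_big_seq => j jr; rewrite dfwith_out //; apply: contraNneq ir2 => ->.
  by rewrite !E linearP /= mulrDr mulrDl -scalerAr -scalerAl.
Qed.

End Lift.

Section Basis.
Variables (N : 'I_d -> nat) (e : forall i, 'I_(N i) -> A i).
Hypothesis e_spans : forall i, spans (fun x : A i => exists k, x = e k).
Hypothesis e_free : forall i, is_free (@e i).
Local Notation J := {dffun forall i, 'I_(N i)}.

(** The slots are replaced by basis elements one after another; in [H] the slots listed in [r] are
    still arbitrary. *)
Lemma tens_basis_spans :
  spans (fun x : T => exists f : J, x = pt (fun i => e (f i))).
Proof.
move=> P lP Pe; apply: tens_spans => // _ [a ->].
suff H (r : seq 'I_d) : forall a, (forall i, i \notin r -> exists k, a i = e k) -> P (pt a).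
  by apply: (H (enum 'I_d)) => i; rewrite mem_enum.
elim: r => [|i r IH] {}a ar.
  have ex i : exists k, a i = e k by apply: ar.
  pose f : J := [ffun i => sval (cid (ex i))].
  suff -> : a = (fun i => e (f i)) by apply: Pe; exists f.
  apply/functional_extensionality_dep => i; rewrite ffunE.
  exact: svalP (cid (ex i)).
have -> : a = dfwith a (a i).
  by apply/functional_extensionality_dep => j; case: dfwithP.
apply: (@e_spans i (fun w => P (pt (dfwith a w)))) => [|_ [k ->]].
  case: lP => P0 Pl; split=> [|c x y Px Py]; last by rewrite ptens_lin; apply: Pl.
  have := ptens_lin a (-1) (0 : A i) 0.
  by rewrite scaler0 addr0 scaleN1r addNr => ->.
apply: IH => j; case: dfwithP => [|l il] jr; first by exists k.
by apply: ar; rewrite in_cons negb_or eq_sym il.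
Qed.

(** A product of coordinate forms of the factors is multilinear, and the form that it induces on the
    tensor product singles out one coefficient. *)
Lemma tens_basis_free : is_free (fun f : J => pt (fun i => e (f i))).
Proof.
have D i := basis_dual (@e_spans i) (@e_free i).
pose co i := sval (cid (D i)).
have co_lin i k c x y : co i k (c *: x + y) = c * co i k x + co i k y.
  by have [H _] := svalP (cid (D i)); apply: H.
have co_e i k l : co i k (e l) = (k == l)%:R.
  by have [_ H] := svalP (cid (D i)); apply: H.
move=> c c0 f.
have [|L [L_lin LE]] := @multilinear_lift (fun a => \prod_i co i (f i) (a i)).
  move=> a i u x y; rewrite !(bigD1 i (P := xpredT)) //= !dfwith_in co_lin mulrDl -mulrA.
  by congr (_ * (_ * _) + _ * _); apply: eq_bigr => j ji; rewrite !dfwith_out // eq_sym.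
have L0 : L 0 = 0 by have := L_lin (-1) 0 0; rewrite scaler0 addr0 mulN1r addNr.
have : L (\sum_g c g *: pt (fun i => e (g i))) = \sum_g c g * L (pt (fun i => e (g i))).
  apply: (big_rec2 (fun x y => L x = y)) => // g x y _ <-; exact: L_lin.
rewrite c0 L0 (bigD1 f) //= LE big1 => [|i _]; last by rewrite co_e eqxx.
rewrite mulr1 big1 ?addr0 // => g gf; rewrite LE.
have [i gi] : exists i, f i != g i.
  apply/existsP; apply: contraNT gf; rewrite negb_exists => /forallP H.
  by apply/eqP/ffunP => i; apply/esym/eqP; have := H i; rewrite negbK.
by rewrite (bigD1 i) //= co_e (negPf gi) mul0r mulr0.
Qed.

End Basis.
End TensorTheory.

(** * Hecke and Temperley-Lieb relations *)

Section Relations.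
Variables (K : comNzRingType) (A : algType K) (X : set A) (X_proper : proper_gens X).

Lemma qproj_rel a b : X (a - b) -> qproj X_proper a = qproj X_proper b.
Proof. by move=> Xab; apply/qprojP/asboolP => J [_]; apply. Qed.

Lemma qproj_rel0 a : X a -> qproj X_proper a = 0.
Proof. by rewrite -{1}[a]subr0 => /qproj_rel; rewrite raddf0. Qed.

End Relations.

Lemma steinberg_morph (K : comNzRingType) (A B : algType K) (f : {lrmorphism A -> B}) x y :
  f (steinberg x y) = steinberg (f x) (f y).
Proof. by rewrite /steinberg !rmorphD !rmorphM rmorph1. Qed.

(* Abstract instances of [rmorphM] and [linearZ]: unification with the latter
   diverges in a free algebra. *)
Section RelationMorphisms.
Variables (K : comNzRingType) (A B : algType K) (f : {lrmorphism A -> B}).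

Lemma morph_rel2 x y z w : f (x * y - z * w) = f x * f y - f z * f w.
Proof. by rewrite rmorphB !rmorphM. Qed.

Lemma morph_rel3 x y z u v w :
  f (x * y * z - u * v * w) = f x * f y * f z - f u * f v * f w.
Proof. by rewrite rmorphB !rmorphM. Qed.

Lemma morph_mul2 x y z w : x * y = z * w -> f x * f y = f z * f w.
Proof. by rewrite -!rmorphM => ->. Qed.

Lemma morph_mul3 x y z u v w : x * y * z = u * v * w ->
  f x * f y * f z = f u * f v * f w.
Proof. by rewrite -!rmorphM => ->. Qed.

Lemma morph_quad q x y : f (x ^+ 2 - (q%:A + (q - 1) *: y)) =
  f x * f x - (q%:A + (q - 1) *: f y).
Proof. by rewrite rmorphB rmorphXn rmorphD /= !linearZ /= rmorph1. Qed.

End RelationMorphisms.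

Section Steinberg.
Variables (K : comNzRingType) (A : algType K) (q : K).
Implicit Types a b c : A.

Definition hecke_quad a : Prop := a * a = q%:A + (q - 1) *: a.

(** In this form every vector killed by [a + 1] is seen to be killed by the Steinberg element. *)
Lemma steinbergE a b : hecke_quad a ->
  steinberg a b = (a + 1) * (b + 1) * (a + 1) - q *: (a + 1).
Proof.
move=> qa; have -> : q *: (a + 1) = a * a + a.
  by rewrite qa scalerDr scalerBl scale1r -addrA subrK addrC.
apply/eqP; rewrite eq_sym subr_eq eq_sym /steinberg; apply/eqP.
rewrite mulrDl mul1r mulrDr mulr1 mulrDr mulr1 !mulrDl mul1r.
by rewrite [LHS](AC (6*2) (6*7*(5*2)*(4*8*(3*1))))%AC.
Qed.

Lemma steinbergC a b : a * b * a = b * a * b -> steinberg a b = steinberg b a.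
Proof. by rewrite /steinberg => ->; rewrite [LHS](ACl (1*3*2*5*4*6))%AC. Qed.

Lemma steinberg_mulr a b : hecke_quad a -> steinberg a b * a = q *: steinberg a b.
Proof.
move=> qa; rewrite steinbergE // mulrBl scalerBr -!scalerAl.
have E : (a + 1) * a = q *: (a + 1).
  by rewrite mulrDl mul1r qa scalerDr scalerBl scale1r -addrA subrK addrC.
by rewrite -(mulrA _ (a + 1) a) E -scalerAr.
Qed.

(* [a b c] conjugates [(a, b)] into [(b, c)]. *)
Lemma steinberg_conj a b c : a * b * a = b * a * b -> b * c * b = c * b * c ->
  a * c = c * a -> steinberg b c * (a * b * c) = a * b * c * steinberg a b.
Proof.
move=> ab bc ac; set u := a * b * c.
have bu : b * u = u * a by rewrite /u !mulrA -ab -!mulrA ac.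
have cu : c * u = u * b.
  by rewrite /u !mulrA -ac -!mulrA; congr (a * _); rewrite !mulrA bc.
have bcu : b * c * u = u * (a * b) by rewrite -mulrA cu mulrA bu -mulrA.
have cbu : c * b * u = u * (b * a) by rewrite -mulrA bu mulrA cu -mulrA.
have bcbu : b * c * b * u = u * (a * b * a).
  by rewrite -(mulrA (b * c)) bu (mulrA (b * c)) bcu -mulrA.
by rewrite /steinberg !mulrDl !mulrDr mul1r mulr1 bu cu bcu cbu bcbu.
Qed.

Section Units.
Variables (qi : K) (qiP : q * qi = 1).

Lemma hecke_quad_inv a : hecke_quad a -> a * (qi *: (a - (q - 1)%:A)) = 1.
Proof.
move=> qa; rewrite -scalerAr mulrBr qa -scalerAr mulr1 addrK.
by rewrite scalerA mulrC qiP scale1r.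
Qed.

Lemma steinberg_shift a b c : hecke_quad a -> hecke_quad b -> hecke_quad c ->
  a * b * a = b * a * b -> b * c * b = c * b * c -> a * c = c * a ->
  steinberg a b = 0 -> steinberg b c = 0.
Proof.
move=> qa qb qc ab bc ac s0; have su := steinberg_conj ab bc ac.
pose inv (x : A) := qi *: (x - (q - 1)%:A).
have uV : a * b * c * (inv c * (inv b * inv a)) = 1.
  rewrite -!mulrA (mulrA c) hecke_quad_inv // mul1r.
  by rewrite (mulrA b) hecke_quad_inv // mul1r hecke_quad_inv.
by rewrite -[LHS]mulr1 -uV (mulrA (steinberg b c)) su s0 mulr0 mul0r.
Qed.

End Units.
End Steinberg.

Section HeckeAlgebra.
Variables (K : comNzRingType) (q : K) (m : nat).
Local Notation G := (@hgen K q m).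
Implicit Types i j : 'I_m.-1.

Local Notation pr := (qproj (hecke_proper q m)).

Lemma hgen_far i j : (i.+1 < j)%N || (j.+1 < i)%N -> G i * G j = G j * G i.
Proof.
move=> ij; apply/eqP; rewrite -subr_eq0; apply/eqP.
apply: etrans (qproj_rel0 (hecke_proper q m) (HeckeComm q ij)).
exact/esym/(morph_rel2 pr (gen K i) (gen K j)).
Qed.

Lemma hgen_braid i j : j = i.+1 :> nat -> G i * G j * G i = G j * G i * G j.
Proof.
move=> ij; apply/eqP; rewrite -subr_eq0; apply/eqP.
apply: etrans (qproj_rel0 (hecke_proper q m) (HeckeBraid q ij)).
exact/esym/(morph_rel3 pr (gen K i) (gen K j)).
Qed.

Lemma hgen_quad i : hecke_quad q (G i).
Proof.
apply/eqP; rewrite -subr_eq0; apply/eqP.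
apply: etrans (qproj_rel0 (hecke_proper q m) (HeckeQuad q i)).
exact/esym/(morph_quad pr q (gen K i)).
Qed.

Lemma hecke_lift (B : algType K) (f : 'I_m.-1 -> B) :
  (forall i j, (i.+1 < j)%N || (j.+1 < i)%N -> f i * f j = f j * f i) ->
  (forall i j, j = i.+1 :> nat -> f i * f j * f i = f j * f i * f j) ->
  (forall i, hecke_quad q (f i)) ->
  exists h : {lrmorphism Hecke q m -> B}, forall i, h (G i) = f i.
Proof.
move=> ff fb fq; pose ev : {lrmorphism freealg K 'I_m.-1 -> B} := freealg_eval f.
have evE i : ev (gen K i) = f i by exact: freealg_eval_gen.
have [|h hE] := @quotalg_lift K _ (@hecke_rel K q m) (hecke_proper q m) B ev; last first.
  by exists h => i; apply: etrans (hE _) (evE _).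
move=> _ [i j ij|i j ij|i].
- by apply: etrans (morph_rel2 ev _ _ _ _) _; rewrite !evE ff ?subrr.
- by apply: etrans (morph_rel3 ev _ _ _ _ _ _) _; rewrite !evE fb ?subrr.
- by apply: etrans (morph_quad ev q _ _) _; rewrite !evE fq subrr.
Qed.

Lemma hecke_spans : spans (fun x : Hecke q m => exists s, x = \prod_(i <- s) G i).
Proof. exact: quotalg_spans. Qed.

Local Notation TG i := (qproj (tl_proper q m) (G i)).

Lemma tl_lift (B : algType K) (h : {lrmorphism Hecke q m -> B}) :
  (forall i j, i = 0%N :> nat -> j = 1%N :> nat -> steinberg (h (G i)) (h (G j)) = 0) ->
  exists g : {lrmorphism TL q m -> B}, forall x, g (qproj (tl_proper q m) x) = h x.
Proof.
move=> st; apply: quotalg_lift => _ [i j i0 j1].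
by rewrite steinberg_morph st.
Qed.

Lemma hecke_quad_morph (A B : algType K) (f : {lrmorphism A -> B}) x :
  hecke_quad q x -> hecke_quad q (f x).
Proof. by rewrite /hecke_quad -rmorphM => ->; rewrite rmorphD /= !linearZ /= rmorph1. Qed.

Lemma tl_spans : spans (fun x : TL q m => exists s, x = \prod_(i <- s) TG i).
Proof.
move=> P [P0 Pl] Pw; apply: qind; apply: hecke_spans => [|_ [s ->]].
  by split=> [|c x y]; rewrite ?raddf0 // linearP; apply: Pl.
by apply: Pw; exists s; rewrite rmorph_prod.
Qed.

Lemma tl_far i j : (i.+1 < j)%N || (j.+1 < i)%N -> TG i * TG j = TG j * TG i.
Proof. by move/hgen_far/(morph_mul2 (qproj (tl_proper q m))). Qed.

Lemma tl_braid i j : j = i.+1 :> nat -> TG i * TG j * TG i = TG j * TG i * TG j.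
Proof. by move/hgen_braid/(morph_mul3 (qproj (tl_proper q m))). Qed.

Lemma tl_quad i : hecke_quad q (TG i).
Proof. exact: hecke_quad_morph (qproj (tl_proper q m)) _ (hgen_quad i). Qed.

(** The defining relation concerns the first two generators; [steinberg_shift] carries it one step
    further at a time, conjugating by a product of three generators, which are invertible because
    [q] is. *)
Lemma tl_steinberg (qi : K) i j : q * qi = 1 -> j = i.+1 :> nat ->
  steinberg (TG i) (TG j) = 0.
Proof.
move=> qiP; move: {2}(i : nat) (erefl (i : nat)) => r; elim: r i j => [|r IH] i j ir ji.
  by rewrite -steinberg_morph; apply: qproj_rel0; apply: TLrel => //; rewrite ji ir.
have kP : (r < m.-1)%N by move: (ltn_ord i); rewrite ir; apply: leq_trans.
pose k : 'I_m.-1 := Ordinal kP.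
have kj : (k.+1 < j)%N || (j.+1 < k)%N by rewrite ji ir ltnSn.
have B1 := @tl_braid k i ir.
refine (steinberg_shift qiP (tl_quad k) (tl_quad i) (tl_quad j)
  B1 (tl_braid ji) (tl_far kj) (IH k i erefl ir)).
Qed.

End HeckeAlgebra.

(** * The Jones elements span *)

Section JonesSpan.
Variables (K : comNzRingType) (A : algType K) (q : K) (m : nat) (g : nat -> A).
Hypothesis g_far : forall i j, (0 < i)%N -> (i.+1 < j < m)%N -> g i * g j = g j * g i.
Hypothesis g_quad : forall i, (0 < i < m)%N -> hecke_quad q (g i).
Hypothesis g_braid : forall i, (0 < i)%N -> (i.+1 < m)%N ->
  g i * g i.+1 * g i = g i.+1 * g i * g i.+1.
Hypothesis g_steinberg : forall i, (0 < i)%N -> (i.+1 < m)%N -> steinberg (g i) (g i.+1) = 0.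
Implicit Types (w u v : seq nat) (t : seq (nat * nat)) (x : nat * nat).

Definition letter (j : nat) : bool := (0 < j < m)%N.
Local Notation gw w := (\prod_(j <- w) g j).

(** Filtration of the algebra by word length, expressed by quantification over linear predicates. *)
Definition below (L : nat) (y : A) : Prop := forall P, lin_closed P ->
  (forall w, all letter w -> (size w <= L)%N -> P (gw w)) -> P y.

Lemma below_lin L : lin_closed (below L).
Proof.
split=> [P [P0 _] //|c y z Hy Hz P lP Pw].
by case: (lP) => _; apply; [apply: Hy | apply: Hz].
Qed.

Lemma below_word L w : all letter w -> (size w <= L)%N -> below L (gw w).
Proof. by move=> vw sw P _; apply. Qed.

Lemma below_le L L' y : (L <= L')%N -> below L y -> below L' y.
Proof.
by move=> LL' Hy P lP Pw; apply: Hy => // w vw wL; apply: Pw => //; apply: leq_trans LL'.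
Qed.

Lemma below_ctx L y u v : all letter u -> all letter v -> below L y ->
  below (size u + L + size v) (gw u * y * gw v).
Proof.
move=> vu vv Hy; apply: (Hy (fun y => below _ (gw u * y * gw v))) => [|w vw wL].
  case: (below_lin (size u + L + size v)) => B0 Bl; split.
    by rewrite mulr0 mul0r.
  by move=> c y1 y2 H1 H2; rewrite mulrDr mulrDl -scalerAr -scalerAl; apply: Bl.
by rewrite -!big_cat; apply: below_word; rewrite ?all_cat ?vu ?vw // !size_cat !leq_add.
Qed.

Lemma below_square i : letter i -> below 1 (g i * g i).
Proof.
move=> li; rewrite g_quad //; case: (below_lin 1) => B0 Bl.
apply: Bl; first by have := @below_word 1 [::]; rewrite big_nil; apply.
apply: (lin_closedZ (P := below 1)); first exact: below_lin.
by have := @below_word 1 [:: i]; rewrite big_seq1 /= li; apply.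
Qed.

(** This is where the Temperley-Lieb relation enters: the vanishing of the Steinberg element
    expresses the braid word through five shorter words. *)
Lemma below_braid i : (0 < i)%N -> (i.+1 < m)%N -> below 2 (g i * g i.+1 * g i).
Proof.
move=> i0 im; have li : letter i by rewrite /letter i0 ltnW.
have li1 : letter i.+1 by rewrite /letter /= im.
have -> : g i * g i.+1 * g i =
    - (1 + g i + g i.+1 + g i * g i.+1 + g i.+1 * g i).
  by apply/eqP; rewrite -addr_eq0 addrC; apply/eqP/g_steinberg.
have W w : all letter w -> (size w <= 2)%N -> below 2 (gw w) by exact: below_word.
have lb := below_lin 2; rewrite -scaleN1r; apply: (lin_closedZ (P := below 2)) => //.
have W2 j k := W [:: j; k]; have W1 j := W [:: j]; have W0 := W [::].
do ![apply: (lin_closedD (P := below 2)) => //].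
- by have := W0; rewrite big_nil; apply.
- by have := W1 i; rewrite big_seq1 /= li; apply.
- by have := W1 i.+1; rewrite big_seq1 /= li1; apply.
- by have := W2 i i.+1; rewrite big_cons big_seq1 /= li li1; apply.
- by have := W2 i.+1 i; rewrite big_cons big_seq1 /= li li1; apply.
Qed.

Lemma gw_comm i w : letter i -> all letter w ->
  all (fun j => (i.+1 < j)%N || (j.+1 < i)%N) w -> g i * gw w = gw w * g i.
Proof.
move=> /andP[i0 im] /allP lw /allP fw; apply: comm_prod => j jw.
have /andP[j0 jm] := lw _ jw; have /orP[ij|ij] := fw _ jw; first by rewrite g_far // ij.
by rewrite [RHS]g_far // ij.
Qed.

Definition block_word x : seq nat := rev (iota (x.1 - x.2) x.2.+1).
(** The head of [t] is the last block of the word, so that a letter multiplied on the right meets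
    the head first. *)
Definition jones_word t : seq nat := foldr (fun x w => w ++ block_word x) [::] t.
Definition block_lt (t : seq (nat * nat)) x : bool :=
  if t is y :: _ then (y.1 < x.1)%N && (y.1 - y.2 < x.1 - x.2)%N else true.
Fixpoint jones_rev t : bool :=
  if t is x :: t' then [&& (x.2 < x.1 < m)%N, block_lt t' x & jones_rev t'] else true.

Lemma block_wordE b k : block_word (b, k) = rev (iota (b - k) k.+1).
Proof. by []. Qed.

Lemma block_word1 i : block_word (i, 0%N) = [:: i].
Proof. by rewrite /block_word /= subn0. Qed.

Lemma letter_rev_iota a l : (0 < a)%N -> (a + l <= m)%N -> all letter (rev (iota a l)).
Proof.
move=> a0 al; rewrite all_rev; apply/allP => j; rewrite mem_iota /letter.
by move: a0 al; clear; lia.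
Qed.

Lemma letter_block x : (x.2 < x.1 < m)%N -> all letter (block_word x).
Proof. by move=> xm; apply: letter_rev_iota; move: xm; clear; lia. Qed.

Lemma letter_jones t : jones_rev t -> all letter (jones_word t).
Proof.
elim: t => //= x t IH /and3P[xm _ /IH lt].
by rewrite all_cat lt letter_block.
Qed.

Lemma rev_iota_split a l1 l2 : rev (iota a (l1 + l2)) = rev (iota (a + l1) l2) ++ rev (iota a l1).
Proof. by rewrite iotaD rev_cat. Qed.

(** Write the last block as [b, ..., a] with [a = b - k]. A letter [i > b] starts a new block;
    [i = a - 1] extends the last one unless the previous block ends at [i]; [i < a - 1] commutes
    with the last block and is passed to the earlier ones; [a <= i <= b] shortens the word. The last
    clause of the first alternative allows a block that was passed over to be put back. *)
Lemma jones_mulr t i : jones_rev t -> letter i ->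
  (exists t', [/\ jones_rev t', size (jones_word t') = (size (jones_word t)).+1,
      gw (jones_word t) * g i = gw (jones_word t')
    & forall x, (i < x.1)%N -> (i < x.1 - x.2)%N -> block_lt t x -> block_lt t' x])
  \/ below (size (jones_word t)) (gw (jones_word t) * g i).
Proof.
move=> + li; have i0 : (0 < i)%N by case/andP: li.
have im : (i < m)%N by case/andP: li.
elim: t => [_|[b k] t IH].
  left; exists [:: (i, 0%N)]; split=> //=; first by rewrite im i0.
  - by rewrite big_nil mul1r block_word1 big_seq1.
  - by move=> x; rewrite subn0 => -> ->.
move=> /= /and3P[/andP[kb bm] ltx jt].
have lt := letter_jones jt.
have [ib|bi] := leqP i b; last first.
  left; exists ((i, 0%N) :: (b, k) :: t); split=> //=.
  - by rewrite im i0 kb bm ltx jt subn0 bi /=; move: bi; clear; lia.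
  - by rewrite block_word1 size_cat addn1.
  - by rewrite block_word1 [in RHS]big_cat /= big_seq1.
  - by move=> x; rewrite subn0 => -> ->.
have [ai|ia] := ltnP (b - k) i.
  (* Here [a < i <= b]: the block contains [i, i - 1], the new letter commutes with what follows
     them, and the braid word [i, i - 1, i] appears. *)
  right; set u := rev (iota i.+1 (b - i)); set v := rev (iota (b - k) (i.-1 - (b - k))).
  have bE : block_word (b, k) = u ++ [:: i; i.-1] ++ v.
    rewrite block_wordE; have -> : k.+1 = (i.-1 - (b - k) + (2 + (b - i)))%N.
      by move: ai ib kb; clear; lia.
    rewrite !rev_iota_split -catA.
    have -> : (b - k + (i.-1 - (b - k)))%N = i.-1 by move: ai; clear; lia.
    have -> : (i.-1 + 2)%N = i.+1 by move: i0; clear; lia.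
    by rewrite /u /= /rev /= prednK.
  have lv : all letter v by apply: letter_rev_iota; move: ai ib kb bm; clear; lia.
  have lu : all letter u by apply: letter_rev_iota; move: ai ib kb bm; clear; lia.
  have cv : g i * gw v = gw v * g i.
    apply: gw_comm => //; rewrite all_rev; apply/allP => j; rewrite mem_iota.
    by move: ai; clear; lia.
  have -> : gw (jones_word ((b, k) :: t)) * g i =
      gw (jones_word t ++ u) * (g i.-1.+1 * g i.-1 * g i.-1.+1) * gw v.
    by rewrite /= bE !big_cat !big_cons /= ?big_nil ?mulr1 !mulrA prednK // -!mulrA cv.
  rewrite -g_braid; first 1 last.
  - by move: ai i0 im kb; clear; lia.
  - by move: ai i0 im kb; clear; lia.
  apply: (@below_le (size (jones_word t ++ u) + 2 + size v)).
    by rewrite /= bE !size_cat /=; clear; lia.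
  apply: below_ctx => //; first by rewrite all_cat lt lu.
  by apply: below_braid; move: ai i0 im kb; clear; lia.
case: (ltngtP i.+1 (b - k)) => iE.
- have lb : all letter (block_word (b, k)) by apply: letter_block; rewrite kb bm.
  have cb : g i * gw (block_word (b, k)) = gw (block_word (b, k)) * g i.
    apply: gw_comm => //; rewrite block_wordE all_rev; apply/allP => j; rewrite mem_iota.
    by move: iE; clear; lia.
  have E : gw (jones_word ((b, k) :: t)) * g i = gw (jones_word t) * g i * gw (block_word (b, k)).
    by rewrite /= big_cat /= -!mulrA cb.
  case: (IH jt) => [[t' [jt' st' gt' bt']]|blw]; [left | right].
    exists ((b, k) :: t'); split=> /=.
    + rewrite kb bm jt' bt' //=; move: iE kb; clear; lia.
    + by rewrite !size_cat st'.
    + by rewrite E gt' big_cat.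
    + by move=> x.
  have := @below_ctx _ _ [::] (block_word (b, k)) isT lb blw.
  by rewrite big_nil mul1r -E /= size_cat.
- have {iE ia} iE : i = (b - k)%N by move: iE ia; clear; lia.
  (* The new letter repeats the last letter of the block, and the quadratic relation applies. *)
  right; set u := rev (iota i.+1 k).
  have bE : block_word (b, k) = u ++ [:: i].
    by rewrite block_wordE -iE -[k.+1]add1n rev_iota_split addn1.
  have lu : all letter u by apply: letter_rev_iota; move: iE kb bm; clear; lia.
  have := @below_ctx _ _ (jones_word t ++ u) [::] _ isT (below_square li).
  rewrite all_cat lt lu => /(_ isT); rewrite big_nil mulr1 addn0 /= bE => H.
  by rewrite catA [in X in below X _]size_cat [in X in below _ X]big_cat big_seq1 /= -mulrA.
- case: (boolP (block_lt t (b, k.+1))) => bt.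
    left; exists ((b, k.+1) :: t); split=> /=.
    + by rewrite bt jt bm /=; move: iE kb i0; clear; lia.
    + by rewrite !size_cat !size_rev !size_iota addnS.
    + rewrite !big_cat /= -mulrA; congr (_ * _); rewrite !block_wordE.
      rewrite -[k.+2]add1n rev_iota_split addn1 big_cat big_seq1 /=.
      have -> : (b - k.+1)%N = i by move: iE; clear; lia.
      by rewrite iE.
    + move=> x _ _; rewrite subnS => /andP[-> lx]; move: lx; clear; lia.
  (* The extension fails only if the previous block ends at [i]. The last block ends at [i + 1] and
     its other letters commute with [i], so that the braid word [i, i + 1, i] appears. *)
  case: t IH ltx jt lt bt => [//|[b' k'] t] IH /= /andP[bb' ab'] /and3P[/andP[kb' bm'] ltx jt].
  rewrite all_cat => /andP[lt lb'] bt.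
  have {bt} a'E : (b' - k')%N = i.
    by move: bt ab' iE i0; rewrite bb' /= subnS; clear; lia.
  right; set u := rev (iota i.+1 k'); set v := rev (iota i.+2 k).
  have bE' : block_word (b', k') = u ++ [:: i].
    by rewrite block_wordE a'E -[k'.+1]add1n rev_iota_split addn1.
  have bE : block_word (b, k) = v ++ [:: i.+1].
    by rewrite block_wordE -iE -[k.+1]add1n rev_iota_split addn1.
  have lu : all letter u by apply: letter_rev_iota; move: a'E kb' bm'; clear; lia.
  have lv : all letter v by apply: letter_rev_iota; move: iE kb bm; clear; lia.
  have cv : g i * gw v = gw v * g i.
    apply: gw_comm => //; rewrite all_rev; apply/allP => j; rewrite mem_iota.
    by clear; lia.
  have := @below_ctx _ _ (jones_word t ++ u ++ v) [::] _ isT (@below_braid i i0 _).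
  rewrite !all_cat lt lu lv big_nil mulr1 addn0 => /(_ isT) H.
  rewrite bE bE'.
  have -> : gw ((jones_word t ++ u ++ [:: i]) ++ v ++ [:: i.+1]) * g i =
     gw (jones_word t ++ u ++ v) * (g i * g i.+1 * g i).
    by rewrite !big_cat !big_seq1 /= !mulrA -!(mulrA _ (g i) (gw v)) cv !mulrA.
  apply: below_le (H _); last by move: iE kb bm; clear; lia.
  by rewrite !size_cat /=; clear; lia.
Qed.

Definition jones_below (L : nat) (y : A) : Prop := forall P, lin_closed P ->
  (forall t, jones_rev t -> (size (jones_word t) <= L)%N -> P (gw (jones_word t))) -> P y.

Lemma jones_below_lin L : lin_closed (jones_below L).
Proof.
split=> [P [P0 _] //|c y z Hy Hz P lP Pw].
by case: (lP) => _; apply; [apply: Hy | apply: Hz].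
Qed.

(** Induction on the length: when multiplication by the last letter does not give a Jones word, it
    leaves shorter words, which the induction hypothesis covers. *)
Lemma word_jones_below L w : all letter w -> (size w <= L)%N -> jones_below L (gw w).
Proof.
elim: L w => [|L IH] w.
  by move=> _; rewrite leqn0 => /nilP-> P _ H; have := H [::]; apply.
case/lastP: w => [_ _ P _ H|w i]; first by have := H [::]; apply.
rewrite all_rcons size_rcons => /andP[li lw] sw; rewrite -cats1 big_cat big_seq1 /=.
apply: (IH w lw sw (fun y => jones_below L.+1 (y * g i))) => [|t jt tL].
  case: (jones_below_lin L.+1) => B0 Bl; split=> [|c y z Hy Hz]; first by rewrite mul0r.
  by rewrite mulrDl -scalerAl; apply: Bl.
case: (jones_mulr jt li) => [[t' [jt' st' -> _]]|].
  by move=> P _; apply => //; rewrite st'.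
move=> H; apply: H => [|u lu su]; first exact: jones_below_lin.
move=> P lP Pt; apply: (IH u lu (leq_trans su tL)) => // t1 jt1 st1.
by apply: Pt => //; apply: leqW.
Qed.

Lemma jones_words_span (P : A -> Prop) : lin_closed P ->
  (forall t, jones_rev t -> P (gw (jones_word t))) ->
  forall w, all letter w -> P (gw w).
Proof.
by move=> lP Pt w lw; apply: (word_jones_below lw (leqnn _)) => // t jt _; apply: Pt.
Qed.

End JonesSpan.

Section JonesSeq.
Variable m : nat.
Implicit Types (s : seq (nat * nat)).

Lemma jones_revE t : jones_rev m t =
  all (fun x : nat * nat => x.2 < x.1 < m)%N t &&
  sorted (fun x y : nat * nat => (y.1 < x.1)%N && (y.1 - y.2 < x.1 - x.2)%N) t.
Proof.
elim: t => //= x t ->; rewrite -!andbA; congr (_ && (_ && _)).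
case: t => //= y t; rewrite -!andbA.
by case: (all _ t); rewrite ?andbF ?andbT //; do ![case: (_ < _)%N => //=].
Qed.

Lemma sorted_ltn_size (r : seq nat) a b : sorted ltn r ->
  all (fun x => a <= x < a + b)%N r -> (size r <= b)%N.
Proof.
move=> sr ar; rewrite -(size_iota a b); apply: uniq_leq_size.
  by apply: sorted_uniq sr; [apply: ltn_trans | move=> x; apply: ltnn].
by move=> x /(allP ar); rewrite mem_iota.
Qed.

(** Reversal turns the two increasing sequences into the decreasing condition of [jones_rev]; the
    number of blocks is bounded because the [i_j] are distinct elements of [1, m - 1]. *)
Lemma jones_seqE s : jones_seq m s = jones_rev m (rev s).
Proof.
rewrite jones_revE all_rev rev_sorted.
have -> : sorted (fun y x : nat * nat => (y.1 < x.1)%N && (y.1 - y.2 < x.1 - x.2)%N) s =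
    sorted ltn [seq x.1 | x <- s] && sorted ltn [seq (x.1 - x.2)%N | x <- s].
  rewrite !sorted_map -sorted_relI; by case: s.
rewrite /jones_seq.
have -> : all (fun x => (x.2 < x.1)%N && (x.1 <= m.-1)%N) s =
          all (fun x : nat * nat => x.2 < x.1 < m)%N s.
  by apply: eq_all => x; clear; lia.
case: (boolP (all _ s)) => /= [al|]; last by rewrite andbF.
case: (boolP (sorted ltn _)) => /= [so|]; last by rewrite andbF.
case: (boolP (sorted ltn _)) => /= [_|]; last by rewrite andbF.
rewrite andbT -(size_map (fun x : nat * nat => x.1)); apply: (@sorted_ltn_size _ 1) => //.
by apply/allP => _ /mapP[x /(allP al) xm ->]; move: xm; clear; lia.
Qed.

Lemma jones_word_rev s : jones_word (rev s) = flatten [seq block_word x | x <- s].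
Proof.
elim: s => // x s IH; rewrite rev_cons -cats1 /jones_word foldr_cat /= -/(jones_word _) -IH.
have E w t : foldr (fun x w => w ++ block_word x) w t = w ++ jones_word t.
  by elim: t => [|y t /= ->]; rewrite ?cats0 ?catA.
by rewrite E.
Qed.

Lemma rev_iotaE b k : (k <= b)%N ->
  rev (iota (b - k) k.+1) = [seq (b - t)%N | t <- iota 0 k.+1].
Proof.
elim: k => [|k IH] kb; first by rewrite /= subn0.
have -> : iota (b - k.+1) k.+2 = (b - k.+1)%N :: iota (b - k) k.+1.
  by rewrite -[LHS]/((b - k.+1)%N :: iota (b - k.+1).+1 k.+1) -subSn // subSS.
have iE : iota 0 (k.+1 + 1) = iota 0 k.+1 ++ [:: k.+1] by rewrite iotaD.
rewrite addn1 in iE; rewrite iE map_cat rev_cons IH; last exact: ltnW.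
by rewrite -cats1.
Qed.

End JonesSeq.

Section TLSpan.
Variables (K : comNzRingType) (q qi : K) (qiP : q * qi = 1) (m : nat).
Local Notation pr := (qproj (tl_proper q m)).
Local Notation g j := (pr (hgenn q m j)).

Lemma hgennE (i : 'I_m.-1) : hgenn q m i.+1 = hgen q i.
Proof.
rewrite /hgenn /=; case: insubP => [u _ ui|]; last by rewrite ltn_ord.
by congr hgen; apply/val_inj.
Qed.

Lemma letterE j : letter m j -> exists i : 'I_m.-1, j = i.+1.
Proof.
case: j => // j jm; have jP : (j < m.-1)%N by move: jm; rewrite /letter; clear; lia.
by exists (Ordinal jP).
Qed.

Lemma jones_eltE s : jones_seq m s -> pr (jones_elt q m s) = \prod_(j <- jones_word (rev s)) g j.
Proof.
rewrite jones_seqE jones_revE all_rev => /andP[al _].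
rewrite jones_word_rev big_flatten big_map rmorph_prod; apply: eq_big_seq => x xs.
have /andP[xx _] := allP al _ xs.
rewrite rmorph_prod /block_word rev_iotaE; last exact: ltnW.
by rewrite big_map -[iota 0 _]/(index_iota 0 x.2.+1) big_mkord.
Qed.

Lemma jones_spans : spans (fun x : TL q m => exists2 s, jones_seq m s & x = pr (jones_elt q m s)).
Proof.
move=> P lP Pe; apply: tl_spans => // _ [s ->].
have -> : \prod_(i <- s) pr (hgen q i) = \prod_(j <- [seq (nat_of_ord i).+1 | i <- s]) g j.
  by rewrite big_map; apply: eq_bigr => i _; rewrite hgennE.
pose h j : TL q m := g j.
have hE (i : 'I_m.-1) : h i.+1 = pr (hgen q i) by rewrite /h hgennE.
have h_far i j : (0 < i)%N -> (i.+1 < j < m)%N -> h i * h j = h j * h i.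
  move=> i0 ij; have [k ik] : exists k : 'I_m.-1, i = k.+1.
    by apply: letterE; rewrite /letter; move: ij i0; clear; lia.
  have [l jl] : exists l : 'I_m.-1, j = l.+1.
    by apply: letterE; rewrite /letter; move: ij; clear; lia.
  by rewrite ik jl !hE; apply: tl_far; move: ij; rewrite ik jl; clear; lia.
have h_next i : (0 < i)%N -> (i.+1 < m)%N -> exists k l : 'I_m.-1,
    [/\ i = k.+1, i.+1 = l.+1 & l = k.+1 :> nat].
  move=> i0 im; have [k ik] : exists k : 'I_m.-1, i = k.+1.
    by apply: letterE; rewrite /letter i0 ltnW.
  have [l jl] : exists l : 'I_m.-1, i.+1 = l.+1 by apply: letterE; rewrite /letter.
  by exists k, l; split=> //; move: jl; rewrite ik => -[].
have h_quad i : (0 < i < m)%N -> hecke_quad q (h i).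
  by move=> /letterE[k ->]; rewrite hE; apply: tl_quad.
have h_braid i : (0 < i)%N -> (i.+1 < m)%N -> h i * h i.+1 * h i = h i.+1 * h i * h i.+1.
  move=> i0 im; have [k [l [-> -> kl]]] := h_next i i0 im; rewrite !hE.
  exact: tl_braid.
have h_st i : (0 < i)%N -> (i.+1 < m)%N -> steinberg (h i) (h i.+1) = 0.
  move=> i0 im; have [k [l [-> -> kl]]] := h_next i i0 im; rewrite !hE.
  exact: (tl_steinberg qiP).
refine (jones_words_span h_far h_quad h_braid h_st lP _ _) => [t jt|].
  apply: Pe; exists (rev t); first by rewrite jones_seqE revK.
  by rewrite jones_eltE ?jones_seqE revK.
by rewrite all_map; apply/allP => i _; rewrite /= /letter /=; move: (ltn_ord i); clear; lia.
Qed.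

End TLSpan.

(** * Enumeration of the Jones normal forms *)

Section JonesCount.

(* Pairs [(a_1 < ... < a_p, b_1 < ... < b_(p+h))] in [x, x + r) with
   [a_j <= b_(j+h)]; [h] counts the intervals already open before [x]. *)
Fixpoint open_pairs (x r h : nat) : seq (seq nat * seq nat) :=
  if r is r'.+1 then
    open_pairs x.+1 r' h
    ++ [seq (x :: p.1, x :: p.2) | p <- open_pairs x.+1 r' h]
    ++ [seq (x :: p.1, p.2) | p <- open_pairs x.+1 r' h.+1]
    ++ (if h is h'.+1 then [seq (p.1, x :: p.2) | p <- open_pairs x.+1 r' h'] else [::])
  else if h == 0%N then [:: ([::], [::])] else [::].

(** Ballot numbers, as differences of neighboring binomial coefficients. The four choices for the
    point [x] give a recursion that matches Pascal's rule used twice; for [h = 0] the missing choice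
    is accounted for by the symmetry [c 0 = c 1]. *)
Lemma size_open_pairs x r h :
  (size (open_pairs x r h) + 'C(r.*2.+1, r + h.+2) = 'C(r.*2.+1, r + h.+1))%N.
Proof.
elim: r x h => [|r IH] x h; first by case: h.
pose c j := 'C(r.*2.+1, r + j); have {}IH y k : (size (open_pairs y r k) + c k.+2 = c k.+1)%N by [].
have P3 j : 'C(r.+1.*2.+1, r.+1 + j.+1) = (c j.+2 + (c j.+1).*2 + c j)%N.
  by rewrite /c doubleS addSn !addnS !binS; clear; lia.
rewrite !P3 /= !size_cat !size_map; have := IH x.+1 h; have := IH x.+1 h.+1.
case: h => [|h]; last first.
  have := IH x.+1 h; rewrite size_map.
  by do ?[move: (size _)]; do ?[move: (c _)]; clear; lia.
have : c 0%N = c 1%N.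
  rewrite /c addn0 addn1 -bin_sub; last by clear; lia.
  by congr 'C(_, _); clear; lia.
by rewrite /=; do ?[move: (size _)]; do ?[move: (c _)]; clear; lia.
Qed.

(** Both numbers are rational multiples of the binomial coefficient of [r + 1] in row [2 r + 1]; [D]
    is the ratio of two neighbors in that row. *)
Lemma catalanE r : size (open_pairs 1 r 0) = catalan r.+1.
Proof.
have E := size_open_pairs 1 r 0; rewrite !addnS addn0 in E.
rewrite /catalan; have : ('C(r.+1.*2, r.+1) = 'C(r.*2.+1, r.+1).*2)%N.
  have sym : 'C(r.*2.+1, r) = 'C(r.*2.+1, r.+1).
    rewrite -bin_sub; last by clear; lia.
    by congr 'C(_, _); clear; lia.
  by rewrite doubleS binS sym addnn.
move=> ->; have D : ('C(r.*2.+1, r.+2) * r.+2 = 'C(r.*2.+1, r.+1) * r)%N.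
  have := mul_bin_left r.*2.+1 r.+1; rewrite mulnC => ->; rewrite mulnC; congr (_ * _)%N.
  by clear; lia.
apply/eqP; rewrite -(eqn_pmul2r (isT : (0 < r.+2)%N)) eq_sym divnK.
  by apply/eqP; move: D; rewrite -E; clear; nia.
apply/dvdnP; exists (size (open_pairs 1 r 0)); move: D; rewrite -E; clear; nia.
Qed.

Definition incr_in (x r : nat) (s : seq nat) : bool :=
  sorted ltn s && all (fun y => x <= y < x + r)%N s.

Lemma sorted_cons_range x r (s : seq nat) :
  (sorted ltn s && all (fun y => x <= y < x + r.+1)%N s) =
  if s is y :: s' then
    if y == x then sorted ltn s' && all (fun y => x.+1 <= y < x.+1 + r)%N s'
    else sorted ltn s && all (fun y => x.+1 <= y < x.+1 + r)%N s
  else true.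
Proof.
case: s => // y s /=; rewrite addSnnS.
have pE z : path ltn z s = sorted ltn s && all (fun y => z < y)%N s.
  by rewrite path_sortedE //; [rewrite andbC | apply: ltn_trans].
rewrite pE; case: eqP => [->|yx].
  rewrite leqnn /= addnS ltnS leq_addr /= -andbA; congr (_ && _); rewrite -all_predI.
  by apply: eq_all => z /=; clear; lia.
rewrite -!andbA; congr (_ && _).
have -> : (x <= y)%N = (x < y)%N by move: yx; clear; lia.
case: (boolP (all (ltn y) s)) => // ys; case: (boolP (x < y)%N) => //= xy.
congr (_ && _); apply: eq_in_all => z /(allP ys) /=; move: xy; clear; lia.
Qed.

Definition open_ok (x r h : nat) (a b : seq nat) : bool :=
  [&& incr_in x r a, incr_in x r b, size b == (size a + h)%N & all2 leq a (drop h b)].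

(** For an increasing sequence with entries at least [x] this says that [x] does not occur. *)
Definition skips (x : nat) (s : seq nat) : bool := if s is y :: _ then y != x else true.

Lemma incr_in_skip x r s : skips x s -> incr_in x r.+1 s = incr_in x.+1 r s.
Proof. by rewrite /incr_in sorted_cons_range; case: s => //= y s /negPf->. Qed.

Lemma incr_in_cons x r s : incr_in x r.+1 (x :: s) = incr_in x.+1 r s.
Proof. by rewrite /incr_in sorted_cons_range eqxx. Qed.

Lemma incr_in_skips x r s : incr_in x.+1 r s -> skips x s.
Proof. by case: s => // y s /andP[_ /andP[+ _]] /=; clear; lia. Qed.

Lemma all2_leq_cons_drop x r h a b : incr_in x.+1 r b -> size b = (size a + h.+1)%N ->
  all2 leq (x :: a) (drop h b) = all2 leq a (drop h.+1 b).
Proof.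
move=> /andP[_ /allP rb] sb; have hb : (h < size b)%N by rewrite sb addnS ltnS leq_addl.
rewrite (drop_nth 0%N hb) /=.
by have /andP[/ltnW-> _] := rb _ (mem_nth 0%N hb).
Qed.

Lemma open_ok_none x r h a b : skips x a -> skips x b ->
  open_ok x r.+1 h a b = open_ok x.+1 r h a b.
Proof. by move=> sa sb; rewrite /open_ok !incr_in_skip. Qed.

Lemma open_ok_both x r h a b : open_ok x r.+1 h (x :: a) (x :: b) = open_ok x.+1 r h a b.
Proof.
rewrite /open_ok !incr_in_cons /= addSn eqSS; case: (boolP (incr_in _ _ a)) => //= ia.
case: (boolP (incr_in _ _ b)) => //= ib; case: eqP => //= sb.
case: h sb => [|h] sb; first by rewrite !drop0 leqnn.
exact: all2_leq_cons_drop ib sb.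
Qed.

Lemma open_ok_left x r h a b : skips x b ->
  open_ok x r.+1 h (x :: a) b = open_ok x.+1 r h.+1 a b.
Proof.
move=> skb; rewrite /open_ok incr_in_cons incr_in_skip //= addSnnS.
case: (boolP (incr_in _ _ a)) => //= ia; case: (boolP (incr_in _ _ b)) => //= ib.
by case: eqP => //= sb; apply: all2_leq_cons_drop ib sb.
Qed.

Lemma open_ok_right x r h a b : skips x a ->
  open_ok x r.+1 h a (x :: b) = if h is h'.+1 then open_ok x.+1 r h' a b else false.
Proof.
move=> ska; rewrite /open_ok incr_in_cons incr_in_skip //=.
case: h => [|h]; last by rewrite addnS eqSS.
case: (boolP (incr_in _ _ a)) => //= ia; case: (incr_in _ _ b) => //=.
case: a ia ska => [|y a] //= /andP[_ /andP[/andP[xy _] _]] _.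
by rewrite leqNgt xy andbF.
Qed.

Lemma mem_map_pair (T U : eqType) (f : T -> U) (L : seq T) (p : T) : injective f ->
  (f p \in map f L) = (p \in L).
Proof. by move=> inj; rewrite seq.mem_map. Qed.

(** The first point [x] opens an interval, closes one, does both or neither, and it can occur only
    at the heads of the two sequences; the four pieces of [open_pairs] correspond to these cases. *)
Lemma mem_open_pairs x r h a b : ((a, b) \in open_pairs x r h) = open_ok x r h a b.
Proof.
elim: r x h a b => [|r IH] x h a b.
  have E y s : incr_in y 0 s = (s == [::]).
    case: s => // z s; rewrite /incr_in /= addn0; apply/negP => /andP[_ /andP[+ _]].
    by clear; lia.
  rewrite /open_ok !E /=; case: h => [|h] /=; last first.
    by case: a => // ; case: b.
  by rewrite inE xpair_eqE; case: a => //; case: b.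
have inj1 : injective (fun p : seq nat * seq nat => (x :: p.1, x :: p.2)).
  by move=> [? ?] [? ?] /= [-> ->].
have inj2 : injective (fun p : seq nat * seq nat => (x :: p.1, p.2)).
  by move=> [? ?] [? ?] /= [-> ->].
have inj3 : injective (fun p : seq nat * seq nat => (p.1, x :: p.2)).
  by move=> [? ?] [? ?] /= [-> ->].
have sk y k c e : (c, e) \in open_pairs y.+1 r k -> skips y c /\ skips y e.
  by rewrite IH => /and3P[/incr_in_skips-> /incr_in_skips->].
have no1 c e k : ~~ (skips x c) || ~~ (skips x e) -> ((c, e) \in open_pairs x.+1 r k) = false.
  by move=> H; apply/negP => /sk[]; move: H; case: skips; case: skips.
have n12 c e L : skips x c || skips x e ->
    ((c, e) \in [seq (x :: p.1, x :: p.2) | p <- L]) = false.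
  by move=> H; apply/negP => /mapP[p _ [cE eE]]; move: H; rewrite cE eE /= eqxx.
have n1 c e L : skips x c -> ((c, e) \in [seq (x :: p.1, p.2) | p <- L]) = false.
  by move=> H; apply/negP => /mapP[p _ [cE _]]; move: H; rewrite cE /= eqxx.
have n1' c e k : ~~ skips x e ->
    ((c, e) \in [seq (x :: p.1, p.2) | p <- open_pairs x.+1 r k]) = false.
  by move=> H; apply/negP => /mapP[[? ?] /sk[_ H'] [_ eE]]; move: H; rewrite eE H'.
have n2 c e L : skips x e -> ((c, e) \in [seq (p.1, x :: p.2) | p <- L]) = false.
  by move=> H; apply/negP => /mapP[p _ [_ eE]]; move: H; rewrite eE /= eqxx.
have n2' c e k : ~~ skips x c ->
    ((c, e) \in [seq (p.1, x :: p.2) | p <- open_pairs x.+1 r k]) = false.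
  by move=> H; apply/negP => /mapP[[? ?] /sk[H' _] [cE _]]; move: H; rewrite cE H'.
have shape s : skips x s \/ exists s', s = x :: s'.
  by case: s => [|y s]; [left | case: (eqVneq y x) => [->|H]; [right; exists s | left]].
rewrite /= !mem_cat; case: (shape a) => [sa|[a' ->]]; case: (shape b) => [sb|[b' ->]].
- rewrite open_ok_none // -IH n12 ?sa // n1 //=.
  by case: h => [|h]; rewrite ?n2 // orbF.
- rewrite open_ok_right // n12 ?sa // n1 //= no1 /= ?eqxx ?orbT //.
  by case: h => [|h] //; rewrite (mem_map_pair _ (a, b') inj3) IH.
- rewrite open_ok_left // -IH n12 ?sb ?orbT // no1 /= ?eqxx //.
  rewrite (mem_map_pair _ (a', b) inj2).
  by case: h => [|h]; rewrite ?n2 // orbF.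
- rewrite open_ok_both -IH no1 /= ?eqxx // (mem_map_pair _ (a', b') inj1).
  rewrite n1' /= ?eqxx //=.
  by case: h => [|h]; rewrite ?n2' /= ?eqxx // orbF.
Qed.

Lemma uniq_open_pairs x r h : uniq (open_pairs x r h).
Proof.
elim: r x h => [|r IH] x h; first by rewrite /=; case: (h == 0%N).
have sk y k c e : (c, e) \in open_pairs y.+1 r k -> skips y c /\ skips y e.
  by rewrite mem_open_pairs => /and3P[/incr_in_skips-> /incr_in_skips->].
rewrite /= !cat_uniq !map_inj_uniq ?IH /=; first 1 last.
- by move=> [? ?] [? ?] /= [-> ->].
- by move=> [? ?] [? ?] /= [-> ->].
rewrite !has_cat !negb_or -!andbA; apply/and5P; split=> //.
- by apply/hasPn => _ /mapP[[c e] _ ->]; apply/negP => /sk[]; rewrite /= eqxx.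
- by apply/hasPn => _ /mapP[[c e] _ ->]; apply/negP => /sk[]; rewrite /= eqxx.
- apply/hasPn => [[c e]]; case: h => // h /mapP[[? ?] _ [-> ->]].
  by apply/negP => /sk[_]; rewrite /= eqxx.
- apply/hasPn => _ /mapP[[c e] H ->]; apply/negP => /mapP[[? ?] _ [_ eE]].
  by have [_] := sk _ _ _ _ H; rewrite eE /= eqxx.
apply/andP; split.
  apply/hasPn => [[c e]]; case: h => // h /mapP[[? ?] /sk[H _] [-> ->]].
  by apply/negP => /mapP[[? ?] _ [cE _]]; move: H; rewrite cE /= eqxx.
apply/andP; split.
  apply/hasPn => [[c e]]; case: h => // h /mapP[[? ?] /sk[H _] [-> ->]].
  by apply/negP => /mapP[[? ?] _ [cE _]]; move: H; rewrite cE /= eqxx.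
case: h => // h; rewrite map_inj_uniq ?IH //.
by move=> [? ?] [? ?] /= [-> ->].
Qed.

(* The block [G_i ... G_(i-k)] is recorded by [a = i - k] and [b = i]. *)
Definition jones_of_pair (p : seq nat * seq nat) : seq (nat * nat) :=
  [seq (x.2, (x.2 - x.1)%N) | x <- zip p.1 p.2].

Definition jones_seqs (m : nat) : seq (seq (nat * nat)) :=
  [seq jones_of_pair p | p <- open_pairs 1 m.-1 0].

Lemma size_jones_seqs m : size (jones_seqs m) = catalan m.
Proof.
rewrite size_map; case: m => [|m]; last exact: catalanE.
by rewrite /= /catalan bin0 divn1.
Qed.

Lemma jones_of_pairK a b : all2 leq a b ->
  [seq x.1 | x <- jones_of_pair (a, b)] = b /\
  [seq (x.1 - x.2)%N | x <- jones_of_pair (a, b)] = a.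
Proof.
rewrite /jones_of_pair /=; elim: a b => [|x a IH] [|y b] //= /andP[xy /IH[E1 E2]].
by rewrite E1 E2 subKn.
Qed.

Lemma jones_seqs_uniq m : uniq (jones_seqs m).
Proof.
rewrite map_inj_in_uniq ?uniq_open_pairs // => -[a b] [a' b'].
rewrite !mem_open_pairs /open_ok !drop0.
move=> /and4P[_ _ _ /jones_of_pairK[E1 E2]] /and4P[_ _ _ /jones_of_pairK[E3 E4]] E.
congr (_, _); first by rewrite -E2 -E4 E.
by rewrite -E1 -E3 E.
Qed.

Lemma mem_jones_seqs m s : (s \in jones_seqs m) = jones_seq m s.
Proof.
apply/mapP/idP => [[[a b]]|].
  rewrite mem_open_pairs /open_ok drop0 => /and4P[/andP[sa ra] /andP[sb rb] /eqP ss ab] ->.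
  have [E1 E2] := jones_of_pairK ab; rewrite /jones_seq E1 E2 sa sb !andbT.
  have bP : all (fun x => 1 <= x <= m.-1)%N b by apply: sub_all rb => x; clear; lia.
  rewrite -(size_map (fun x : nat * nat => x.1)) E1 (@sorted_ltn_size _ 1) //=.
  have aP : all (fun x => 0 < x)%N a by apply: sub_all ra => x; clear; lia.
  move: ab aP bP; rewrite /jones_of_pair /=; clear; elim: a b => [|x a IH] [|y b] //=.
  move=> /andP[xy ab] /andP[x0 a0] /andP[y0 b0]; rewrite IH //.
  by move: xy x0 y0; clear; lia.
rewrite /jones_seq => /and4P[_ al s1 s2].
exists ([seq (x.1 - x.2)%N | x <- s], [seq x.1 | x <- s]); last first.
  rewrite /jones_of_pair /= zip_map -map_comp -[LHS]map_id; apply/eq_in_map => -[i k].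
  by move=> /(allP al) /= /andP[ki _]; rewrite subKn // ltnW.
rewrite mem_open_pairs /open_ok /incr_in s1 s2 !size_map addn0 eqxx drop0 /=.
apply/and3P; split.
- by rewrite all_map; apply: sub_all al => -[i k] /=; clear; lia.
- by rewrite all_map; apply: sub_all al => -[i k] /=; clear; lia.
- by clear; elim: s => //= x s ->; rewrite leq_subr.
Qed.
End JonesCount.

(** * The Jones elements are independent *)

Section MatrixColumns.
Variables (K : comNzRingType) (A : algType K) (N : nat) (N_gt0 : (0 < N)%N).
Local Notation M := (matalg A N_gt0).

Lemma scale_mul_ev (c : K) (X : M) k (a : A) :
  (c *: X : M) *m ev k a = X *m ev k (c *: a).
Proof.
apply/colP => l; rewrite !mulmx_ev matalgZ -scalerAl scalerAr; by [].
Qed.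

Lemma one_mul_ev k (a : A) : (1 : M) *m ev k a = ev k a.
Proof. exact: mul1mx. Qed.

Lemma hecke_quad_ev (q : K) (X : M) :
  (forall k, X *m (X *m ev k 1) = ev k (q *: 1) + X *m ev k ((q - 1) *: 1)) ->
  hecke_quad q X.
Proof.
move=> H; apply: mx_ev => k; rewrite matalgM -mulmxA H.
by rewrite [RHS]mulmxDl !scale_mul_ev one_mul_ev.
Qed.

End MatrixColumns.

Section Triangular.
Variables (K : nzRingType) (V : lmodType K) (I : finType) (e : I -> V).
Variables (psi : I -> V -> K) (mu : I -> nat).
Hypothesis psi_lin : forall i c x y, psi i (c *: x + y) = c * psi i x + psi i y.
Hypothesis psi_diag : forall i, psi i (e i) = 1.
Hypothesis psi_tri : forall i j, psi i (e j) != 0 -> j != i -> (mu i < mu j)%N.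

(** Among the indices with nonzero coefficient take [i] with [mu i] maximal; the form [psi i] then
    sees no other term of the relation. *)
Lemma triangular_free : is_free e.
Proof.
move=> c c0 i; apply/eqP; apply/negPn/negP => ci.
case: (@arg_maxnP I i (fun j => c j != 0) mu ci) => {ci}i ci max.
have psi0 : psi i 0 = 0 by have := psi_lin i (-1) 0 0; rewrite scaler0 addr0 mulN1r addNr.
have E : psi i (\sum_j c j *: e j) = \sum_j c j * psi i (e j).
  by apply: (big_rec2 (fun x y => psi i x = y)) => // j x y _ <-; apply: psi_lin.
move: E; rewrite c0 psi0 (bigD1 i) //= psi_diag mulr1 big1 ?addr0 => [E|j ji].
  by rewrite -E eqxx in ci.
case: (eqVneq (psi i (e j)) 0) => [->|pj]; first by rewrite mulr0.
case: (eqVneq (c j) 0) => [->|cj]; first by rewrite mul0r.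
by have /= := max j cj; rewrite leqNgt psi_tri.
Qed.

End Triangular.

(* The Hecke algebra acting on words of particles and holes, where [G_i] sends
   "particle at i, hole at i + 1" to "hole at i, particle at i + 1". *)
Section SpinRep.
Variables (K : comNzRingType) (q : K) (m : nat).
Local Notation sr := (@simple_refl m).
Local Notation F := {ffun 'I_m -> bool}.
Local Notation N := #|{ffun 'I_m -> bool}|.

Implicit Types (i j : 'I_m.-1).

Definition cfg (k : 'I_N) : F := enum_val k.
Definition spin_s (i : 'I_m.-1) (k : 'I_N) : 'I_N := enum_rank [ffun j => cfg k (sr i j)].
(** A particle has color 0 and a hole color 1, so that the move of a particle to the right is the
    color-increasing case of [rep_mx], which has coefficient 1 here. *)
Definition spin_col (k : 'I_N) (j : 'I_m) : nat := ~~ cfg k j.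

Lemma cfg_s i k (j : 'I_m) : cfg (spin_s i k) j = cfg k (sr i j).
Proof. by rewrite /cfg /spin_s enum_rankK ffunE. Qed.

Lemma cfg_inj k l : cfg k =1 cfg l -> k = l.
Proof. by move=> kl; apply: enum_val_inj; apply/ffunP. Qed.

Lemma spin_col_s i k p : spin_col (spin_s i k) p = spin_col k (sr i p).
Proof. by rewrite /spin_col cfg_s. Qed.

Lemma spin_sK i : involutive (spin_s i).
Proof. by move=> k; apply: cfg_inj => j; rewrite !cfg_s /simple_refl tpermK. Qed.

Lemma spin_s_far i j k : (i.+1 < j)%N || (j.+1 < i)%N ->
  spin_s i (spin_s j k) = spin_s j (spin_s i k).
Proof.
by move=> ij; apply: cfg_inj => p; rewrite !cfg_s -!pcompE simple_refl_far // orbC.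
Qed.

Lemma spin_s_braid i j k : j = i.+1 :> nat ->
  spin_s i (spin_s j (spin_s i k)) = spin_s j (spin_s i (spin_s j k)).
Proof.
move=> ij; apply: cfg_inj => p; rewrite !cfg_s.
by have := congr1 (fun u : 'S_m => u p) (simple_refl_braid ij); rewrite !pcompE => ->.
Qed.

Lemma spin_gt0 : (0 < N)%N.
Proof. by rewrite card_ffun card_bool expn_gt0. Qed.

Local Notation M := (matalg K^o spin_gt0).
Definition spin_mx (i : 'I_m.-1) : M :=
  rep_mx 1 q (q - 1) spin_col spin_s (fun _ _ => -1 : K^o) i.
Local Notation T := spin_mx.

Lemma spin_quad_scalar : (-1 : K^o) * -1 = q%:A + (q - 1) *: (-1).
Proof. by rewrite mulrNN mulr1 scalerN scalerBl scale1r opprB addrC subrK. Qed.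

Lemma spin_far i j : (i.+1 < j)%N || (j.+1 < i)%N -> T i * T j = T j * T i.
Proof.
exact: (rep_far _ _ _ spin_col_s spin_s_far).
Qed.

Lemma spin_braid i j : j = i.+1 :> nat -> T i * T j * T i = T j * T i * T j.
Proof.
apply: (rep_braid (mul1r q) (or_intror erefl) spin_col_s spin_sK spin_s_braid) => //.
by move=> *; apply: spin_quad_scalar.
Qed.

Lemma spin_eq i k (u : K^o) : spin_col k (pos_lo i) = spin_col k (pos_hi i) ->
  T i *m ev k u = ev k (- u).
Proof. by move=> ki; rewrite -mulN1r; apply: T_eq. Qed.

Lemma spin_lt i k (u : K^o) : (spin_col k (pos_lo i) < spin_col k (pos_hi i))%N ->
  T i *m ev k u = ev (spin_s i k) u.
Proof. by move=> ki; rewrite -[in RHS](scale1r u); apply: T_lt. Qed.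

Lemma spin_quad i : hecke_quad q (T i).
Proof.
apply: hecke_quad_ev => k.
case: (eqVneq (spin_col k (pos_lo i)) (spin_col k (pos_hi i))) => [ki|/eqP ki].
  rewrite !spin_eq // opprK -evD -scalerN; congr ev.
  by rewrite scalerN scalerBl scale1r opprB addrC subrK.
exact: (rep_quad_ne _ (mul1r q) _ (@spin_col_s) (@spin_sK)).
Qed.

(** Three points carry only two states. If two neighbors agree, the corresponding [T + 1] kills the
    vector; if not, the vector is the image under some [T] of one with equal neighbors, and this [T]
    is absorbed because the Steinberg element times [T] is [q] times itself. *)
Lemma spin_steinberg i j : j = i.+1 :> nat -> steinberg (T i) (T j) = 0.
Proof.
move=> ij; have hl : pos_hi i = pos_lo j by apply/val_inj; rewrite /= ij.
have D1 : pos_hi j != pos_lo i by rewrite -val_eqE /=; move: ij; clear; lia.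
have D2 : pos_hi j != pos_hi i by rewrite -val_eqE /=; move: ij; clear; lia.
have D3 : pos_lo i != pos_lo j by rewrite -val_eqE /=; move: ij; clear; lia.
have D1' : pos_lo i != pos_hi j by rewrite eq_sym.
have D2' : pos_hi i != pos_hi j by rewrite eq_sym.
have D3' : pos_lo j != pos_lo i by rewrite eq_sym.
have kill i' k u : spin_col k (pos_lo i') = spin_col k (pos_hi i') ->
    (T i' + 1) *m ev k u = 0.
  by move=> ki; rewrite mulmxDl spin_eq // mul1mx -evD addNr ev0.
have st i' j' k u : spin_col k (pos_lo i') = spin_col k (pos_hi i') ->
    steinberg (T i') (T j') *m ev k u = 0.
  move=> ki; rewrite (steinbergE _ (spin_quad i')) mulmxBl scale_mul_ev kill // subr0.
  by rewrite matalgM -mulmxA kill // mulmx0.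
have C := steinbergC (spin_braid ij).
have fin i' j' k u : spin_col (spin_s i' k) (pos_lo i') = 0%N ->
    spin_col (spin_s i' k) (pos_hi i') = 1%N ->
    steinberg (T i') (T j') *m ev (spin_s i' k) (q *: u) = 0 ->
    steinberg (T i') (T j') *m ev k u = 0.
  move=> lo hi s0; rewrite -[X in ev X u](spin_sK i' k) -spin_lt ?lo ?hi //.
  by rewrite mulmxA -matalgM (steinberg_mulr _ (spin_quad i')) scale_mul_ev.
apply: mx_ev => k; rewrite mul0mx.
case: (eqVneq (spin_col k (pos_lo i)) (spin_col k (pos_hi i))) => [ki|ki]; first exact: st.
case: (eqVneq (spin_col k (pos_lo j)) (spin_col k (pos_hi j))) => [kj|kj].
  by rewrite C; apply: st.
have v p : spin_col k p = 0%N \/ spin_col k p = 1%N.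
  by rewrite /spin_col; case: (cfg k p); [left | right].
have [lo|lo] := v (pos_lo i).
  have mid : spin_col k (pos_lo j) = 1%N by move: ki; rewrite lo hl; case: (v (pos_lo j)) => ->.
  have hi : spin_col k (pos_hi j) = 0%N by move: kj; rewrite mid; case: (v (pos_hi j)) => ->.
  rewrite C; apply: fin; rewrite ?spin_col_s /simple_refl ?tpermL ?tpermR ?hi ?mid //.
  rewrite -C; apply: st; rewrite !spin_col_s hl /simple_refl tpermL tpermD //.
  by rewrite lo hi.
have mid : spin_col k (pos_lo j) = 0%N by move: ki; rewrite lo hl; case: (v (pos_lo j)) => ->.
have hi : spin_col k (pos_hi j) = 1%N by move: kj; rewrite mid; case: (v (pos_hi j)) => ->.
apply: fin; rewrite ?spin_col_s /simple_refl ?tpermL ?tpermR ?hl ?lo ?mid //.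
rewrite C; apply: st; rewrite !spin_col_s -hl /simple_refl tpermR tpermD //.
by rewrite lo hi.
Qed.

Lemma spin_rep : exists rho : {lrmorphism TL q m -> M},
  forall i, rho (qproj (tl_proper q m) (hgen q i)) = T i.
Proof.
have [h hE] := hecke_lift spin_far spin_braid spin_quad.
have [|g gE] := @tl_lift K q m M h.
  by move=> i j i0 j1; rewrite !hE spin_steinberg // i0 j1.
by exists g => i; rewrite gE hE.
Qed.

End SpinRep.

(** * Top matrix entries of words, as moves of particles *)

Section SpinMoves.
Variables (K : comNzRingType) (q : K) (m : nat).
Local Notation N := #|{ffun 'I_m -> bool}|.
Local Notation T := (spin_mx q).
Local Notation M := (matalg K^o (spin_gt0 m)).
Implicit Types (k l p : 'I_N) (i : 'I_m.-1) (w : seq nat).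

(** A generator raises this by at most 1, so that a matrix entry which raises it by the length of
    the word comes from particle moves alone. *)
Definition height k : nat := \sum_(j < m) cfg k j * j.

Lemma height_s i k :
  (height (spin_s i k) + cfg k (pos_hi i) = height k + cfg k (pos_lo i))%N.
Proof.
have lh : pos_hi i != pos_lo i by rewrite -val_eqE /=; clear; lia.
have -> : height (spin_s i k) = (\sum_(j < m) cfg k j * simple_refl i j)%N.
  rewrite /height (reindex_inj (@perm_inj _ (simple_refl i))); apply: eq_bigr => j _.
  by rewrite cfg_s /simple_refl tpermK.
rewrite /height (bigD1 (pos_lo i)) //= (bigD1 (pos_hi i)) //=.
rewrite [in RHS](bigD1 (pos_lo i)) //= [in RHS](bigD1 (pos_hi i)) //=.
rewrite !simple_reflE /= eqxx (gtn_eqF (ltnSn i)) eqxx.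
rewrite [in LHS](eq_bigr (fun j => cfg k j * j)%N).
  by move: (\sum_(_ < m | _) _)%N; case: (cfg k _); case: (cfg k _) => r; clear; lia.
by move=> j /andP[jl jh]; rewrite /simple_refl tpermD // eq_sym.
Qed.

Lemma spin_mx_top i l p : (height p < height l)%N ->
  T i l p = (cfg p (pos_lo i) && ~~ cfg p (pos_hi i) && (l == spin_s i p))%:R.
Proof.
move=> pl; have lp : (l == p) = false by apply: contraTF pl => /eqP->; rewrite ltnn.
rewrite mxE /spin_col lp !mulr0n addr0; have := height_s i p.
case: (cfg p (pos_lo i)); case: (cfg p (pos_hi i)) => //= H.
  by rewrite scale1r.
by case: eqP => [E|//]; move: pl H; rewrite E; clear; lia.
Qed.

(** Occupation of the sites [1, ..., m], extended by empty sites on both sides so that no bounds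
    have to be carried along. *)
Definition pt k (x : nat) : bool :=
  (0 < x)%N && (if insub x.-1 is Some j then cfg k j else false).
Definition step (j : nat) k : 'I_N := if insub j.-1 is Some i then spin_s i k else k.
Definition spin_letter (j : nat) : M := if insub j.-1 is Some i then T i else 1.
Definition move1 (j : nat) k : option 'I_N :=
  if pt k j && ~~ pt k j.+1 then Some (step j k) else None.
Definition moves w k : option 'I_N := foldr (fun j => obind (move1 j)) (Some k) w.

Lemma ptE k (j : 'I_m) : pt k j.+1 = cfg k j.
Proof.
rewrite /pt /=; case: insubP => [u _ uj|]; last by rewrite ltn_ord.
by congr (cfg k _); apply/val_inj.
Qed.

Lemma pt_out k x : ~~ (0 < x <= m)%N -> pt k x = false.
Proof.
by rewrite /pt; case: x => //= x; case: insubP => // u ->.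
Qed.

Lemma pt_inj k l : pt k =1 pt l -> k = l.
Proof. by move=> kl; apply: cfg_inj => j; rewrite -!ptE kl. Qed.

Lemma insub_letter j : letter m j -> exists2 i : 'I_m.-1, insub j.-1 = Some i & j = i.+1.
Proof.
move=> /letterE[i ->]; exists i => //=.
by rewrite insubT => [|ii]; [apply: ltn_ord | congr Some; apply/val_inj].
Qed.

Lemma pt_lo i k : pt k i.+1 = cfg k (pos_lo i).
Proof. exact: (ptE k (pos_lo i)). Qed.
Lemma pt_hi i k : pt k i.+2 = cfg k (pos_hi i).
Proof. exact: (ptE k (pos_hi i)). Qed.

Lemma pt_step j k x : letter m j ->
  pt (step j k) x = if x == j then pt k j.+1 else if x == j.+1 then pt k j else pt k x.
Proof.
move=> /insub_letter[i ij jE]; rewrite /step ij jE.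
case: (boolP (0 < x <= m)%N) => [xm|nx].
  case: x xm => // x xm; rewrite !eqSS (ptE _ (Ordinal xm)) cfg_s -(ptE k (simple_refl i _)).
  by rewrite simple_reflE /=; case: eqP => // _; case: eqP.
rewrite pt_out //; case: eqP => [E|_].
  by move: nx (ltn_ord i); rewrite E; clear; lia.
case: eqP => [E|_]; last by rewrite pt_out.
by move: nx (ltn_ord i); rewrite E; clear; lia.
Qed.

Lemma moves_cat u v k : moves (u ++ v) k = obind (moves u) (moves v k).
Proof.
rewrite /moves foldr_cat; case: (foldr _ _ v) => [p|] //.
by elim: u => //= j u ->.
Qed.

Lemma moves_height w k p : all (letter m) w -> moves w k = Some p ->
  height p = (height k + size w)%N.
Proof.
elim: w p => [|j w IH] p /=; first by move=> _ [->]; rewrite addn0.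
move=> /andP[lj lw]; case E : (moves w k) => [r|] //=; rewrite /move1.
have := IH r lw E; case: ifP => // /andP[]; have [i ij jE] := insub_letter lj.
rewrite /step ij jE pt_lo pt_hi => lo /negPf hi hr [<-].
by have := height_s i r; rewrite lo hi hr; clear; lia.
Qed.

(** To reach a configuration this high every letter must raise the height by one, hence act by its
    particle move, whose coefficient is 1. *)
Lemma spin_word_top w k l : all (letter m) w -> (height k + size w <= height l)%N ->
  (\prod_(j <- w) spin_letter j : M) l k = (moves w k == Some l)%:R.
Proof.
elim: w l => [|j w IH] l /=.
  by move=> _ _; rewrite big_nil mxE eq_sym.
move=> /andP[lj lw] hl; rewrite big_cons matalgM mxE.
have [i ij jE] := insub_letter lj.
have tj : spin_letter j = T i by rewrite /spin_letter ij.
have E p : spin_letter j l p * (\prod_(j <- w) spin_letter j : M) p k =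
    ((moves w k == Some p) && (move1 j p == Some l))%:R.
  rewrite tj; case: (ltnP (height p) (height l)) => pl; last first.
    have hp : (height k + size w <= height p)%N by move: hl pl; clear; lia.
    rewrite IH //; case: eqP => [mw|]; last by rewrite mulr0.
    by have := moves_height lw mw; move: hl pl; clear; lia.
  rewrite spin_mx_top //.
  have -> : (cfg p (pos_lo i) && ~~ cfg p (pos_hi i) && (l == spin_s i p)) =
      (move1 j p == Some l).
    rewrite /move1 /step ij [in pt _ j]jE [in pt _ j.+1]jE pt_lo pt_hi.
    by case: ifP => //= _; rewrite eq_sym.
  case: eqP => [mv|]; last by rewrite mul0r andbF.
  rewrite mul1r andbT IH //.
  move: mv; rewrite /move1 /step ij [in pt _ j]jE [in pt _ j.+1]jE pt_lo pt_hi.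
  case: ifP => // /andP[lo /negPf hi] [ls].
  by have := height_s i p; rewrite lo hi ls; move: hl; clear; lia.
rewrite (eq_bigr _ (fun p _ => E p)); case mw : (moves w k) => [r|] /=; last first.
  by rewrite big1.
rewrite (bigD1 r) //= eqxx big1 ?addr0 // => p pr.
by case: eqP => // -[rp]; rewrite rp eqxx in pr.
Qed.

(** The letter [a] acts first, and each following letter takes the same particle one site
    further. *)
Lemma moves_block a (l : nat) k p : (0 < a)%N -> (a + l < m)%N ->
  moves (rev (iota a l.+1)) k = Some p ->
  pt k a /\ forall x, pt p x = (x == (a + l).+1) || (x != a) && pt k x.
Proof.
elim: l a k => [|l IH] a k a0 alm.
  have la : letter m a by rewrite /letter a0; move: alm; clear; lia.
  rewrite addn0 /= /move1; case: ifP => // /andP[ka /negPf ka1] [<-]; split=> // x.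
  rewrite pt_step // ka ka1; case: eqP => [->|_] /=; last by case: eqP.
  by rewrite (ltn_eqF (ltnSn a)).
have -> : rev (iota a l.+2) = rev (iota a.+1 l.+1) ++ [:: a] by rewrite /= rev_cons -cats1.
rewrite moves_cat /= [move1 a k]/move1; case: ifP => //= /andP[ka /negPf ka1].
have la : letter m a by rewrite /letter a0; move: alm; clear; lia.
move/IH => []; [by [] | by move: alm; clear; lia | move=> _ H; split=> // x].
rewrite H addSnnS pt_step // ka1.
case: (x == _) => //=; case: eqP => [->|/eqP xa1] /=.
  by rewrite ka1 andbF.
by case: eqP.
Qed.

Lemma moves_block_exists a (l : nat) k : (0 < a)%N -> (a + l < m)%N -> pt k a ->
  (forall x, (a < x <= (a + l).+1)%N -> pt k x = false) ->
  exists p, moves (rev (iota a l.+1)) k = Some p.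
Proof.
elim: l a k => [|l IH] a k a0 alm ka kx.
  by rewrite /= /move1 ka kx ?ltnSn ?addn0 //=; exists (step a k).
have -> : rev (iota a l.+2) = rev (iota a.+1 l.+1) ++ [:: a] by rewrite /= rev_cons -cats1.
have la : letter m a by rewrite /letter a0; move: alm; clear; lia.
have ka1 : pt k a.+1 = false by apply: kx; clear; lia.
rewrite moves_cat /= [move1 a k]/move1 ka ka1 /=; apply: IH => //.
- by move: alm; clear; lia.
- by rewrite pt_step // (gtn_eqF (ltnSn a)) eqxx.
- move=> x xa; rewrite pt_step // ka1 (gtn_eqF (ltnW _)); last by move: xa; clear; lia.
  rewrite gtn_eqF; last by move: xa; clear; lia.
  by apply: kx; move: xa; clear; lia.
Qed.

Definition jones_lt (x y : nat * nat) : bool := (x.1 < y.1)%N && (x.1 - x.2 < y.1 - y.2)%N.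
Definition starts (s : seq (nat * nat)) : seq nat := [seq (x.1 - x.2)%N | x <- s].
Definition ends (s : seq (nat * nat)) : seq nat := [seq x.1.+1 | x <- s].
Local Notation block_ok := (fun x : nat * nat => (x.2 < x.1 < m)%N).
Local Notation jw s := (flatten [seq block_word x | x <- s]).

Lemma jones_pairwise s : jones_seq m s = all block_ok s && pairwise jones_lt s.
Proof.
rewrite jones_seqE jones_revE all_rev rev_sorted; congr (_ && _).
apply: sorted_pairwise => y x z; rewrite /jones_lt.
by move=> /andP[xy xy'] /andP[yz yz']; rewrite (ltn_trans xy) ?(ltn_trans xy').
Qed.

(** The last block acts first. The landing sites of the blocks in [s] all exceed [b + 1], so that
    the block [(b, j)] in front of them finds site [b - j] as it was at the beginning. *)
Lemma moves_jones s k p : all block_ok s -> pairwise jones_lt s -> moves (jw s) k = Some p ->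
  {in starts s, forall a, pt k a} /\
  forall x, pt p x = (x \in ends s) || (x \notin starts s) && pt k x.
Proof.
elim: s p => [|[b j] s IH] p /=; first by move=> _ _ [<-].
move=> /andP[/andP[jb bm] oks] /andP[ltb pws]; rewrite moves_cat.
case mv : (moves (jw s) k) => [r|] //=; have [ks rE] := IH r oks pws mv.
rewrite block_wordE => /moves_block[].
- by move: jb; clear; lia.
- by move: jb bm; clear; lia.
have -> : (b - j + j)%N = b by move: jb; clear; lia.
have nb : (b - j)%N \notin ends s.
  apply/negP => /mapP[y /(allP ltb) /andP[/= lt _]].
  by move: lt jb; clear; lia.
have ns : (b - j)%N \notin starts s.
  by apply/negP => /mapP[y /(allP ltb) /andP[_ /= lt] E]; move: lt; rewrite E ltnn.
rewrite rE (negPf nb) (negPf ns) /= => kbj pE; split.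
  by move=> a; rewrite inE => /orP[/eqP->|/ks].
move=> x; rewrite pE rE !inE negb_or; case: (eqVneq x b.+1) => //= _.
by case: (eqVneq x (b - j)%N) => //= ->; rewrite (negPf nb).
Qed.

Lemma moves_jones_exists s k : all block_ok s -> pairwise jones_lt s ->
  {in starts s, forall a, pt k a} ->
  (forall x, pt k x -> x \in starts s \/ {in starts s, forall a, x < a}%N) ->
  exists p, moves (jw s) k = Some p.
Proof.
elim: s => [|[b j] s IH] /=; first by exists k.
move=> /andP[/andP[jb bm] oks] /andP[ltb pws] ks kx.
have lts a : a \in starts s -> (b - j < a)%N.
  by move=> /mapP[y /(allP ltb) /andP[_ lt] ->].
have lte a : a \in ends s -> (b.+1 < a)%N.
  by move=> /mapP[y /(allP ltb) /andP[lt _] ->].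
have [|x /kx[]|r mv] := IH oks pws.
- by move=> a sa; apply: ks; rewrite inE sa orbT.
- by rewrite inE => /orP[/eqP->|]; [right => a /lts | left].
- by move=> H; right => a sa; apply: H; rewrite inE sa orbT.
have [_ rE] := moves_jones oks pws mv.
rewrite moves_cat mv block_wordE.
apply: moves_block_exists.
- by move: jb; clear; lia.
- by move: jb bm; clear; lia.
- rewrite rE ks ?inE ?eqxx // andbT; apply/orP; right.
  by apply/negP => /lts; rewrite ltnn.
- move=> x xb; rewrite rE; case: (boolP (x \in ends s)) => [/lte|_].
    by move: xb jb; clear; lia.
  case: (boolP (x \in starts s)) => //= xs; apply/negP => /kx[].
    by rewrite inE (negPf xs) orbF => /eqP E; move: xb; rewrite E ltnn.
  by move/(_ (b - j)%N); rewrite inE eqxx => /(_ isT); move: xb; clear; lia.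
Qed.

Definition cfg_set (A : seq nat) : 'I_N := enum_rank [ffun j : 'I_m => j.+1 \in A].

Lemma pt_cfg_set A x : all (fun x => 0 < x <= m)%N A -> pt (cfg_set A) x = (x \in A).
Proof.
move=> /allP rA; case: (boolP (0 < x <= m)%N) => [xm|nx].
  by case: x xm => // x xm; rewrite (ptE _ (Ordinal xm)) /cfg enum_rankK ffunE.
by rewrite pt_out //; apply/esym/negP => /rA; apply/negP.
Qed.

Lemma starts_range s : all block_ok s -> all (fun x => 0 < x <= m)%N (starts s).
Proof. by rewrite all_map; apply: sub_all => -[b j] /=; clear; lia. Qed.
Lemma ends_range s : all block_ok s -> all (fun x => 0 < x <= m)%N (ends s).
Proof. by rewrite all_map; apply: sub_all => -[b j] /=; clear; lia. Qed.

Lemma letter_jw s : all block_ok s -> all (letter m) (jw s).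
Proof.
elim: s => //= x s IH /andP[xm /IH ls].
by rewrite all_cat ls letter_block.
Qed.

Lemma moves_jones_diag s : all block_ok s -> pairwise jones_lt s ->
  moves (jw s) (cfg_set (starts s)) = Some (cfg_set (ends s)).
Proof.
move=> oks pws; have rs := starts_range oks.
have [a|x|p mv] := @moves_jones_exists s (cfg_set (starts s)) oks pws.
- by rewrite pt_cfg_set.
- by rewrite pt_cfg_set //; left.
rewrite mv; congr Some; apply: pt_inj => x; have [_ ->] := moves_jones oks pws mv.
rewrite !pt_cfg_set ?ends_range //.
by case: (x \in starts s); rewrite ?andbF ?orbF.
Qed.

Lemma starts_ends_inj s t : all block_ok s -> all block_ok t ->
  starts s = starts t -> ends s = ends t -> s = t.
Proof.
elim: s t => [|[b j] s IH] [|[b' j'] t] //= /andP[ob os] /andP[ob' ot] [E1 E2] [E3 E4].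
by rewrite (IH t) // E3; congr ((_, _) :: _); move: ob ob' E1 E3; clear; lia.
Qed.

Lemma starts_sorted s : pairwise jones_lt s -> sorted ltn (starts s).
Proof.
move=> pw; rewrite sorted_pairwise; last exact: ltn_trans.
by rewrite pairwise_map; apply: sub_pairwise pw => x y /andP[].
Qed.
Lemma ends_sorted s : pairwise jones_lt s -> sorted ltn (ends s).
Proof.
move=> pw; rewrite sorted_pairwise; last exact: ltn_trans.
by rewrite pairwise_map; apply: sub_pairwise pw => x y /andP[].
Qed.

(** The moves require the sites [starts t] to be occupied at the beginning; by the size condition
    they are then all of [starts s], and the arrival sites agree as well. A Jones sequence is
    determined by these two lists. *)
Lemma moves_jones_eq s t : all block_ok s -> pairwise jones_lt s ->
  all block_ok t -> pairwise jones_lt t -> (size s <= size t)%N ->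
  moves (jw t) (cfg_set (starts s)) = Some (cfg_set (ends s)) -> s = t.
Proof.
move=> oks pws okt pwt st mv; have [sub pE] := moves_jones okt pwt mv.
have E1 : starts t = starts s.
  apply: (irr_sorted_eq ltn_trans ltnn); rewrite ?starts_sorted //.
  have u : uniq (starts t) by apply: (sorted_uniq ltn_trans ltnn); apply: starts_sorted.
  have sb : {subset starts t <= starts s}.
    by move=> a /sub; rewrite pt_cfg_set // starts_range.
  have [//|_ H] := uniq_min_size u sb; first by rewrite !size_map.
  by move=> a; rewrite H.
apply: starts_ends_inj => //.
apply: (irr_sorted_eq ltn_trans ltnn); rewrite ?ends_sorted // => x.
have := pE x; rewrite !pt_cfg_set ?ends_range ?starts_range // E1.
by case: (x \in starts s); rewrite ?andbF ?orbF.
Qed.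

End SpinMoves.

Section TLBasis.
Variables (K : comNzRingType) (q qi : K) (qiP : q * qi = 1) (m : nat).
Local Notation pr := (qproj (tl_proper q m)).
Local Notation I := 'I_(catalan m).

Definition jones_nth (i : I) : seq (nat * nat) := nth [::] (jones_seqs m) i.

Lemma jones_nthP i : jones_seq m (jones_nth i).
Proof. by rewrite -mem_jones_seqs mem_nth // size_jones_seqs. Qed.

Lemma jones_nth_inj : injective jones_nth.
Proof.
move=> i j /eqP; rewrite nth_uniq ?size_jones_seqs ?jones_seqs_uniq // => /eqP.
exact: val_inj.
Qed.

Lemma jones_nth_surj s : jones_seq m s -> exists i, s = jones_nth i.
Proof.
rewrite -mem_jones_seqs => sm; have := sm; rewrite -index_mem size_jones_seqs => lt.
by exists (Ordinal lt); rewrite /jones_nth nth_index.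
Qed.

Definition tl_basis (i : I) : TL q m := pr (jones_elt q m (jones_nth i)).

Lemma jones_basisE x : @jones_basis K q m x <-> exists i, x = tl_basis i.
Proof.
split=> [[s /= js <-]|[i ->]].
  by have [i ->] := jones_nth_surj js; exists i.
by exists (jones_nth i) => //=; apply: jones_nthP.
Qed.

Lemma tl_basis_spans : spans (fun x => exists i, x = tl_basis i).
Proof.
move=> P lP Pe; apply: (jones_spans qiP) => // _ [s js ->].
by have [i ->] := jones_nth_surj js; apply: Pe; exists i.
Qed.

Lemma tl_basis_free : is_free tl_basis.
Proof.
have [rho rhoE] := spin_rep q m.
have rhoL u : letter m u -> rho (pr (hgenn q m u)) = spin_letter q m u.
  by move=> /insub_letter[r ur uE]; rewrite /spin_letter ur uE hgennE; apply: rhoE.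
pose word i := flatten [seq block_word x | x <- jones_nth i].
pose psi i x : K := rho x (cfg_set m (ends (jones_nth i))) (cfg_set m (starts (jones_nth i))).
(* Lexicographic order by word length, then by decreasing number of blocks; the factor [m + 1]
   exceeds the second term. At equal lengths [moves_jones_eq] excludes the entries with no more
   blocks in [i] than in [j]. *)
pose mu i := (size (word i) * m.+1 + (m - size (jones_nth i)))%N.
have ok i : all (fun x : nat * nat => (x.2 < x.1 < m)%N) (jones_nth i) &&
    pairwise jones_lt (jones_nth i) by rewrite -jones_pairwise jones_nthP.
have lw i : all (letter m) (word i) by have /andP[o _] := ok i; apply: letter_jw.
have psiE i j : psi i (tl_basis j) = (\prod_(u <- word j) spin_letter q m u : matalg K^o (spin_gt0 m))
    (cfg_set m (ends (jones_nth i))) (cfg_set m (starts (jones_nth i))).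
  rewrite /psi /tl_basis jones_eltE ?jones_nthP // jones_word_rev -/(word j).
  rewrite rmorph_prod; congr ((_ : 'M_ _) _ _); apply: eq_big_seq => u /(allP (lw j)).
  exact: rhoL.
have diag i : moves (word i) (cfg_set m (starts (jones_nth i))) = Some (cfg_set m (ends (jones_nth i))).
  by have /andP[o p] := ok i; apply: moves_jones_diag.
have hd i := moves_height (lw i) (diag i).
apply: (@triangular_free _ _ _ tl_basis psi mu).
- by move=> i c x y; rewrite /psi rmorphD /= linearZ /= mxE matalgZ.
- by move=> i; rewrite psiE spin_word_top // ?diag ?eqxx // hd.
- move=> i j; rewrite psiE => ne ji.
  case: (ltnP (size (word i)) (size (word j))) => [lt|le].
    rewrite /mu; apply: leq_ltn_trans (_ : _ <= size (word i) * m.+1 + m)%N _.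
      by rewrite leq_add2l leq_subr.
    have := leq_mul lt (leqnn m.+1); rewrite mulSn; clear; lia.
  rewrite spin_word_top // in ne; last by rewrite hd leq_add2l.
  have [mv|nm] := eqVneq (moves (word j) (cfg_set m (starts (jones_nth i))))
    (Some (cfg_set m (ends (jones_nth i)))); last by rewrite (negPf nm) eqxx in ne.
  have E := moves_height (lw j) mv; rewrite hd in E.
  have {}E : size (word i) = size (word j) by exact: addnI E.
  rewrite /mu E ltn_add2l.
  have /andP[oi pi] := ok i; have /andP[oj pj] := ok j.
  case: (leqP (size (jones_nth i)) (size (jones_nth j))) => [sij|sji].
    by have /jones_nth_inj E' := moves_jones_eq oi pi oj pj sij mv; rewrite E' eqxx in ji.
  have := jones_nthP i; rewrite /jones_seq => /and4P[si _ _ _].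
  by move: sji si; clear; lia.
Qed.

End TLBasis.

(** * Relations of the Yokonuma-Hecke algebra *)

Section Corner.
Variables (K : comNzRingType) (A : algType K) (e f : A).
Hypotheses (ee : e * e = e) (ef1 : 1 = e + f).

(* [corner x] acts as [x] on the image of [e] and as the sign character on the
   complementary image of [f], so that it satisfies the relations that [x e] does. *)
Definition corner (x : A) : A := x * e - f.

Let ef : e * f = 0.
Proof. by apply: (addrI e); rewrite -{1}ee -mulrDr -ef1 mulr1 addr0. Qed.
Let fe : f * e = 0.
Proof. by apply: (addrI e); rewrite -{1}ee -mulrDl -ef1 mul1r addr0. Qed.
Let ff : f * f = f.
Proof. by rewrite -[RHS]mul1r ef1 mulrDl ef add0r. Qed.
Let fC x : e * x = x * e -> f * x = x * f.
Proof.
by move=> ex; apply: (addrI (e * x)); rewrite -mulrDl ex -mulrDr -ef1 mul1r mulr1.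
Qed.
Let eMe y : e * y = y * e -> e * (y * e) = y * e.
Proof. by move=> ey; rewrite mulrA ey -mulrA ee. Qed.
Let fMe y : e * y = y * e -> f * (y * e) = 0.
Proof. by move=> ey; rewrite mulrA fC // -mulrA fe mulr0. Qed.

Lemma corner_e x : corner x * e = x * e.
Proof. by rewrite /corner mulrBl fe subr0 -mulrA ee. Qed.

Lemma corner_eC x : e * x = x * e -> e * corner x = corner x * e.
Proof. by move=> ex; rewrite corner_e /corner mulrBr ef subr0 eMe. Qed.

Lemma cornerM x y : e * y = y * e -> corner x * corner y = x * y * e + f.
Proof.
move=> ey; rewrite /corner mulrBr !mulrBl ff fMe // subr0.
by rewrite -(mulrA x e) eMe // -(mulrA x e) ef mulr0 sub0r opprK mulrA.
Qed.

Lemma cornerM3 x y z : e * y = y * e -> e * z = z * e ->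
  corner x * corner y * corner z = x * y * z * e - f.
Proof.
move=> ey ez; rewrite cornerM // /corner mulrBr !mulrDl ff fMe // addr0.
by rewrite -(mulrA _ e (z * e)) eMe // -(mulrA _ e f) ef mulr0 add0r mulrA.
Qed.

Lemma corner_quad q x : e * x = x * e -> x * x * e = q *: e + (q - 1) *: (x * e) ->
  hecke_quad q (corner x).
Proof.
move=> ex xx; rewrite /hecke_quad cornerM // xx [in q%:A]ef1 /corner.
rewrite scalerDr scalerBr addrACA; congr (_ + _).
by rewrite -scalerBl opprB addrC subrK scale1r.
Qed.

(** With both generators equal to -1 the Steinberg element is 1 - 1 - 1 + 1 + 1 - 1 = 0, so its part
    on the image of [f] disappears. *)
Lemma corner_steinberg x y : e * x = x * e -> e * y = y * e ->
  steinberg (corner x) (corner y) = steinberg x y * e.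
Proof.
move=> ex ey; rewrite /steinberg cornerM3 // !cornerM // /corner !mulrDl mul1r.
rewrite [X in X + (x * e - f)]ef1.
rewrite [LHS](AC (2*2*2*2*2*2) ((1*3*5*7*9*11)*((2*4)*(8*6)*(10*12))))%AC /=.
by rewrite !subrr !addr0.
Qed.

End Corner.

Section YokonumaRels.
Variables (K : comNzRingType) (q : K) (d n : nat) (dinv : K).

(** The relations are stated for arbitrary elements of an algebra, because they are used for the
    generators of Y, for their images in FTL and for the matrices acting on colorings. *)
Record yokonuma_rels (A : algType K) (g : 'I_n.-1 -> A) (t : 'I_n -> A) : Prop :=
  YokonumaRels {
  yr_far : forall i j : 'I_n.-1, (i.+1 < j)%N || (j.+1 < i)%N -> g i * g j = g j * g i;
  yr_braid : forall i j : 'I_n.-1, j = i.+1 :> nat -> g i * g j * g i = g j * g i * g j;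
  yr_comm : forall i j, t i * t j = t j * t i;
  yr_tg : forall i j, t j * g i = g i * t (simple_refl i j);
  yr_exp : forall j, t j ^+ d = 1;
  yr_quad : forall i, g i * g i = q%:A + (q - 1) *: (idem_e d dinv t i * g i) }.

Lemma yokonuma_rels_morph (A B : algType K) (f : {lrmorphism A -> B}) g t :
  yokonuma_rels g t -> yokonuma_rels (fun i => f (g i)) (fun j => f (t j)).
Proof.
case=> H1 H2 H3 H4 H5 H6; split=> [i j ij|i j ij|i j|i j|j|i].
- exact: morph_mul2 (H1 i j ij).
- exact: morph_mul3 (H2 i j ij).
- exact: morph_mul2 (H3 i j).
- exact: morph_mul2 (H4 i j).
- by rewrite -rmorphXn H5 rmorph1.
- by rewrite -rmorphM H6 rmorphD /= !linearZ /= rmorph1 rmorphM /= idem_e_morph.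
Qed.

End YokonumaRels.

Section YokonumaRelations.
Variables (K : comNzRingType) (q : K) (d n : nat) (dinv : K).
Hypothesis dinvP : dinv * d%:R = 1.
Local Notation Y := (YH q n dinvP).
Local Notation g := (@yg K q d n dinv dinvP).
Local Notation t := (@yt K q d n dinv dinvP).
Local Notation ey := (@ye K q d n dinv dinvP).
Local Notation pr := (qproj (yh_proper q n dinvP)).
Local Notation G i := (gen K (inl i : ygen n)).
Local Notation TT j := (gen K (inr j : ygen n)).

Lemma yg_far (i j : 'I_n.-1) : (i.+1 < j)%N || (j.+1 < i)%N -> g i * g j = g j * g i.
Proof.
move=> ij; apply/eqP; rewrite -subr_eq0; apply/eqP.
apply: etrans (qproj_rel0 (yh_proper q n dinvP) (YHcomm q d dinv ij)).
exact/esym/(morph_rel2 pr (G i) (G j)).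
Qed.

Lemma yg_braid (i j : 'I_n.-1) : j = i.+1 :> nat -> g i * g j * g i = g j * g i * g j.
Proof.
move=> ij; apply/eqP; rewrite -subr_eq0; apply/eqP.
apply: etrans (qproj_rel0 (yh_proper q n dinvP) (YHbraid q d dinv ij)).
exact/esym/(morph_rel3 pr (G i) (G j)).
Qed.

Lemma yt_comm i j : t i * t j = t j * t i.
Proof.
apply/eqP; rewrite -subr_eq0; apply/eqP.
apply: etrans (qproj_rel0 (yh_proper q n dinvP) (YHtt q d dinv i j)).
exact/esym/(morph_rel2 pr (TT i) (TT j)).
Qed.

Lemma yt_yg i j : t j * g i = g i * t (simple_refl i j).
Proof.
apply/eqP; rewrite -subr_eq0; apply/eqP.
apply: etrans (qproj_rel0 (yh_proper q n dinvP) (YHtg q d dinv i j)).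
exact/esym/(morph_rel2 pr (TT j) (G i)).
Qed.

Lemma morph_exp (A B : algType K) (f : {lrmorphism A -> B}) (x : A) :
  f (x ^+ d - 1) = f x ^+ d - 1.
Proof. by rewrite rmorphB rmorphXn rmorph1. Qed.

Lemma yt_exp j : t j ^+ d = 1.
Proof.
apply/eqP; rewrite -subr_eq0; apply/eqP.
have H := qproj_rel0 (yh_proper q n dinvP) (YHtd q d dinv j).
exact: etrans (esym (morph_exp pr (TT j))) H.
Qed.

Lemma morph_yquad (A B : algType K) (f : {lrmorphism A -> B}) (x : A) (u : 'I_n -> A) i :
  f (x ^+ 2 - (q%:A + (q - 1) *: (idem_e d dinv u i * x))) =
  f x * f x - (q%:A + (q - 1) *: (idem_e d dinv (fun j => f (u j)) i * f x)).
Proof. by rewrite morph_quad rmorphM /= idem_e_morph. Qed.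

Lemma yg_quad i : g i * g i = q%:A + (q - 1) *: (ey i * g i).
Proof.
apply/eqP; rewrite -subr_eq0; apply/eqP.
have H := qproj_rel0 (yh_proper q n dinvP) (YHquad q d dinv i).
exact: etrans (esym (morph_yquad pr (G i) (fun j => TT j) i)) H.
Qed.

Lemma yh_rels : yokonuma_rels q d dinv g t.
Proof.
exact: YokonumaRels yg_far yg_braid yt_comm yt_yg yt_exp yg_quad.
Qed.

Lemma yh_lift (B : algType K) (fg : 'I_n.-1 -> B) (ft : 'I_n -> B) :
  yokonuma_rels q d dinv fg ft ->
  exists h : {lrmorphism Y -> B}, (forall i, h (g i) = fg i) /\ (forall j, h (t j) = ft j).
Proof.
case=> H1 H2 H3 H4 H5 H6.
pose f (x : ygen n) : B := match x with inl i => fg i | inr j => ft j end.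
pose ev : {lrmorphism freealg K (ygen n) -> B} := freealg_eval f.
have evg i : ev (G i) = fg i by exact: (freealg_eval_gen f (inl i : ygen n)).
have evt j : ev (TT j) = ft j by exact: (freealg_eval_gen f (inr j : ygen n)).
have [|h hE] := @quotalg_lift K _ (@yh_rel K q d n dinv) (yh_proper q n dinvP) B ev; last first.
  by exists h; split=> i; [apply: etrans (hE _) (evg i) | apply: etrans (hE _) (evt i)].
move=> _ [i j ij|i j ij|i j|i j|j|i].
- by apply: etrans (morph_rel2 ev _ _ _ _) _; rewrite !evg H1 ?subrr.
- by apply: etrans (morph_rel3 ev _ _ _ _ _ _) _; rewrite !evg H2 ?subrr.
- by apply: etrans (morph_rel2 ev _ _ _ _) _; rewrite !evt H3 subrr.
- by apply: etrans (morph_rel2 ev _ _ _ _) _; rewrite !evt !evg H4 subrr.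
- by apply: etrans (morph_exp ev _) _; rewrite evt H5 subrr.
- apply: etrans (morph_yquad ev _ _ _) _; rewrite evg H6.
  by rewrite (_ : (fun j => ev (TT j)) = ft) ?subrr //; apply/funext.
Qed.

Lemma yh_ind_left (P : Y -> Prop) : lin_closed P -> P 1 ->
  (forall i x, P x -> P (g i * x)) -> (forall j x, P x -> P (t j * x)) -> forall x, P x.
Proof. by move=> lP P1 Pg Pt; apply: quotalg_ind_left => // -[i|j]; [apply: Pg | apply: Pt]. Qed.

End YokonumaRelations.

(** * Eigenprojections and color idempotents *)

Section RootProjections.
Variables (K : comNzRingType) (A : algType K) (d : nat) (dinv : K).
Variable zeta : 'I_d -> K.

(* [zeta] enumerates the d-th roots of unity *)
Record root_family : Prop := RootFamily {
  rf_exp : forall c, zeta c ^+ d = 1;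
  rf_orth : forall a b,
    dinv * (\sum_(s < d) zeta a ^+ s * zeta b ^+ (d - s)) = (a == b)%:R;
  rf_sum : forall s : 'I_d, dinv * (\sum_c zeta c ^+ s) = (s == 0%N :> nat)%:R }.
Hypothesis Z : root_family.
Implicit Types (u x y : A) (a b c : 'I_d).

(** Projection onto the eigenspace of [u] for [zeta c]; the idempotent [E_chi] is a product of such
    factors. *)
Definition root_proj u c : A := dinv *: \sum_(s < d) zeta c ^+ s *: u ^+ (d - s).

Lemma root_proj_eigen u c : u ^+ d = 1 -> u * root_proj u c = zeta c *: root_proj u c.
Proof.
move=> ud; rewrite /root_proj -scalerAr scalerA mulrC -scalerA; congr (_ *: _).
(* Both sides are sums of [G] over [d] consecutive indices, shifted by one; the two end terms agree
   because the [d]-th powers of [u] and [zeta c] are 1. *)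
pose G s : A := zeta c ^+ s *: u ^+ (d.+1 - s).
have e1 : u * (\sum_(s < d) zeta c ^+ s *: u ^+ (d - s)) = \sum_(s < d) G s.
  rewrite mulr_sumr; apply: eq_bigr => s _.
  by rewrite -scalerAr -exprS /G subSn // ltnW.
have e2 : zeta c *: (\sum_(s < d) zeta c ^+ s *: u ^+ (d - s)) = \sum_(s < d) G s.+1.
  by rewrite scaler_sumr; apply: eq_bigr => s _; rewrite scalerA -exprS.
have G0 : G 0%N = G d by rewrite /G subn0 subSn // subnn exprSr ud (rf_exp Z) expr0 mul1r.
rewrite e1 e2; apply: (addrI (G 0%N)).
rewrite -(big_ord_recl d (fun s => G s)) {1}G0 addrC.
by rewrite big_ord_recr.
Qed.

Lemma root_projl u x a b : u * x = zeta a *: x -> root_proj u b * x = (b == a)%:R *: x.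
Proof.
move=> ux; have uxn k : u ^+ k * x = zeta a ^+ k *: x.
  elim: k => [|k IH]; first by rewrite !expr0 mul1r scale1r.
  by rewrite exprSr -mulrA ux -scalerAr IH scalerA -exprS.
rewrite -(rf_orth Z) /root_proj -scalerAl -scalerA; congr (_ *: _).
rewrite mulr_suml scaler_suml; apply: eq_bigr => s _.
by rewrite -scalerAl uxn scalerA.
Qed.

Lemma root_projr u x a b : x * u = zeta a *: x -> x * root_proj u b = (b == a)%:R *: x.
Proof.
move=> ux; have uxn k : x * u ^+ k = zeta a ^+ k *: x.
  elim: k => [|k IH]; first by rewrite !expr0 mulr1 scale1r.
  by rewrite exprS mulrA ux -scalerAl IH scalerA -exprS.
rewrite -(rf_orth Z) /root_proj -scalerAr -scalerA; congr (_ *: _).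
rewrite mulr_sumr scaler_suml; apply: eq_bigr => s _.
by rewrite -scalerAr uxn scalerA.
Qed.

Lemma root_proj_sum u : (0 < d)%N -> u ^+ d = 1 -> \sum_c root_proj u c = 1.
Proof.
move=> d_gt0 ud; rewrite -scaler_sumr exchange_big /= scaler_sumr.
have E (s : 'I_d) : dinv *: (\sum_c zeta c ^+ s *: u ^+ (d - s)) = (s == 0%N :> nat)%:R.
  rewrite -scaler_suml scalerA (rf_sum Z); case: eqP => [->|_]; last by rewrite scale0r.
  by rewrite subn0 ud scale1r.
rewrite (eq_bigr _ (fun s _ => E s)) (bigD1 (Ordinal d_gt0)) //= big1 ?addr0 // => s.
by rewrite -val_eqE /= => /negPf->.
Qed.

Lemma root_proj_comm u x y c : u * x = x * y -> root_proj u c * x = x * root_proj y c.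
Proof.
move=> ux; rewrite /root_proj -scalerAl -scalerAr; congr (_ *: _).
rewrite mulr_suml mulr_sumr; apply: eq_bigr => s _.
rewrite -scalerAl -scalerAr; congr (_ *: _).
elim: (d - s)%N => [|k IH]; first by rewrite !expr0 mulr1 mul1r.
by rewrite exprSr -mulrA ux mulrA IH -mulrA -exprSr.
Qed.

End RootProjections.

Section YokonumaData.
Variables (K : comNzRingType) (A : algType K) (q qi dinv : K) (d n : nat).
Variables (g : 'I_n.-1 -> A) (t : 'I_n -> A) (zeta : 'I_d -> K).
Hypothesis qiP : q * qi = 1.
Hypothesis d_gt0 : (0 < d)%N.
Hypothesis Y : yokonuma_rels q d dinv g t.
Hypothesis Z : root_family dinv zeta.
Local Notation e := (idem_e d dinv t).
Implicit Types (x y : A) (f : 'I_n -> 'I_d) (i j : 'I_n.-1) (p : 'I_n) (w : 'S_n).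
Local Notation proj := (root_proj dinv zeta).

Definition color_idem f : A := \prod_p proj (t p) (f p).
Local Notation E := color_idem.

Lemma t_color_idem p f : t p * E f = zeta (f p) *: E f.
Proof.
rewrite /E /index_enum -enumT; have : p \in enum 'I_n by rewrite mem_enum.
elim: (enum _) => // p' r IH; rewrite big_cons inE => /predU1P[->|/IH{}IH].
  by rewrite mulrA (root_proj_eigen Z _ (yr_exp Y _)) -scalerAl.
have C : proj (t p') (f p') * t p = t p * proj (t p') (f p').
  exact: (root_proj_comm _ _ _ (yr_comm Y _ _)).
by rewrite mulrA -C -mulrA IH -scalerAr.
Qed.

Lemma color_idem_t p f : E f * t p = zeta (f p) *: E f.
Proof.
rewrite -t_color_idem; apply/esym/comm_prod => p' _; apply/esym.
exact: (root_proj_comm _ _ _ (yr_comm Y _ _)).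
Qed.

Lemma color_idem_absorbl f x : (forall p, t p * x = zeta (f p) *: x) -> E f * x = x.
Proof.
move=> tx; rewrite /E; elim: (index_enum _) => [|p r IH]; first by rewrite big_nil mul1r.
by rewrite big_cons -mulrA IH (root_projl Z (f p) (tx p)) eqxx scale1r.
Qed.

Lemma color_idem_absorbr f x : (forall p, x * t p = zeta (f p) *: x) -> x * E f = x.
Proof.
move=> tx; rewrite /E; elim: (index_enum _) => [|p r IH]; first by rewrite big_nil mulr1.
by rewrite big_cons mulrA (root_projr Z (f p) (tx p)) eqxx scale1r.
Qed.

Lemma color_idem_idem f : E f * E f = E f.
Proof. by apply: color_idem_absorbl => p; apply: t_color_idem. Qed.

Lemma color_idem_orth f f' p : f p != f' p -> E f * E f' = 0.
Proof.
move=> ne; have <- : E f * proj (t p) (f p) = E f.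
  by rewrite (root_projr Z (f p) (color_idem_t p f)) eqxx scale1r.
rewrite -mulrA (root_projl Z (f p) (t_color_idem p f')) (negPf ne).
by rewrite scale0r mulr0.
Qed.

Lemma color_idem_sum : \sum_(f : {ffun 'I_n -> 'I_d}) E f = 1.
Proof.
rewrite -(bigA_distr_bigA (fun p c => proj (t p) c)) big1 // => p _.
exact: (root_proj_sum Z d_gt0 (yr_exp Y _)).
Qed.

(** The color idempotents sum to 1, so identities can be checked one coloring at a time, where the
    [t_j] and [e_i] act as scalars. *)
Lemma color_idem_ext x y : (forall f, x * E f = y * E f) -> x = y.
Proof.
move=> xy; rewrite -[x]mulr1 -[y]mulr1 -color_idem_sum !mulr_sumr.
by apply: eq_bigr => f _.
Qed.

Lemma color_idem_g i f : E f * g i = g i * E (f \o simple_refl i).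
Proof.
have sK p : simple_refl i (simple_refl i p) = p by rewrite /simple_refl tpermK.
have r : E f * g i * E (f \o simple_refl i) = E f * g i.
  apply: color_idem_absorbr => p /=; rewrite -{1}(sK p) -mulrA -(yr_tg Y) mulrA.
  by rewrite color_idem_t scalerAl.
rewrite -r -mulrA; apply: color_idem_absorbl => p.
by rewrite mulrA (yr_tg Y) -mulrA t_color_idem /= sK scalerAr.
Qed.

Lemma g_color_idem i f : g i * E f = E (f \o simple_refl i) * g i.
Proof.
rewrite color_idem_g; congr (_ * E _); apply/funext => p /=.
by rewrite /simple_refl tpermK.
Qed.

(** Orthogonality of roots of unity turns [e_i] into the test whether two neighboring points have
    the same color. *)
Lemma idem_e_eigen i f x : (forall p, t p * x = zeta (f p) *: x) ->
  e i * x = (f (pos_lo i) == f (pos_hi i))%:R *: x.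
Proof.
move=> tx; have tn p k : t p ^+ k * x = zeta (f p) ^+ k *: x.
  elim: k => [|k IH]; first by rewrite !expr0 mul1r scale1r.
  by rewrite exprSr -mulrA tx -scalerAr IH scalerA -exprS.
rewrite -(rf_orth Z) /idem_e -scalerAl -scalerA; congr (_ *: _).
rewrite mulr_suml scaler_suml; apply: eq_bigr => s _.
by rewrite -mulrA tn -scalerAr tn scalerA mulrC.
Qed.

Lemma e_color_idem i f : e i * E f = (f (pos_lo i) == f (pos_hi i))%:R *: E f.
Proof. by apply: idem_e_eigen => p; apply: t_color_idem. Qed.

Lemma e_color_idemC i f : e i * E f = E f * e i.
Proof.
have tC p : t p * E f = E f * t p by rewrite t_color_idem color_idem_t.
have tn p k : t p ^+ k * E f = E f * t p ^+ k.
  by apply/esym/commrX/esym/tC.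
rewrite /idem_e -scalerAl -scalerAr mulr_suml mulr_sumr; congr (_ *: _).
by apply: eq_bigr => s _; rewrite -mulrA tn mulrA tn -mulrA.
Qed.

Lemma g_e i : g i * e i = e i * g i.
Proof.
apply: color_idem_ext => f; rewrite -!mulrA e_color_idem g_color_idem mulrA e_color_idem /=.
by rewrite /simple_refl tpermL tpermR eq_sym -scalerAl -scalerAr -/(simple_refl i) -g_color_idem.
Qed.

(** Solved from the quadratic relation, in which [g_i] and [e_i] commute. *)
Definition g_inv i : A := qi *: (g i - (q - 1) *: e i).

Lemma g_gV i : g i * g_inv i = 1.
Proof.
by rewrite /g_inv -scalerAr mulrBr (yr_quad Y) -scalerAr g_e addrK scalerA mulrC qiP scale1r.
Qed.

Lemma gV_g i : g_inv i * g i = 1.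
Proof.
by rewrite /g_inv -scalerAl mulrBl (yr_quad Y) -(scalerAl (q - 1)) addrK scalerA mulrC qiP scale1r.
Qed.

Local Notation gw := (wprod g).

Lemma color_idem_prod (s : seq 'I_n.-1) f :
  E f * \prod_(i <- s) g i = \prod_(i <- s) g i * E (f \o word_perm s).
Proof.
elim: s f => [|i s IH] f; rewrite ?big_nil ?big_cons /=.
  by rewrite mulr1 mul1r; congr E; apply/funext => p /=; rewrite perm1.
rewrite mulrA color_idem_g -mulrA IH mulrA; congr (_ * E _).
by apply/funext => p /=; rewrite permM.
Qed.

Lemma reduced_word_perm w : word_perm (reduced_word w) = w.
Proof. by apply/eqP; apply: (xchooseP (reduced_word_exists w)). Qed.

Lemma color_idem_gw w f : E f * gw w = gw w * E (f \o w).
Proof. by rewrite /wprod color_idem_prod reduced_word_perm. Qed.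

Lemma gw_color_idem w f : gw w * E f = E (f \o w^-1%g) * gw w.
Proof.
rewrite color_idem_gw; congr (_ * E _).
by apply/funext => p /=; rewrite permK.
Qed.

Definition gw_inv w : A := \prod_(i <- rev (reduced_word w)) g_inv i.

Lemma gw_gwV w : gw w * gw_inv w = 1.
Proof.
rewrite /wprod /gw_inv; elim: (reduced_word w) => [|i s IH]; first by rewrite !big_nil mulr1.
by rewrite rev_cons -cats1 big_cat big_cons big_seq1 mulrA -(mulrA (g i)) IH mulr1 g_gV.
Qed.

Lemma gwV_gw w : gw_inv w * gw w = 1.
Proof.
rewrite /wprod /gw_inv; elim: (reduced_word w) => [|i s IH]; first by rewrite !big_nil mulr1.
by rewrite rev_cons -cats1 big_cat big_seq1 big_cons mulrA -(mulrA _ (g_inv i)) gV_g mulr1 IH.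
Qed.

(** [Psi] is prescribed on the products of a color idempotent and some [g_w], so its uniqueness
    rests on these products spanning Y. *)
Definition color_span x : Prop :=
  forall P, lin_closed P -> (forall f w, P (E f * gw w)) -> P x.

Lemma color_span_lin : lin_closed color_span.
Proof.
split=> [P [] //|c x y xP yP P lP Pe].
by case: (lP) => _; apply; [apply: xP | apply: yP].
Qed.

Lemma color_span_mul u : (forall f w, color_span (u * (E f * gw w))) ->
  forall x, color_span x -> color_span (u * x).
Proof.
move=> uP x xs; apply: (xs (fun y => color_span (u * y))) => //; split=> [|c y z yP zP]; first by rewrite mulr0; case: color_span_lin.
by rewrite mulrDr -scalerAr; case: color_span_lin => _; apply.
Qed.

Lemma color_span_basis f w : color_span (E f * gw w).
Proof. by move=> P _; apply. Qed.

Lemma color_span_t p x : color_span x -> color_span (t p * x).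
Proof.
apply: color_span_mul => f w; rewrite mulrA t_color_idem -scalerAl.
by apply: (lin_closedZ (P := color_span)); [exact: color_span_lin | exact: color_span_basis].
Qed.

Lemma color_span_g i x : color_span x -> color_span (g i * x).
Proof.
have sL := color_span_lin.
apply: color_span_mul => f w; rewrite mulrA g_color_idem -mulrA.
move: (f \o _) => {}f.
have [lt|ge] := boolP (asc i w); first by rewrite -(wprod_asc (yr_far Y) (yr_braid Y)) //; apply: color_span_basis.
(* At a descent [g_w = g_i g_w'], so that the square of [g_i] appears; in the quadratic relation
   [e_i] then becomes a scalar next to the color idempotent. *)
pose w' := pcomp (simple_refl i) w.
have wE : w = pcomp (simple_refl i) w' by rewrite /w' pcompsK.
have lt' : asc i w' by rewrite /w' asc_simple.
have gwE : gw w = g i * gw w' by rewrite {1}wE (wprod_asc (yr_far Y) (yr_braid Y)).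
rewrite gwE (mulrA (g i)) (yr_quad Y) mulrDl mulr_algl -(scalerAl (q - 1)) -mulrA -gwE.
rewrite mulrDr -2!scalerAr mulrA -e_color_idemC e_color_idem -scalerAl.
apply: (lin_closedD sL); rewrite -/color_span ?scalerA; apply: (lin_closedZ (P := color_span) _ sL);
  exact: color_span_basis.
Qed.

Lemma color_span1 : color_span 1.
Proof.
rewrite -color_idem_sum; apply: lin_closed_sum => [|f _]; first exact: color_span_lin.
by rewrite -[E f]mulr1 -(wprod1 (yr_far Y) (yr_braid Y)); apply: color_span_basis.
Qed.

End YokonumaData.

Lemma color_idem_morph (K : comNzRingType) (A B : algType K) (h : {lrmorphism A -> B})
  (d n : nat) (dinv : K) (t : 'I_n -> A) (zeta : 'I_d -> K) (f : 'I_n -> 'I_d) :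
  h (color_idem dinv t zeta f) = color_idem dinv (fun p => h (t p)) zeta f.
Proof.
rewrite /color_idem rmorph_prod /=; apply: eq_bigr => p _.
rewrite /root_proj linearZ /= raddf_sum; congr (_ *: _); apply: eq_bigr => s _.
by rewrite /= linearZ /= rmorphXn.
Qed.

(** * Matrices over the blocks *)

Section CosetRep.
Variables (K : comNzRingType) (q c : K) (cq : c = 0 \/ c = q - 1) (B : algType K).
Variables (d n : nat) (mu : Comp d n) (pi : 'I_(nb_cosets mu) -> 'S_n).
Hypothesis pi_enum : coset_enum pi.
Variable hx : 'I_n -> B.
Implicit Types (k l : 'I_(nb_cosets mu)) (i j r : 'I_n.-1).
Local Notation J := (young_gens mu).
Local Notation sr := (@simple_refl n).
Hypothesis hx_quad : forall r, r \in J -> hecke_quad q (hx (pos_lo r)).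
Hypothesis hx_far : forall r r', r \in J -> r' \in J -> (r.+1 < r')%N || (r'.+1 < r)%N ->
  hx (pos_lo r) * hx (pos_lo r') = hx (pos_lo r') * hx (pos_lo r).
Hypothesis hx_braid : forall r r', r \in J -> r' \in J -> r' = r.+1 :> nat ->
  hx (pos_lo r) * hx (pos_lo r') * hx (pos_lo r) =
  hx (pos_lo r') * hx (pos_lo r) * hx (pos_lo r').

Let colr k (p : 'I_n) : nat := col pi k p.
Let sa i k := pact pi_enum (sr i) k.
(** When [s_i] fixes the coset this is the generator for the letter [r] with [s_i pi_k = pi_k s_r];
    [hx] is indexed by points, so that the expression makes sense for every [k] and [i]. *)
Definition coset_x k i : B := hx ((pi k)^-1%g (pos_lo i)).
Local Notation X := coset_x.
Local Notation eqcol k i := (colr k (pos_lo i) = colr k (pos_hi i)).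

(** The factorization of [q] into [q] for increasing and 1 for decreasing colors is dictated by
    [Psi], whose conjugation by U_mu produces these powers. *)
Definition coset_rep i : 'M[B]_(nb_cosets mu) := rep_mx q 1 c colr sa X i.

Let col_s i k p : colr (sa i k) p = colr k (sr i p).
Proof. by rewrite /colr /sa col_pact simple_reflV. Qed.
Let sK i : involutive (sa i).
Proof. by move=> k; rewrite /sa -pact_comp /pcomp /simple_refl tperm2 pact1. Qed.
Let s_far i j k : (i.+1 < j)%N || (j.+1 < i)%N -> sa i (sa j k) = sa j (sa i k).
Proof. by move=> ij; rewrite /sa -!pact_comp simple_refl_far. Qed.
Let s_braid i j k : j = i.+1 :> nat -> sa i (sa j (sa i k)) = sa j (sa i (sa j k)).
Proof. by move=> ij; rewrite /sa -!pact_comp -!pcompA (simple_refl_braid ij). Qed.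

Lemma coset_xE k i : eqcol k i -> exists2 r, r \in J &
  [/\ pos_lo r = (pi k)^-1%g (pos_lo i), pos_hi r = (pi k)^-1%g (pos_hi i)
    & X k i = hx (pos_lo r)].
Proof.
by move=> /val_inj/(pi_simple_eq pi_enum)[r rJ [rl rh _]]; exists r => //; rewrite /X rl.
Qed.

Let x_quad k i : eqcol k i -> X k i * X k i = q%:A + (q - 1) *: X k i.
Proof. by move=> /coset_xE[r rJ [_ _ ->]]; apply: hx_quad. Qed.

Let x_far k i j : eqcol k i -> eqcol k j -> (i.+1 < j)%N || (j.+1 < i)%N ->
  X k i * X k j = X k j * X k i.
Proof.
move=> /coset_xE[r rJ [rl rh ->]] /coset_xE[r' rJ' [rl' rh' ->]] ij; apply: hx_far => //.
have N1 : pos_lo r != pos_lo r'.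
  by rewrite rl rl' (inj_eq perm_inj) -val_eqE /=; move: ij; clear; lia.
have N2 : pos_hi r != pos_lo r'.
  by rewrite rh rl' (inj_eq perm_inj) -val_eqE /=; move: ij; clear; lia.
have N3 : pos_lo r != pos_hi r'.
  by rewrite rl rh' (inj_eq perm_inj) -val_eqE /=; move: ij; clear; lia.
by move: N1 N2 N3; rewrite -!val_eqE /=; clear; lia.
Qed.

Let x_braid k i j : eqcol k i -> eqcol k j -> j = i.+1 :> nat ->
  X k i * X k j * X k i = X k j * X k i * X k j.
Proof.
move=> /coset_xE[r rJ [rl rh ->]] /coset_xE[r' rJ' [rl' rh' ->]] ij; apply: hx_braid => //.
have hl : pos_lo j = pos_hi i by apply/val_inj; rewrite /= ij.
by have /(congr1 val) : pos_lo r' = pos_hi r by rewrite rh rl' hl.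
Qed.

Let ne_col k i : colr k (pos_lo i) <> colr k (pos_hi i) ->
  col pi k (pos_lo i) != col pi k (pos_hi i).
Proof. by move=> ne; apply/eqP => E; apply: ne; rewrite /colr E. Qed.

Let x_s_far k i j : eqcol k i -> (i.+1 < j)%N || (j.+1 < i)%N ->
  colr k (pos_lo j) <> colr k (pos_hi j) -> X (sa j k) i = X k i.
Proof.
move=> ki ij /ne_col/(pi_pact_ne pi_enum) E; rewrite /X /sa E pcompV pcompE simple_reflV.
by rewrite /simple_refl tpermD // -val_eqE /=; move: ij; clear; lia.
Qed.

Let x_s_braid k i j : eqcol k i -> j = i.+1 :> nat ->
  colr k (pos_lo j) <> colr k (pos_hi j) -> X (sa i (sa j k)) j = X k i.
Proof.
move=> ki ij kj; have hl : pos_lo j = pos_hi i by apply/val_inj; rewrite /= ij.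
have Ej := pi_pact_ne pi_enum (ne_col kj).
have D : sr j (pos_lo i) = pos_lo i.
  by rewrite /simple_refl tpermD // -val_eqE /= ij; clear; lia.
have ki' : colr (sa j k) (pos_lo i) <> colr (sa j k) (pos_hi i).
  by rewrite !col_s D -hl /simple_refl tpermL ki -hl.
have Ei := pi_pact_ne pi_enum (ne_col ki').
rewrite /X /sa Ei /sa Ej !pcompV !pcompE !simple_reflV.
by rewrite hl {2}/simple_refl tpermR D.
Qed.

Let albe : q * 1 = q. Proof. exact: mulr1. Qed.

Lemma coset_rep_far i j : (i.+1 < j)%N || (j.+1 < i)%N ->
  coset_rep i *m coset_rep j = coset_rep j *m coset_rep i.
Proof. exact: (rep_far q 1 c col_s s_far x_far x_s_far). Qed.

Lemma coset_rep_braid i j : j = i.+1 :> nat ->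
  coset_rep i *m coset_rep j *m coset_rep i = coset_rep j *m coset_rep i *m coset_rep j.
Proof. exact: (rep_braid albe cq col_s sK s_braid x_quad x_braid x_s_braid). Qed.

Lemma coset_rep_quad_eq i k a : col pi k (pos_lo i) = col pi k (pos_hi i) ->
  coset_rep i *m (coset_rep i *m ev k a) = ev k (q *: a) + ev k ((q - 1) *: (X k i * a)).
Proof. by move=> E; apply: (rep_quad_eq q 1 c sa x_quad); rewrite /colr E. Qed.

Lemma coset_rep_quad_ne i k a : col pi k (pos_lo i) <> col pi k (pos_hi i) ->
  coset_rep i *m (coset_rep i *m ev k a) = ev k (q *: a) + coset_rep i *m ev k (c *: a).
Proof. by move=> E; apply: (rep_quad_ne c albe X col_s sK) => /val_inj. Qed.

Lemma coset_rep_eq i k a : col pi k (pos_lo i) = col pi k (pos_hi i) ->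
  coset_rep i *m ev k a = ev k (X k i * a).
Proof. by move=> E; apply: T_eq; rewrite /colr E. Qed.

Lemma coset_rep_lt i k a : (col pi k (pos_lo i) < col pi k (pos_hi i))%N ->
  coset_rep i *m ev k a = ev (pact pi_enum (sr i) k) (q *: a).
Proof. exact: T_lt. Qed.

Lemma coset_rep_gt i k a : (col pi k (pos_hi i) < col pi k (pos_lo i))%N ->
  coset_rep i *m ev k a = ev (pact pi_enum (sr i) k) a + ev k (c *: a).
Proof. by move=> lt; rewrite -{2}(scale1r a); apply: T_gt. Qed.

End CosetRep.

(** * Matrix units attached to the cosets *)

Section MatrixUnits.
Variables (K : comNzRingType) (A B : algType K) (q qi dinv : K) (d n : nat).
Variables (g : 'I_n.-1 -> A) (t : 'I_n -> A) (zeta : 'I_d -> K).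
Hypotheses (qiP : q * qi = 1) (d_gt0 : (0 < d)%N).
Hypotheses (Y : yokonuma_rels q d dinv g t) (Z : root_family dinv zeta).
Variables (mu : Comp d n) (pi : 'I_(nb_cosets mu) -> 'S_n).
Hypothesis pi_enum : coset_enum pi.
Variables (hx : 'I_n -> B) (al : {lrmorphism B -> A}).
Local Notation E := (color_idem dinv t zeta).
Local Notation gw := (wprod g).
Local Notation gwV := (gw_inv q qi dinv d g t).
Local Notation E1 := (E (blk mu)).
Local Notation sr := (@simple_refl n).
Local Notation k0 := (coset0 pi_enum).
Local Notation act := (pact pi_enum).
Local Notation T := (coset_rep q 0 pi_enum hx).
Hypothesis al_E : forall x, al x * E1 = E1 * al x.
Hypothesis al_hx : forall r, r \in young_gens mu -> al (hx (pos_lo r)) * E1 = g r * E1.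
Implicit Types (k l : 'I_(nb_cosets mu)) (i r : 'I_n.-1) (p : 'I_n).
Implicit Types (M N : 'M[B]_(nb_cosets mu)).

(** Left and right halves of matrix units: a matrix with the single entry [x] at [(k, l)] goes to
    the product of [cosetl k], the image of [x] and [cosetr l]. The powers of [q] cancel between the
    halves for equal indices and adapt the action of the [g_i] to the weights of [coset_rep]. *)
Definition cosetl k : A := qi ^+ perm_length (pi k) *: (gw (pi k) * E1).
Definition cosetr k : A := q ^+ perm_length (pi k) *: (E1 * gwV (pi k)).

Let alZ c x : al (c *: x) = c *: al x. Proof. exact: linearZ. Qed.
Let EE : E1 * E1 = E1 := color_idem_idem Y Z (blk mu).

Lemma cosetl_E1 k : cosetl k * E1 = cosetl k.
Proof. by rewrite /cosetl -scalerAl -mulrA EE. Qed.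

Lemma gw_E1 k : gw (pi k) * E1 = E (col pi k) * gw (pi k).
Proof. exact: (gw_color_idem Y Z). Qed.

Lemma gwV_E1 k : E1 * gwV (pi k) = gwV (pi k) * E (col pi k).
Proof.
rewrite -[LHS]mul1r -(gwV_gw qiP Y (pi k)) -mulrA (mulrA (gw _)) gw_E1.
by rewrite -(mulrA (E _)) (gw_gwV qiP d_gt0 Y Z) mulr1.
Qed.

Lemma color_cosetl k : E (col pi k) * cosetl k = cosetl k.
Proof. by rewrite /cosetl gw_E1 -scalerAr mulrA (color_idem_idem Y Z). Qed.

Lemma cosetr_cosetl l k : cosetr l * cosetl k = (l == k)%:R *: E1.
Proof.
have [->|lk] := eqVneq l k.
  rewrite /cosetr /cosetl -scalerAl -scalerAr scalerA -exprMn qiP expr1n !scale1r.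
  by rewrite -mulrA (mulrA (gwV _)) (gwV_gw qiP Y) mul1r EE.
have [p np] : exists p, col pi l p != col pi k p.
  apply/existsP; rewrite -negb_forall; apply: contra lk => /forallP kl.
  by apply/eqP/(col_inj pi_enum) => p; apply/eqP.
rewrite /cosetr /cosetl gw_E1 gwV_E1 -scalerAl -scalerAr -mulrA (mulrA (E _)).
by rewrite (color_idem_orth Y Z np) mul0r mulr0 !scaler0 scale0r.
Qed.

Lemma cosetl_cosetr k : cosetl k * cosetr k = E (col pi k).
Proof.
rewrite /cosetr /cosetl -scalerAl -scalerAr scalerA -exprMn mulrC qiP expr1n scale1r.
rewrite mulrA -(mulrA (gw _)) EE gw_E1 -mulrA.
by rewrite (gw_gwV qiP d_gt0 Y Z) mulr1.
Qed.

Lemma cosetl_al k x : cosetl k * al x * E1 = cosetl k * al x.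
Proof. by rewrite -mulrA al_E mulrA cosetl_E1. Qed.

Lemma t_cosetl p k : t p * cosetl k = zeta (col pi k p) *: cosetl k.
Proof. by rewrite -color_cosetl mulrA (t_color_idem Y Z) -scalerAl. Qed.

Let ev_sum N k l x : N *m ev k 1 = ev l x ->
  \sum_j cosetl j * al (N j k) = cosetl l * al x.
Proof.
move=> Nk; rewrite (bigD1 l) //= big1 ?addr0 => [|j jl].
  by rewrite -[N l k]mulr1 -mulmx_ev Nk mxE eqxx.
by rewrite -[N j k]mulr1 -mulmx_ev Nk mxE (negPf jl) raddf0 mulr0.
Qed.

Let g_cosetl_lt i k : (col pi k (pos_lo i) < col pi k (pos_hi i))%N ->
  g i * cosetl k = q *: cosetl (act (sr i) k).
Proof.
move=> lt; have asck := asc_col_lt lt.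
have pE : pi (act (sr i) k) = pcomp (sr i) (pi k).
  by apply: pi_pact_ne; rewrite neq_ltn lt.
rewrite /cosetl pE (wprod_asc (yr_far Y) (yr_braid Y)) // perm_length_asc // exprS.
by rewrite -scalerAr scalerA (mulrA q) qiP mul1r mulrA.
Qed.

(** Increasing colors lengthen [pi_k]. Decreasing colors are the same case read backwards, the
    square of [g_i] acting as [q] because [e_i] kills distinct colors. For equal colors Deodhar's
    lemma moves [g_i] across [g_(pi_k)], where it becomes a generator of a block. *)
Lemma g_cosetl i k : g i * cosetl k = \sum_l cosetl l * al (T i l k).
Proof.
case: (ltngtP (col pi k (pos_lo i)) (col pi k (pos_hi i))) => [lt|gt|/val_inj eq].
- rewrite (ev_sum (coset_rep_lt q 0 pi_enum hx 1 lt)) g_cosetl_lt //.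
  by rewrite alZ rmorph1 -scalerAr mulr1.
- have E0 := coset_rep_gt q 0 pi_enum hx 1 gt; rewrite scale0r ev0 addr0 in E0.
  rewrite (ev_sum E0) rmorph1 mulr1; set k' := act _ k.
  have sK : act (sr i) k' = k by rewrite /k' -pact_comp /pcomp /simple_refl tperm2 pact1.
  have lt' : (col pi k' (pos_lo i) < col pi k' (pos_hi i))%N.
    by rewrite !col_pact simple_reflV /simple_refl tpermL tpermR.
  have gk' := g_cosetl_lt lt'; rewrite sK in gk'.
  have gk : cosetl k = qi *: (g i * cosetl k') by rewrite gk' scalerA mulrC qiP scale1r.
  have ek : idem_e d dinv t i * cosetl k = 0.
    rewrite -color_cosetl mulrA (e_color_idem Y Z) eq_sym -val_eqE /= (ltn_eqF gt).
    by rewrite scale0r mul0r.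
  rewrite {1}gk -scalerAr mulrA (yr_quad Y) mulrDl mulr_algl -(scalerAl (q - 1)) -mulrA gk'.
  by rewrite -scalerAr ek !scaler0 addr0 scalerA mulrC qiP scale1r.
- rewrite (ev_sum (coset_rep_eq q 0 pi_enum hx 1 eq)) mulr1.
  have [r rJ [rl rh pE]] := pi_simple_eq pi_enum eq.
  have gg : g i * gw (pi k) = gw (pi k) * g r.
    rewrite -(wprod_asc (yr_far Y) (yr_braid Y)); last by rewrite (asc_col_le pi_enum) // eq.
    rewrite pE (wprod_asc_right (yr_far Y) (yr_braid Y)) //.
    by rewrite rl rh !permKV.
  rewrite /cosetl -scalerAr -scalerAl; congr (_ *: _).
  by rewrite mulrA gg -mulrA -al_hx // al_E mulrA /coset_x rl.
Qed.

Definition coset_map N : A := \sum_k \sum_l cosetl k * al (N k l) * cosetr l.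

Lemma coset_mapD M N : coset_map (M + N) = coset_map M + coset_map N.
Proof.
rewrite /coset_map -big_split; apply: eq_bigr => k _; rewrite -big_split.
by apply: eq_bigr => l _; rewrite mxE raddfD mulrDr mulrDl.
Qed.

Lemma coset_map0 : coset_map 0 = 0.
Proof. by apply: (addrI (coset_map 0)); rewrite -coset_mapD !addr0. Qed.

Lemma coset_mapZ (c : K) N : coset_map (map_mx (fun x => c *: x) N) = c *: coset_map N.
Proof.
rewrite /coset_map scaler_sumr; apply: eq_bigr => k _; rewrite scaler_sumr.
by apply: eq_bigr => l _; rewrite mxE alZ -(scalerAr c) -(scalerAl c).
Qed.

Lemma coset_map1 : coset_map 1%:M = \sum_k E (col pi k).
Proof.
apply: eq_bigr => k _; rewrite (bigD1 k) //= big1 ?addr0 => [|l lk].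
  by rewrite !mxE eqxx rmorph1 mulr1 cosetl_cosetr.
by rewrite !mxE eq_sym (negPf lk) raddf0 mulr0 mul0r.
Qed.

Lemma coset_map_cosetl N l : coset_map N * cosetl l = \sum_k cosetl k * al (N k l).
Proof.
rewrite /coset_map mulr_suml; apply: eq_bigr => k _; rewrite mulr_suml.
rewrite (bigD1 l) //= big1 ?addr0 => [|j jl].
  by rewrite -mulrA cosetr_cosetl eqxx scale1r cosetl_al.
by rewrite -mulrA cosetr_cosetl (negPf jl) scale0r mulr0.
Qed.

(** The right halves are carried along unchanged, so a left multiplication is known once its effect
    on the left halves is. *)
Lemma mul_coset_map u M N : (forall k, u * cosetl k = \sum_l cosetl l * al (M l k)) ->
  u * coset_map N = coset_map (M *m N).
Proof.
move=> uM; have E2 k : \sum_l cosetl k * al ((M *m N) k l) * cosetr l =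
    \sum_j \sum_l cosetl k * al (M k j) * (al (N j l) * cosetr l).
  rewrite exchange_big; apply: eq_bigr => l _.
  rewrite mxE raddf_sum mulr_sumr mulr_suml; apply: eq_bigr => j _ /=.
  by rewrite rmorphM !mulrA.
rewrite /coset_map [RHS](eq_bigr _ (fun k _ => E2 k)) [RHS]exchange_big mulr_sumr.
apply: eq_bigr => j _; rewrite mulr_sumr [RHS]exchange_big; apply: eq_bigr => l _ /=.
by rewrite -(mulrA (cosetl j)) (mulrA u) uM mulr_suml.
Qed.

Lemma coset_mapM M N : coset_map (M *m N) = coset_map M * coset_map N.
Proof. by apply/esym/mul_coset_map => k; apply: coset_map_cosetl. Qed.

Lemma g_coset_map i N : g i * coset_map N = coset_map (T i *m N).
Proof. by apply: mul_coset_map => k; apply: g_cosetl. Qed.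

Definition color_diag p : 'M[B]_(nb_cosets mu) :=
  \matrix_(k, l) ((zeta (col pi l p))%:A *+ (k == l)).

Lemma color_diagE p k a : color_diag p *m ev k a = ev k (zeta (col pi k p) *: a).
Proof. by apply/colP => l; rewrite mulmx_ev !mxE mulrnAl mulr_algl. Qed.

Lemma t_coset_map p N : t p * coset_map N = coset_map (color_diag p *m N).
Proof.
apply: mul_coset_map => k; rewrite (ev_sum (color_diagE p k 1)).
by rewrite t_cosetl alZ rmorph1 -(scalerAr (zeta _)) mulr1.
Qed.

Local Notation Emu := (\sum_k E (col pi k)).

Lemma coset_idem_g i : Emu * g i = g i * Emu.
Proof.
rewrite mulr_suml mulr_sumr [RHS](reindex_inj (inv_inj (_ : involutive (act (sr i))))) /=.
  apply: eq_bigr => k _; rewrite (color_idem_g Y Z); congr (_ * E _).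
  by apply/funext => p /=; rewrite col_pact simple_reflV.
by move=> k; rewrite -pact_comp /pcomp /simple_refl tperm2 pact1.
Qed.

Lemma coset_idem_t p : Emu * t p = t p * Emu.
Proof.
rewrite mulr_suml mulr_sumr; apply: eq_bigr => k _.
by rewrite (color_idem_t Y Z) (t_color_idem Y Z).
Qed.

End MatrixUnits.

Section CosetMatrices.
Variables (K : comNzRingType) (B : algType K) (q dinv : K) (d n : nat).
Variables (zeta : 'I_d -> K) (Z : root_family dinv zeta).
Variables (mu : Comp d n) (pi : 'I_(nb_cosets mu) -> 'S_n).
Hypothesis pi_enum : coset_enum pi.
Variable hx : 'I_n -> B.
Implicit Types (k l : 'I_(nb_cosets mu)) (i j r : 'I_n.-1) (p : 'I_n).
Local Notation J := (young_gens mu).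
Local Notation sr := (@simple_refl n).
Hypothesis hx_quad : forall r, r \in J -> hecke_quad q (hx (pos_lo r)).
Hypothesis hx_far : forall r r', r \in J -> r' \in J -> (r.+1 < r')%N || (r'.+1 < r)%N ->
  hx (pos_lo r) * hx (pos_lo r') = hx (pos_lo r') * hx (pos_lo r).
Hypothesis hx_braid : forall r r', r \in J -> r' \in J -> r' = r.+1 :> nat ->
  hx (pos_lo r) * hx (pos_lo r') * hx (pos_lo r) =
  hx (pos_lo r') * hx (pos_lo r) * hx (pos_lo r').
Local Notation M := (matalg B (nb_cosets_gt0 pi_enum)).
Local Notation act := (pact pi_enum).

Definition coset_T i : M := coset_rep q 0 pi_enum hx i.
Definition coset_D p : M := color_diag B zeta pi p.
Local Notation T := coset_T.
Local Notation D := coset_D.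

Definition diag_unit k : M := delta_mx k k.

Lemma diag_unitE k l a : diag_unit k *m ev l a = ev l ((k == l)%:R *: a).
Proof.
apply/colP => j; rewrite mulmx_ev !mxE; case: (eqVneq k l) => [->|kl].
  by rewrite scale1r andbT -mulr_natl; case: (j == l); rewrite ?mul1r ?mul0r.
by rewrite andbF mul0r scale0r mul0rn.
Qed.

Lemma coset_D_unit p k : D p * diag_unit k = zeta (col pi k p) *: diag_unit k.
Proof.
apply: mx_ev => l; rewrite matalgM -mulmxA scale_mul_ev !diag_unitE color_diagE.
by rewrite !scalerA; case: eqP => [->|_]; rewrite ?mulr1 ?mul1r // mulr0 mul0r.
Qed.

Lemma unit_ev (X : M) (c : K) k a : X * diag_unit k = c *: diag_unit k ->
  X *m ev k a = ev k (c *: a).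
Proof.
move=> Xk; have -> : ev k a = diag_unit k *m ev k a by rewrite diag_unitE eqxx scale1r.
have -> : X *m (diag_unit k *m ev k a) = (X * diag_unit k) *m ev k a by rewrite matalgM mulmxA.
by rewrite Xk scale_mul_ev diag_unitE eqxx scale1r.
Qed.

Lemma idem_e_ev i k a : idem_e d dinv D i *m ev k a =
  ev k ((col pi k (pos_lo i) == col pi k (pos_hi i))%:R *: a).
Proof. by apply: unit_ev; apply: (idem_e_eigen Z) => p; apply: coset_D_unit. Qed.

Lemma coset_D_exp p k m a : (D p ^+ m : M) *m ev k a = ev k (zeta (col pi k p) ^+ m *: a).
Proof.
apply: unit_ev; elim: m => [|m IH]; first by rewrite !expr0 mul1r scale1r.
by rewrite !exprS -mulrA IH -scalerAr coset_D_unit scalerA mulrC.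
Qed.

(** As [c = 0] here, [T i] squares to [q] on distinct colors, where [e_i] acts by 0; on equal colors
    [e_i] acts by 1 and the block generator satisfies the Hecke relation. Both agree with the
    quadratic relation of Y. *)
Lemma coset_rels : yokonuma_rels q d dinv T D.
Proof.
split=> [i j ij|i j ij|p p'|i p|p|i].
- by apply: (coset_rep_far q 0 pi_enum) ij.
- by apply: (coset_rep_braid (or_introl erefl) pi_enum) ij.
- apply: mx_ev => k; rewrite !matalgM -!mulmxA !color_diagE.
  by rewrite !scalerA mulrC.
- apply: mx_ev => k; rewrite !matalgM -!mulmxA !color_diagE.
  case: (ltngtP (col pi k (pos_lo i)) (col pi k (pos_hi i))) => [lt|gt|/val_inj eq].
  + rewrite !(coset_rep_lt _ _ _ _ _ lt) color_diagE col_pact simple_reflV.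
    by rewrite !scalerA mulrC.
  + rewrite !(coset_rep_gt _ _ _ _ _ gt) !scale0r !ev0 !addr0.
    by rewrite color_diagE col_pact simple_reflV.
  + rewrite !(coset_rep_eq _ _ _ _ _ eq) color_diagE -scalerAr mulr1.
    congr (ev k (zeta _ *: _)); rewrite /simple_refl.
    by case: tpermP => [->|->|//].
- apply: mx_ev => k; rewrite coset_D_exp (rf_exp Z) scale1r.
  exact/esym/one_mul_ev.
- apply: mx_ev => k; rewrite matalgM -mulmxA [RHS]mulmxDl !scale_mul_ev one_mul_ev.
  rewrite [X in _ = _ + X](_ : _ = idem_e d dinv D i *m (T i *m ev k ((q - 1) *: 1))); last first.
    by rewrite matalgM mulmxA.
  case: (eqVneq (col pi k (pos_lo i)) (col pi k (pos_hi i))) => [eq|ne].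
    rewrite (coset_rep_quad_eq 0 pi_enum hx_quad) // (coset_rep_eq _ _ _ _ _ eq).
    by rewrite idem_e_ev eq eqxx scale1r mulr1 -scalerAr mulr1.
  rewrite (coset_rep_quad_ne q 0 pi_enum hx); last exact/eqP.
  rewrite scale0r ev0 mulmx0 addr0.
  have E l a b : T i *m ev k a = ev (act (sr i) k) b -> idem_e d dinv D i *m (T i *m ev k a) = 0.
    move=> ->; rewrite idem_e_ev !col_pact simple_reflV /simple_refl tpermL tpermR.
    by rewrite eq_sym (negPf ne) scale0r ev0.
  have [b /E-> //] : exists b, T i *m ev k ((q - 1) *: 1) = ev (act (sr i) k) b.
    move: ne; rewrite -val_eqE /= neq_ltn => /orP[lt|gt].
      by rewrite (coset_rep_lt _ _ _ _ _ lt); eexists.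
    by rewrite (coset_rep_gt _ _ _ _ _ gt) scale0r ev0 addr0; eexists.
  by rewrite addr0.
Qed.

Section Rep.
Variables (A : algType K) (g : 'I_n.-1 -> A) (t : 'I_n -> A) (qi : K).
Hypotheses (qiP : q * qi = 1) (d_gt0 : (0 < d)%N).
Hypothesis Y : yokonuma_rels q d dinv g t.
Variable rho : {lrmorphism A -> M}.
Hypotheses (rho_g : forall i, rho (g i) = T i) (rho_t : forall p, rho (t p) = D p).
Local Notation E := (color_idem dinv t zeta).
Local Notation k0 := (coset0 pi_enum).

Lemma rho_color_idem f k a :
  rho (E f) *m ev k a = ev k ([forall p, f p == col pi k p]%:R *: a).
Proof.
apply: unit_ev; rewrite color_idem_morph (_ : (fun p => _) = D); last exact/funext.
have Ek : color_idem dinv D zeta (col pi k) * diag_unit k = diag_unit k.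
  by apply: (color_idem_absorbl Z) => p; apply: coset_D_unit.
case: (boolP [forall p, f p == col pi k p]) => [/forallP fk|].
  have -> : f = col pi k by apply/funext => p; apply/eqP.
  by rewrite scale1r.
rewrite negb_forall scale0r => /existsP[p fp].
by rewrite -Ek mulrA (color_idem_orth coset_rels Z fp) mul0r.
Qed.

(** Along a reduced expression of [pi_k], read from the right, each letter is applied to a coloring
    with increasing colors at its two points, and so contributes one factor [q]. *)
Lemma rho_gw k a : rho (wprod g (pi k)) *m ev k0 a = ev k (q ^+ perm_length (pi k) *: a).
Proof.
move: {2}(perm_length _) (erefl (perm_length (pi k))) => r; elim: r k a => [|r IH] k a kr.
  have all_asc i : asc i (pi k).
    by apply/negPn/negP => /perm_length_desc; rewrite kr.
  have p1 : pi k = 1%g by apply: asc_all_id.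
  have -> : k = k0 by have [inj _ _] := pi_enum; apply: inj; rewrite p1 pi_coset0.
  rewrite pi_coset0 (wprod1 (yr_far Y) (yr_braid Y)) rmorph1 one_mul_ev.
  by rewrite perm_length1 expr0 scale1r.
have [/asc_all_id p1|/existsNP[i /negP ni]] := pselect (forall i, asc i (pi k)).
  by move: kr; rewrite p1 perm_length1.
(* By [asc_col_le] a minimal representative has a left descent only where the color strictly
   decreases. *)
have gt : (col pi k (pos_hi i) < col pi k (pos_lo i))%N.
  by rewrite ltnNge; apply: contra ni => /(asc_col_le pi_enum).
pose k' := act (sr i) k.
have pE : pi k' = pcomp (sr i) (pi k) by apply: pi_pact_ne; rewrite neq_ltn gt orbT.
have kE : act (sr i) k' = k by rewrite /k' -pact_comp /pcomp /simple_refl tperm2 pact1.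
have lt' : (col pi k' (pos_lo i) < col pi k' (pos_hi i))%N.
  by rewrite !col_pact simple_reflV /simple_refl tpermL tpermR.
have k'r : perm_length (pi k') = r by move: kr; rewrite pE (perm_length_desc ni) => -[].
have -> : wprod g (pi k) = g i * wprod g (pi k').
  rewrite -(wprod_asc (yr_far Y) (yr_braid Y)) ?pE ?pcompsK //.
  by rewrite asc_simple.
rewrite rmorphM /= matalgM -mulmxA IH // rho_g k'r (coset_rep_lt _ _ _ _ _ lt') kE.
by rewrite scalerA -exprS kr.
Qed.

Variable al : {lrmorphism B -> A}.
Local Notation E1 := (E (blk mu)).
Hypothesis al_E : forall x, al x * E1 = E1 * al x.
Hypothesis rho_al : forall x a, rho (al x) *m ev k0 a = ev k0 (x * a).
Local Notation cl := (cosetl qi dinv g t zeta pi).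

Lemma rho_cosetl k a : rho (cl k) *m ev k0 a = ev k a.
Proof.
rewrite /cosetl linearZ /= scale_mul_ev rmorphM /= matalgM -mulmxA rho_color_idem.
have -> : [forall p, blk mu p == col pi k0 p].
  by apply/forallP => p; rewrite col_coset0.
by rewrite rho_gw scale1r scalerA -exprMn qiP expr1n scale1r.
Qed.

Lemma rho_coset_map N : rho (coset_map q qi dinv g t zeta pi al N) = N.
Proof.
apply: mx_ev => l; rewrite -{1}(rho_cosetl l 1) mulmxA -matalgM -rmorphM.
rewrite (coset_map_cosetl qiP d_gt0 Y Z pi_enum al_E) raddf_sum /= mulmx_suml.
apply/colP => j; rewrite summxE (bigD1 j) //= big1 ?addr0 => [|k kj];
  rewrite rmorphM /= matalgM -mulmxA rho_al rho_cosetl !mxE ?(negPf kj) ?mulr0n //.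
- by rewrite eqxx mulr1 (bigD1 l) //= big1 ?mxE ?eqxx ?mulr1 ?addr0 // => k kl;
    rewrite mxE (negPf kl) mulr0.
- by rewrite eq_sym (negPf kj).
Qed.

End Rep.
End CosetMatrices.

(** * Steinberg elements and tensor factors *)

Lemma steinberg_comm (A : nzRingType) (x y z : A) : z * x = x * z -> z * y = y * z ->
  z * steinberg x y = steinberg x y * z.
Proof.
move=> zx zy; rewrite /steinberg.
by do ![apply: commrD | apply: commrM | apply: commr1 | exact: zx | exact: zy].
Qed.

Section SteinbergColor.
Variables (K : comNzRingType) (A : algType K) (q qi dinv : K) (d n : nat).
Variables (g : 'I_n.-1 -> A) (t : 'I_n -> A) (zeta : 'I_d -> K).
Hypotheses (qiP : q * qi = 1) (d_gt0 : (0 < d)%N).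
Hypotheses (Y : yokonuma_rels q d dinv g t) (Z : root_family dinv zeta).
Local Notation E := (color_idem dinv t zeta).
Local Notation e := (idem_e d dinv t).
Local Notation sr := (@simple_refl n).
Local Notation gV := (g_inv q qi dinv d g t).
Hypothesis g_steinberg : forall i j : 'I_n.-1, i = 0%N :> nat -> j = 1%N :> nat ->
  e i * e j * steinberg (g i) (g j) = 0.
Implicit Types (i j : 'I_n.-1) (f : 'I_n -> 'I_d).

Lemma color_idem_eqC i f : f (pos_lo i) = f (pos_hi i) -> E f * g i = g i * E f.
Proof.
move=> fi; rewrite (color_idem_g Y Z); congr (_ * E _); apply/funext => p /=.
by rewrite /simple_refl; case: tpermP => [->|->|].
Qed.

Lemma gV_color_idem i f : gV i * E f = E (f \o sr i) * gV i.
Proof.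
rewrite -[RHS]mul1r -(gV_g qiP Y i) -mulrA (mulrA (g i)) (g_color_idem Y Z).
rewrite -(mulrA (E _)) (g_gV qiP d_gt0 Y Z) mulr1; congr (_ * E _).
by apply/funext => p /=; rewrite /simple_refl tpermK.
Qed.

(** The relation is imposed on the first three points and is moved along by conjugation with
    [g_(i-1) g_i g_(i+1)]. The coloring is permuted on the way and stays constant on the three
    points involved. *)
Lemma steinberg_color i j f : j = i.+1 :> nat -> f (pos_lo i) = f (pos_hi i) ->
  f (pos_lo j) = f (pos_hi j) -> steinberg (g i) (g j) * E f = 0.
Proof.
move: {2}(i : nat) (erefl (i : nat)) => r; elim: r i j f => [|r IH] i j f ir ji fi fj.
  have C : E f * steinberg (g i) (g j) = steinberg (g i) (g j) * E f.
    exact: steinberg_comm (color_idem_eqC fi) (color_idem_eqC fj).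
  have := g_steinberg ir; move=> /(_ j); rewrite ji ir => /(_ erefl)/(congr1 ( *%R^~ (E f))).
  rewrite mul0r -mulrA -C mulrA -(mulrA (e i)) (e_color_idem Y Z) fj eqxx scale1r.
  by rewrite (e_color_idem Y Z) fi eqxx scale1r C.
have kP : (r < n.-1)%N by move: (ltn_ord i); rewrite ir; apply: leq_trans.
pose k : 'I_n.-1 := Ordinal kP.
have hk : pos_hi k = pos_lo i by apply/val_inj; rewrite /= ir.
have hi : pos_hi i = pos_lo j by apply/val_inj; rewrite /= ji.
have kj : (k.+1 < j)%N by rewrite ji ir ltnSn.
have B1 := @yr_braid _ _ _ _ _ _ _ _ Y k i ir.
have B2 := @yr_braid _ _ _ _ _ _ _ _ Y i j ji.
have C1 : g k * g j = g j * g k by apply: (yr_far Y); rewrite kj.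
have uV : g k * g i * g j * (gV j * (gV i * gV k)) = 1.
  rewrite -!mulrA (mulrA (g j)) (g_gV qiP d_gt0 Y Z) mul1r.
  by rewrite (mulrA (g i)) (g_gV qiP d_gt0 Y Z) mul1r (g_gV qiP d_gt0 Y Z).
have VE : gV j * (gV i * gV k) * E f =
    E (((f \o sr k) \o sr i) \o sr j) * (gV j * (gV i * gV k)).
  rewrite -!mulrA gV_color_idem (mulrA (gV i)) gV_color_idem -!mulrA.
  by rewrite (mulrA (gV j)) gV_color_idem -!mulrA.
rewrite -[E f]mul1r -uV -(mulrA _ _ (E f)) VE (mulrA (steinberg _ _)) (steinberg_conj B1 B2 C1).
have fix_ i1 (x : 'I_n) : x != i1 :> nat -> x != i1.+1 :> nat -> sr i1 x = x.
  by move=> x1 x2; rewrite /simple_refl tpermD // -val_eqE /= eq_sym.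
have P0 : sr k (sr i (sr j (pos_lo k))) = pos_lo i.
  rewrite (fix_ j) ?(fix_ i) /= ?ji ?ir; try by clear; lia.
  by rewrite /simple_refl tpermL hk.
have P1 : sr k (sr i (sr j (pos_hi k))) = pos_lo j.
  rewrite (fix_ j) /= ?ji ?ir; try by clear; lia.
  rewrite hk {2}/simple_refl tpermL hi fix_ //= ?ji ?ir; by clear; lia.
have P2 : sr k (sr i (sr j (pos_hi i))) = pos_hi j.
  rewrite hi {3}/simple_refl tpermL (fix_ i) ?(fix_ k) //= ?ji ?ir; by clear; lia.
have S0 : steinberg (g k) (g i) * E (((f \o sr k) \o sr i) \o sr j) = 0.
  apply: IH => //=; first by rewrite P0 P1 fi hi.
  by rewrite -hk P1 P2.
by rewrite -(mulrA _ (steinberg _ _)) (mulrA (steinberg _ _)) S0 mul0r mulr0.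
Qed.

End SteinbergColor.

Section TensorSlots.
Variables (K : comNzRingType) (d : nat) (A : 'I_d -> algType K).
Hypothesis augA : forall i, augmented (A i).
Local Notation T := (tens augA).
Local Notation pt := (ptens augA).

Let one_at i (x : A i) : forall j, A j := dfwith (fun j => 1 : A j) x.

Definition slot i (x : A i) : T := pt (one_at x).

Let slotP i c (x y : A i) : slot (c *: x + y) = c *: slot x + slot y.
Proof. exact: ptens_lin. Qed.

Let slotM i (x y : A i) : slot (x * y) = slot x * slot y.
Proof.
rewrite /slot ptensM; congr (ptens _ _); apply/functional_extensionality_dep => j.
case: (eqVneq i j) => [<-|ij]; first by rewrite /one_at !dfwith_in.
by rewrite /one_at !dfwith_out // mul1r.
Qed.

Let slot1 i : slot (1 : A i) = 1.
Proof.
rewrite -ptens1 /slot; congr (ptens _ _); apply/functional_extensionality_dep => j.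
case: (eqVneq i j) => [<-|ij]; first by rewrite /one_at !dfwith_in.
by rewrite /one_at !dfwith_out.
Qed.

Lemma slot_zmod i : zmod_morphism (@slot i).
Proof. by move=> x y; rewrite addrC -scaleN1r slotP scaleN1r addrC. Qed.
Lemma slot_monoid i : monoid_morphism (@slot i).
Proof. by split=> [|x y]; rewrite ?slot1 ?slotM. Qed.
Lemma slot_scalable i : scalable (@slot i).
Proof.
by move=> c x; have := slotP c x 0; rewrite !addr0 -(subrr x) slot_zmod subrr addr0.
Qed.
HB.instance Definition _ i := GRing.isZmodMorphism.Build (A i) T (@slot i) (@slot_zmod i).
HB.instance Definition _ i := GRing.isMonoidMorphism.Build (A i) T (@slot i) (@slot_monoid i).
HB.instance Definition _ i := GRing.isScalable.Build K (A i) T *:%R (@slot i) (@slot_scalable i).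

Lemma slotC i j (x : A i) (y : A j) : i != j -> slot x * slot y = slot y * slot x.
Proof.
move=> ij; rewrite /slot !ptensM; congr (ptens _ _); apply/functional_extensionality_dep => k.
case: (eqVneq i k) => [ik|ik].
  have -> : one_at y k = 1 by rewrite /one_at dfwith_out // -ik eq_sym.
  by rewrite mulr1 mul1r.
have -> : one_at x k = 1 by rewrite /one_at dfwith_out.
by rewrite mulr1 mul1r.
Qed.

Lemma prod_slot (a : forall i, A i) : \prod_i slot (a i) = pt a.
Proof.
have H (r : seq 'I_d) : uniq r ->
    \prod_(i <- r) slot (a i) = pt (fun i => if i \in r then a i else 1).
  elim: r => [|i r IH] /=; first by rewrite big_nil -ptens1.
  move=> /andP[ir /IH E]; rewrite big_cons E /slot ptensM; congr (ptens _ _).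
  apply/functional_extensionality_dep => j; rewrite inE.
  case: (eqVneq i j) => [<-|ij]; first by rewrite /one_at dfwith_in (negPf ir) mulr1.
  by rewrite /one_at dfwith_out // mul1r.
rewrite H ?index_enum_uniq //; congr (ptens _ _); apply/functional_extensionality_dep => i.
by rewrite mem_index_enum.
Qed.

Lemma tens_slot_lift (B : algType K) (beta : forall i, {lrmorphism A i -> B}) :
  (forall i j (x : A i) (y : A j), i != j -> beta i x * beta j y = beta j y * beta i x) ->
  exists al : {lrmorphism T -> B}, forall i x, al (@slot i x) = beta i x.
Proof.
move=> /(tens_lift augA)[al alE]; exists al => i x; rewrite alE.
have H (r : seq 'I_d) : uniq r ->
    \prod_(j <- r) beta j (one_at x j) = if i \in r then beta i x else 1.
  elim: r => [|j r IH] /=; first by rewrite big_nil.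
  move=> /andP[jr /IH E]; rewrite big_cons E inE.
  case: (eqVneq i j) jr => [<- /negPf->|ij _]; first by rewrite /one_at dfwith_in mulr1.
  by rewrite /one_at dfwith_out // rmorph1 mul1r.
by rewrite H ?index_enum_uniq // mem_index_enum.
Qed.

End TensorSlots.

Lemma spans_words_mul (K : comNzRingType) (A B : algType K) (f : {lrmorphism A -> B})
  (I : Type) (G : I -> A) (P : B -> Prop) :
  spans (fun y => exists s, y = \prod_(i <- s) G i) -> lin_closed P ->
  (forall i x, P x -> P (f (G i) * x)) -> forall y x, P x -> P (f y * x).
Proof.
move=> sp lP PG y x Px; apply: (sp (fun y => P (f y * x))) => [|_ [s ->]].
  split=> [|c u v Pu Pv]; first by rewrite raddf0 mul0r; case: lP.
  by rewrite linearP mulrDl -scalerAl; case: lP => _; apply.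
elim: s => [|i s IH]; first by rewrite big_nil rmorph1 mul1r.
by rewrite big_cons rmorphM -mulrA; apply: PG.
Qed.

Section BlockGenerators.
Variables (d n : nat) (mu : Comp d n).

Lemma blk_gen_subproof (b : 'I_d) (a : 'I_(part mu b).-1) : (psum mu b + a < n.-1)%N.
Proof.
by have := psum_le_n mu b.+1; rewrite psumS; move: (ltn_ord a); clear; lia.
Qed.
Definition blk_gen b (a : 'I_(part mu b).-1) : 'I_n.-1 := Ordinal (blk_gen_subproof a).

Lemma blk_gen_lo b (a : 'I_(part mu b).-1) : blk mu (pos_lo (blk_gen a)) = b.
Proof. by apply: blk_unique; rewrite psumS /=; move: (ltn_ord a); clear; lia. Qed.

Lemma blk_gen_hi b (a : 'I_(part mu b).-1) : blk mu (pos_hi (blk_gen a)) = b.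
Proof. by apply: blk_unique; rewrite psumS /=; move: (ltn_ord a); clear; lia. Qed.

Lemma blk_gen_young b (a : 'I_(part mu b).-1) : blk_gen a \in young_gens mu.
Proof. by rewrite young_gensE blk_gen_lo blk_gen_hi. Qed.

Lemma young_blk_gen r : r \in young_gens mu ->
  exists b (a : 'I_(part mu b).-1), r = blk_gen a.
Proof.
rewrite young_gensE => /eqP bE; set b := blk mu (pos_lo r) in bE *.
have /andP[bl _] := blkP mu (pos_lo r); have /andP[_ hb] := blkP mu (pos_hi r).
rewrite -/b in bl; rewrite -bE psumS in hb.
have aP : (r - psum mu b < (part mu b).-1)%N by move: bl hb => /=; clear; lia.
by exists b, (Ordinal aP); apply/val_inj => /=; move: bl => /=; clear; lia.
Qed.

End BlockGenerators.

Section BlockHecke.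
Variables (F : numFieldType) (d n : nat) (mu : Comp d n).
Local Notation K := (laurent_ring F).
Local Notation q := (qvar F : K).
Local Notation HT := (Htens F mu).
Local Notation J := (young_gens mu).
Implicit Types (b : 'I_d) (r : 'I_n.-1).

Definition block_slot b : {lrmorphism Hpart F mu b -> HT} :=
  (@slot _ _ _ (Hpart_aug F mu) b : {lrmorphism Hpart F mu b -> tens (Hpart_aug F mu)}).
Local Notation sl := block_slot.

Lemma block_slotC b b' (x : Hpart F mu b) (y : Hpart F mu b') : b != b' ->
  sl b x * sl b' y = sl b' y * sl b x.
Proof. exact: slotC. Qed.

Let block_hx b (p : 'I_n) : HT :=
  sl b (hgenn q (part mu b) (p.+1 - psum mu b) : Hpart F mu b).

(** A function of all points, meaningful at the lower point of a letter of J^mu, where [htens_genE]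
    identifies it with a generator of the factor of its block. *)
Definition htens_gen (p : 'I_n) : HT := block_hx (blk mu p) p.

Lemma htens_genE b (a : 'I_(part mu b).-1) :
  htens_gen (pos_lo (blk_gen a)) = sl b (hgen q a).
Proof.
rewrite /htens_gen blk_gen_lo /block_hx; congr (sl b _).
by rewrite -hgennE /= -addnS addKn.
Qed.

Lemma htens_gen_quad r : r \in J -> hecke_quad q (htens_gen (pos_lo r)).
Proof.
move=> /young_blk_gen[b [a ->]]; rewrite htens_genE.
exact: (hecke_quad_morph (sl b) (hgen_quad q a)).
Qed.

Lemma htens_gen_far r r' : r \in J -> r' \in J -> (r.+1 < r')%N || (r'.+1 < r)%N ->
  htens_gen (pos_lo r) * htens_gen (pos_lo r') = htens_gen (pos_lo r') * htens_gen (pos_lo r).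
Proof.
move=> /young_blk_gen[b [a ->]] /young_blk_gen[b' [a' ->]]; rewrite !htens_genE => far.
case: (eqVneq b b') => [bb|]; last exact: block_slotC.
subst b'; apply: (morph_mul2 (sl b)).
by apply: hgen_far; move: far => /=; clear; lia.
Qed.

Lemma htens_gen_braid r r' : r \in J -> r' \in J -> r' = r.+1 :> nat ->
  htens_gen (pos_lo r) * htens_gen (pos_lo r') * htens_gen (pos_lo r) =
  htens_gen (pos_lo r') * htens_gen (pos_lo r) * htens_gen (pos_lo r').
Proof.
move=> /young_blk_gen[b [a ->]] /young_blk_gen[b' [a' ->]] rr.
have bb : b = b'.
  by rewrite -(blk_gen_hi a) -(blk_gen_lo a'); congr blk; apply/val_inj; rewrite /= -rr.
subst b'; rewrite !htens_genE.
apply: (morph_mul3 (sl b)).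
by apply: hgen_braid; move: rr => /=; clear; lia.
Qed.

Lemma htens_ind (P : HT -> Prop) : lin_closed P -> P 1 ->
  (forall r x, r \in J -> P x -> P (htens_gen (pos_lo r) * x)) -> forall x, P x.
Proof.
move=> lP P1 Pg.
have Pslot b (y : Hpart F mu b) x : P x -> P (sl b y * x).
  apply: (spans_words_mul (f := sl b) (@hecke_spans _ q (part mu b)) lP) => i z Pz.
  by have := Pg _ _ (blk_gen_young i) Pz; rewrite htens_genE.
apply: tens_spans => // _ [a ->]; rewrite -prod_slot.
elim: (index_enum _) => [|b s IH]; first by rewrite big_nil.
by rewrite big_cons; apply: Pslot.
Qed.

End BlockHecke.

Section MorphismWords.
Variables (K : comNzRingType) (A B : algType K) (f : {lrmorphism A -> B}).
Variables (I : Type) (G : I -> A).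
Hypothesis sp : spans (fun y => exists s, y = \prod_(i <- s) G i).

Lemma spans_words_centr z : (forall i, f (G i) * z = z * f (G i)) ->
  forall y, f y * z = z * f y.
Proof.
move=> Gz; apply: sp => [|_ [s ->]].
  split=> [|c u v uz vz]; first by rewrite raddf0 mul0r mulr0.
  by rewrite linearP mulrDl mulrDr -scalerAl -scalerAr uz vz.
elim: s => [|i s IH]; first by rewrite big_nil rmorph1 mul1r mulr1.
by rewrite big_cons rmorphM -mulrA IH mulrA Gz -mulrA.
Qed.

End MorphismWords.

Lemma lrmorphism_comp (K : comNzRingType) (A B C : algType K)
  (f : {lrmorphism B -> C}) (h : {lrmorphism A -> B}) :
  exists u : {lrmorphism A -> C}, forall x, u x = f (h x).
Proof. by exists (f \o h : {lrmorphism A -> C}). Qed.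

Section TensProj.
Variables (F : numFieldType) (d n : nat) (mu : Comp d n).
Local Notation K := (laurent_ring F).
Local Notation q := (qvar F : K).
Local Notation HT := (Htens F mu).
Local Notation TT := (TLmu F mu).

Definition tlp b : {lrmorphism Hpart F mu b -> TLpart F mu b} :=
  (qproj (tl_proper q (part mu b)) : {lrmorphism Hecke q (part mu b) -> TL q (part mu b)}).

Definition tl_slot b : {lrmorphism TLpart F mu b -> TT} :=
  (@slot _ _ _ (TLpart_aug F mu) b : {lrmorphism TLpart F mu b -> tens (TLpart_aug F mu)}).

Lemma tl_slotC b b' (x : TLpart F mu b) (y : TLpart F mu b') : b != b' ->
  tl_slot b x * tl_slot b' y = tl_slot b' y * tl_slot b x.
Proof. exact: slotC. Qed.

Let tproj_exists : exists h : {lrmorphism HT -> TT},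
  forall b x, h (block_slot F mu b x) = tl_slot b (tlp b x).
Proof.
have ex b := lrmorphism_comp (tl_slot b) (tlp b).
pose be b : {lrmorphism Hpart F mu b -> TT} := sval (cid (ex b)).
have beE b x : be b x = tl_slot b (tlp b x) by exact: (svalP (cid (ex b))).
have beC b b' (x : Hpart F mu b) (y : Hpart F mu b') : b != b' ->
    be b x * be b' y = be b' y * be b x.
  by move=> bb; rewrite !beE; apply: tl_slotC.
have [h hE] := tens_slot_lift (Hpart_aug F mu) beC.
by exists h => b x; rewrite -beE; apply: hE.
Qed.

Definition tproj : {lrmorphism HT -> TT} := sval (cid tproj_exists).
Lemma tproj_slot b x : tproj (block_slot F mu b x) = tl_slot b (tlp b x).
Proof. exact: (svalP (cid tproj_exists)). Qed.

Lemma prod_block_slot (a : forall b, Hpart F mu b) :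
  \prod_b block_slot F mu b (a b) = ptens (Hpart_aug F mu) a :> HT.
Proof. exact: prod_slot. Qed.

Lemma prod_tl_slot (a : forall b, TLpart F mu b) :
  \prod_b tl_slot b (a b) = ptens (TLpart_aug F mu) a :> TT.
Proof. exact: prod_slot. Qed.

Lemma tproj_ptens (a : forall b, Hpart F mu b) :
  tproj (ptens (Hpart_aug F mu) a) = ptens (TLpart_aug F mu) (fun b => tlp b (a b)).
Proof.
rewrite -prod_block_slot -prod_tl_slot rmorph_prod /=.
by apply: eq_bigr => b _; apply: tproj_slot.
Qed.

Lemma tens_projE x : tens_proj x = tproj x.
Proof. by apply: freealg_eval_qrepr => a; apply: tproj_ptens. Qed.

Lemma tproj_surj (y : TT) : exists x, tproj x = y.
Proof.
move: y; apply: tens_spans => [|_ [a ->]].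
  split=> [|c _ _ [u <-] [v <-]]; first by exists 0; rewrite raddf0.
  by exists (c *: u + v); rewrite linearP.
pose a' b : Hpart F mu b := qrepr (X_proper := tl_proper q (part mu b)) (a b).
exists (ptens (Hpart_aug F mu) a'); rewrite tproj_ptens; congr ptens.
by apply/functional_extensionality_dep => b; apply: qreprK.
Qed.

End TensProj.

Section CornerMorphism.
Variables (F : numFieldType) (A : algType (laurent_ring F)).
Local Notation K := (laurent_ring F).
Local Notation q := (qvar F : K).
Variables (qi dinv : K) (d n : nat) (g : 'I_n.-1 -> A) (t : 'I_n -> A) (zeta : 'I_d -> K).
Hypotheses (qiP : q * qi = 1) (d_gt0 : (0 < d)%N).
Hypotheses (Y : yokonuma_rels q d dinv g t) (Z : root_family dinv zeta).
Variable mu : Comp d n.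
Local Notation E := (color_idem dinv t zeta).
Local Notation E1 := (E (blk mu)).
Local Notation cg r := (corner E1 (1 - E1) (g r)).
Local Notation J := (young_gens mu).
Implicit Types (r : 'I_n.-1) (b : 'I_d).

Let EE : E1 * E1 = E1 := color_idem_idem Y Z (blk mu).
Let E1f : 1 = E1 + (1 - E1). Proof. by rewrite addrC subrK. Qed.

Lemma young_gC r : r \in J -> E1 * g r = g r * E1.
Proof. by rewrite young_gensE => /eqP; apply: (color_idem_eqC Y Z). Qed.

Lemma corner_gC r : r \in J -> cg r * E1 = E1 * cg r.
Proof. by move=> /young_gC rC; rewrite (corner_eC EE E1f rC). Qed.

Lemma corner_far r r' : r \in J -> r' \in J -> (r.+1 < r')%N || (r'.+1 < r)%N ->
  cg r * cg r' = cg r' * cg r.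
Proof.
move=> /young_gC rC /young_gC rC' far.
by rewrite !(cornerM EE E1f) // (yr_far Y far).
Qed.

Lemma corner_braid r r' : r \in J -> r' \in J -> r' = r.+1 :> nat ->
  cg r * cg r' * cg r = cg r' * cg r * cg r'.
Proof.
move=> /young_gC rC /young_gC rC' rr.
by rewrite !(cornerM3 EE E1f) // (yr_braid Y rr).
Qed.

Lemma corner_g_quad r : r \in J -> hecke_quad q (cg r).
Proof.
move=> rJ; have rC := young_gC rJ; apply: (corner_quad EE E1f rC).
rewrite (yr_quad Y) mulrDl mulr_algl -(scalerAl (q - 1)) -mulrA -rC mulrA.
by rewrite (e_color_idem Y Z); move: rJ; rewrite young_gensE => ->; rewrite scale1r.
Qed.

(** Letters of different blocks are separated by a boundary letter, which is outside J^mu. *)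
Lemma young_far r r' : r \in J -> r' \in J -> blk mu (pos_lo r) != blk mu (pos_lo r') ->
  (r.+1 < r')%N || (r'.+1 < r)%N.
Proof.
rewrite !young_gensE => /eqP br /eqP br' ne.
have N (x y : 'I_n) : blk mu x = blk mu (pos_lo r) -> blk mu y = blk mu (pos_lo r') -> x <> y.
  by move=> xr yr xy; move: ne; rewrite -xr -yr xy eqxx.
have N1 := N (pos_lo r) (pos_lo r') erefl erefl.
have N2 := N (pos_hi r) (pos_lo r') (esym br) erefl.
have N3 := N (pos_lo r) (pos_hi r') erefl (esym br').
have M1 : r <> r' :> nat by move=> rr; apply: N1; apply/val_inj.
have M2 : r.+1 <> r' by move=> rr; apply: N2; apply/val_inj.
have M3 : r <> r'.+1 :> nat by move=> rr; apply: N3; apply/val_inj.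
by move: M1 M2 M3; clear; lia.
Qed.

Let beta_exists b : exists h : {lrmorphism Hpart F mu b -> A},
  forall a, h (hgen q a) = cg (blk_gen a).
Proof.
have [||i|h hE] := @hecke_lift K q (part mu b) A (fun a => cg (blk_gen a)).
- move=> i j ij; apply: corner_far; rewrite ?blk_gen_young //.
  by move: ij => /=; clear; lia.
- by move=> i j ij; apply: corner_braid; rewrite ?blk_gen_young //= ij addnS.
- exact: corner_g_quad (blk_gen_young i).
- by exists h.
Qed.

Let beta b : {lrmorphism Hpart F mu b -> A} := sval (cid (beta_exists b)).
Let betaE b a : beta b (hgen q a) = cg (blk_gen a).
Proof. exact: (svalP (cid (beta_exists b))). Qed.

Let betaC b b' (x : Hpart F mu b) (y : Hpart F mu b') : b != b' ->
  beta b x * beta b' y = beta b' y * beta b x.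
Proof.
move=> bb.
apply: (spans_words_centr (f := beta b) (@hecke_spans _ q (part mu b))) => a.
apply/esym.
apply: (spans_words_centr (f := beta b') (@hecke_spans _ q (part mu b'))) => a'.
rewrite !betaE; apply: corner_far; rewrite ?blk_gen_young //.
by apply: young_far; rewrite ?blk_gen_young // !blk_gen_lo eq_sym.
Qed.

Lemma corner_lift : exists al : {lrmorphism Htens F mu -> A},
  forall r, r \in J -> al (htens_gen F mu (pos_lo r)) = cg r.
Proof.
have [al alE] := tens_slot_lift (Hpart_aug F mu) betaC.
exists al => r /young_blk_gen[b [a ->]]; rewrite htens_genE.
exact: etrans (alE b _) (betaE a).
Qed.

Hypothesis st : forall (i j : 'I_n.-1) (f : 'I_n -> 'I_d), j = i.+1 :> nat -> f (pos_lo i) = f (pos_hi i) ->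
  f (pos_lo j) = f (pos_hi j) -> steinberg (g i) (g j) * E f = 0.

Let beta0_exists b : exists h : {lrmorphism TLpart F mu b -> A},
  forall x, h (tlp F mu b x) = beta b x.
Proof.
have [i j i0 j1|h hE] := @tl_lift K q (part mu b) A (beta b); last by exists h.
rewrite !betaE corner_steinberg ?young_gC ?blk_gen_young //.
apply: st; rewrite ?blk_gen_lo ?blk_gen_hi //=.
by rewrite i0 j1 addn0 addn1.
Qed.

Let beta0 b : {lrmorphism TLpart F mu b -> A} := sval (cid (beta0_exists b)).
Let beta0E b x : beta0 b (tlp F mu b x) = beta b x.
Proof. exact: (svalP (cid (beta0_exists b))). Qed.

Let beta0C b b' (x : TLpart F mu b) (y : TLpart F mu b') : b != b' ->
  beta0 b x * beta0 b' y = beta0 b' y * beta0 b x.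
Proof.
have -> : x = tlp F mu b (qrepr (X_proper := tl_proper q (part mu b)) x) by exact/esym/qreprK.
have -> : y = tlp F mu b' (qrepr (X_proper := tl_proper q (part mu b')) y) by exact/esym/qreprK.
by rewrite !beta0E; apply: betaC.
Qed.

(** By [corner_steinberg] the Steinberg element of the corners is that of the [g_j] cut by [E_1],
    which [st] kills since [blk] is constant on a block; hence the map of each factor descends to
    TL. *)
Lemma corner_lift_tl : exists al0 : {lrmorphism TLmu F mu -> A},
  forall r, r \in J -> al0 (tproj F mu (htens_gen F mu (pos_lo r))) = cg r.
Proof.
have [al0 al0E] := tens_slot_lift (TLpart_aug F mu) beta0C.
exists al0 => r /young_blk_gen[b [a ->]]; rewrite htens_genE tproj_slot.
by rewrite -betaE -beta0E; apply: al0E.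
Qed.

End CornerMorphism.

Section BlockAlgebra.
Variables (F : numFieldType) (d n : nat) (mu : Comp d n).
Local Notation K := (laurent_ring F).
Local Notation q := (qvar F : K).
Local Notation J := (young_gens mu).
Variables (B : algType K) (pB : {lrmorphism Htens F mu -> B}).
Hypothesis pB_surj : forall y, exists x, pB x = y.

(** [B] will be the tensor product of the Hecke algebras or its quotient TL^mu; the argument is made
    once, for any surjective image. *)
Definition block_gen (p : 'I_n) : B := pB (htens_gen F mu p).
Local Notation hx := block_gen.
Implicit Types (r : 'I_n.-1).

Lemma block_gen_quad r : r \in J -> hecke_quad q (hx (pos_lo r)).
Proof. by move=> rJ; exact: (hecke_quad_morph pB (htens_gen_quad F rJ)). Qed.

Lemma block_gen_far r r' : r \in J -> r' \in J -> (r.+1 < r')%N || (r'.+1 < r)%N ->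
  hx (pos_lo r) * hx (pos_lo r') = hx (pos_lo r') * hx (pos_lo r).
Proof. by move=> rJ rJ' far; exact: (morph_mul2 pB (htens_gen_far F rJ rJ' far)). Qed.

Lemma block_gen_braid r r' : r \in J -> r' \in J -> r' = r.+1 :> nat ->
  hx (pos_lo r) * hx (pos_lo r') * hx (pos_lo r) =
  hx (pos_lo r') * hx (pos_lo r) * hx (pos_lo r').
Proof. by move=> rJ rJ' rr; exact: (morph_mul3 pB (htens_gen_braid F rJ rJ' rr)). Qed.

Lemma block_ind (P : B -> Prop) : lin_closed P -> P 1 ->
  (forall r x, r \in J -> P x -> P (hx (pos_lo r) * x)) -> forall x, P x.
Proof.
move=> [P0 lP] P1 Pg y; have [x <-] := pB_surj y.
apply: (htens_ind (P := fun x => P (pB x))) => [||r z rJ Pz].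
- by split=> [|c u v Pu Pv]; [rewrite raddf0 | rewrite linearP; apply: lP].
- by rewrite rmorph1.
- by rewrite rmorphM; apply: Pg.
Qed.

Section Action.
Variables (A : algType K) (qi dinv : K) (g : 'I_n.-1 -> A) (t : 'I_n -> A).
Variable zeta : 'I_d -> K.
Hypotheses (qiP : q * qi = 1) (d_gt0 : (0 < d)%N).
Hypotheses (Y : yokonuma_rels q d dinv g t) (Z : root_family dinv zeta).
Local Notation E := (color_idem dinv t zeta).
Local Notation E1 := (E (blk mu)).
Variable al : {lrmorphism B -> A}.
Hypothesis alE : forall r, r \in J -> al (hx (pos_lo r)) = corner E1 (1 - E1) (g r).

Lemma block_al_E x : al x * E1 = E1 * al x.
Proof.
move: x; apply: block_ind => [||r x rJ xE].
- split=> [|c u v uE vE]; first by rewrite raddf0 mul0r mulr0.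
  by rewrite linearP mulrDl mulrDr -scalerAl -scalerAr uE vE.
- by rewrite rmorph1 mul1r mulr1.
- by rewrite rmorphM /= -mulrA xE mulrA alE // (corner_gC Y Z rJ) -mulrA.
Qed.

Lemma block_al_hx r : r \in J -> al (hx (pos_lo r)) * E1 = g r * E1.
Proof.
move=> rJ; rewrite alE //; apply: corner_e; first exact: (color_idem_idem Y Z).
by rewrite addrC subrK.
Qed.

Variables (pi : 'I_(nb_cosets mu) -> 'S_n) (pi_enum : coset_enum pi).
Local Notation M := (matalg B (nb_cosets_gt0 pi_enum)).
Local Notation k0 := (coset0 pi_enum).
Variable rho : {lrmorphism A -> M}.
Hypothesis rho_g : forall i, rho (g i) = coset_T q pi_enum hx i.
Hypothesis rho_t : forall p, rho (t p) = coset_D B zeta pi_enum p.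

(** The first column belongs to the coloring [blk], on which [E_1] acts as the identity, so the sign
    part of [corner] vanishes there. *)
Lemma block_rho_al x a : rho (al x) *m ev k0 a = ev k0 (x * a).
Proof.
move: x a; apply: block_ind => [||r x rJ xE a].
- split=> [a|c u v uE vE a].
    by rewrite !raddf0 mul0r ev0; apply: mul0mx.
  rewrite !linearP /= mulrDl -scalerAl [LHS]mulmxDl scale_mul_ev uE vE -evD.
  by rewrite scalerAr.
- by move=> a; rewrite !rmorph1 mul1r one_mul_ev.
- rewrite !rmorphM /= matalgM -mulmxA xE alE // /corner rmorphB /= rmorphM rmorphB rmorph1 /=.
  rewrite [LHS]mulmxBl matalgM -mulmxA [X in _ - X]mulmxBl one_mul_ev.
  rewrite !(rho_color_idem Z block_gen_quad block_gen_far block_gen_braid rho_t).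
  have -> : [forall p, blk mu p == col pi k0 p].
    by apply/forallP => p; rewrite col_coset0.
  rewrite !scale1r subrr subr0 rho_g (coset_rep_eq _ _ _ _ _ (_ : col pi k0 _ = _)).
    by rewrite /coset_x pi_coset0 invg1 perm1 mulrA.
  by rewrite !col_coset0; apply/eqP; rewrite -young_gensE.
Qed.

End Action.
End BlockAlgebra.

(** * The tensor product of Hecke algebras inside H_n *)

Section HeckeEmbedding.
Variables (F : numFieldType) (d n : nat) (mu : Comp d n).
Local Notation K := (laurent_ring F).
Local Notation q := (qvar F : K).
Local Notation HT := (Htens F mu).
Local Notation J := (young_gens mu).
Local Notation H := (Hq F n).
Implicit Types (b : 'I_d) (r : 'I_n.-1).

Let be_exists b : exists h : {lrmorphism Hpart F mu b -> H},
  forall a, h (hgen q a) = Hgen F (blk_gen a).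
Proof.
have [i j ij|i j ij|i|h hE] := @hecke_lift K q (part mu b) H (fun a => hgen q (blk_gen a)).
- by apply: hgen_far; move: ij => /=; clear; lia.
- by apply: hgen_braid; rewrite /= ij addnS.
- exact: hgen_quad.
- by exists h.
Qed.
Let be b : {lrmorphism Hpart F mu b -> H} := sval (cid (be_exists b)).
Let beE b a : be b (hgen q a) = Hgen F (blk_gen a).
Proof. exact: (svalP (cid (be_exists b))). Qed.

Let beC b b' (x : Hpart F mu b) (y : Hpart F mu b') : b != b' ->
  be b x * be b' y = be b' y * be b x.
Proof.
move=> bb; apply: (spans_words_centr (f := be b) (@hecke_spans _ q (part mu b))) => a.
apply/esym; apply: (spans_words_centr (f := be b') (@hecke_spans _ q (part mu b'))) => a'.
rewrite !beE; apply: hgen_far.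
by apply: (young_far (mu := mu)); rewrite ?blk_gen_young // !blk_gen_lo eq_sym.
Qed.

Let block_embedE b (x : Hpart F mu b) : block_embed x = be b x.
Proof.
apply: freealg_eval_qrepr => a; rewrite addnS (hgennE q (blk_gen a)).
exact: beE.
Qed.

Let iso_exists : exists h : {lrmorphism HT -> H},
  forall b x, h (block_slot F mu b x) = be b x.
Proof. exact: (tens_slot_lift (Hpart_aug F mu) beC). Qed.

Definition Hiso : {lrmorphism HT -> H} := sval (cid iso_exists).
Let Hiso_slot b x : Hiso (block_slot F mu b x) = be b x.
Proof. exact: (svalP (cid iso_exists)). Qed.

Lemma Htens_isoE x : Htens_iso x = Hiso x.
Proof.
apply: freealg_eval_qrepr => a; rewrite -[qproj _ _]/(ptens (Hpart_aug F mu) a).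
rewrite -prod_block_slot rmorph_prod /=; apply: eq_bigr => b _.
by rewrite block_embedE Hiso_slot.
Qed.

Lemma Hiso_gen r : r \in J -> Hiso (htens_gen F mu (pos_lo r)) = Hgen F r.
Proof. by move=> /young_blk_gen[b [a ->]]; rewrite htens_genE Hiso_slot beE. Qed.

Lemma Hiso_Hmu x : @Hmu F d n mu (Hiso x).
Proof.
move: x; have S : is_subalg (@Hmu F d n mu).
  split=> [P [[P1 _ _] _] //|c u v Mu Mv P CP|u v Mu Mv P CP]; have [[_ Pl Pm] _] := CP.
    exact: Pl (Mu P CP) (Mv P CP).
  exact: Pm (Mu P CP) (Mv P CP).
case: (S) => S1 Sl Sm; apply: htens_ind => [||r x rJ Sx].
- split=> [|c u v Su Sv]; last by rewrite linearP; apply: Sl.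
  by rewrite raddf0; have := Sl (-1) 1 1 S1 S1; rewrite scaleN1r addNr.
- by rewrite rmorph1.
- rewrite rmorphM /= Hiso_gen //; apply: Sm => // P [_ Pg].
  by apply: Pg; exists r.
Qed.

Lemma Hmu_Hiso y : @Hmu F d n mu y -> exists x, Hiso x = y.
Proof.
move=> yM; apply: (yM (fun y => exists x, Hiso x = y)); split=> [|_ [r rJ <-]]; last by exists (htens_gen F mu (pos_lo r)); apply: Hiso_gen.
split=> [|c _ _ [u <-] [v <-]|_ _ [u <-] [v <-]].
- by exists 1; rewrite rmorph1.
- by exists (c *: u + v); rewrite linearP.
- by exists (u * v); rewrite rmorphM.
Qed.

Variables (pi : 'I_(nb_cosets mu) -> 'S_n) (pi_enum : coset_enum pi).
Local Notation T i := (coset_rep q (q - 1) pi_enum (htens_gen F mu) i).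
Local Notation M := (matalg HT (nb_cosets_gt0 pi_enum)).
Local Notation k0 := (coset0 pi_enum).

(** H_n acts on the module induced from the blocks, this time with [c = q - 1]; on its first column
    [Hiso x] acts as left multiplication by [x], which recovers [x]. *)
Lemma Hiso_inj : injective Hiso.
Proof.
have hq := @htens_gen_quad F d n mu; have hf := @htens_gen_far F d n mu.
have hb := @htens_gen_braid F d n mu.
have [i j ij|i j ij|i|R RE] := @hecke_lift K q n M (fun i => T i).
- exact: (coset_rep_far q (q - 1) pi_enum hf ij).
- exact: (coset_rep_braid (or_intror erefl) pi_enum hq hb ij).
- apply: hecke_quad_ev => k; case: (eqVneq (col pi k (pos_lo i)) (col pi k (pos_hi i))) => [eq|ne].
    rewrite (coset_rep_quad_eq (q - 1) pi_enum hq) // (coset_rep_eq _ _ _ _ _ eq).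
    by rewrite -scalerAr mulr1.
  by rewrite (coset_rep_quad_ne q (q - 1) pi_enum) //; apply/eqP.
have RI x : forall a, R (Hiso x) *m ev k0 a = ev k0 (x * a).
  move: x; apply: htens_ind => [||r x rJ xE a].
  - split=> [a|c u v uE vE a]; first by rewrite !raddf0 mul0r ev0; apply: mul0mx.
    rewrite !linearP /= mulrDl -scalerAl [LHS]mulmxDl scale_mul_ev uE vE -evD.
    by rewrite scalerAr.
  - by move=> a; rewrite !rmorph1 mul1r one_mul_ev.
  - rewrite !rmorphM /= matalgM -mulmxA xE Hiso_gen // RE.
    rewrite (coset_rep_eq _ _ _ _ _ (_ : col pi k0 _ = _)).
      by rewrite /coset_x pi_coset0 invg1 perm1 mulrA.
    by rewrite !col_coset0; apply/eqP; rewrite -young_gensE.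
move=> x y xy; have := RI x 1; rewrite xy RI !mulr1.
by move/ev_inj.
Qed.

(** [rho] applies the projection to a chosen preimage, and [Hiso_inj] leaves only one. *)
Lemma rhoE x : rho mu (Hiso x) = tproj F mu x.
Proof.
rewrite /rho tens_projE; congr (tproj F mu _); apply: Hiso_inj.
have xE : [set y : HT | @Htens_iso F d n mu y = Hiso x] x := Htens_isoE x.
by rewrite -Htens_isoE; exact: (xgetI 0 xE).
Qed.

End HeckeEmbedding.

(** * The isomorphism Psi_mu *)

Section ThreeColors.
Variables (K : comNzRingType) (A : algType K) (q dinv : K) (d n : nat).
Variables (g : 'I_n.-1 -> A) (t : 'I_n -> A) (zeta : 'I_d -> K).
Hypothesis d_gt0 : (0 < d)%N.
Hypotheses (Y : yokonuma_rels q d dinv g t) (Z : root_family dinv zeta).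
Local Notation E := (color_idem dinv t zeta).
Local Notation e := (idem_e d dinv t).
Local Notation sr := (@simple_refl n).

Lemma idem_e2_color (i j : 'I_n.-1) f : e i * e j * E f =
  ((f (pos_lo i) == f (pos_hi i)) && (f (pos_lo j) == f (pos_hi j)))%:R *: E f.
Proof.
rewrite -mulrA (e_color_idem Y Z) -scalerAr (e_color_idem Y Z) scalerA.
by rewrite -natrM mulnb andbC.
Qed.

Lemma idem_e2_g (i j : 'I_n.-1) : j = i.+1 :> nat ->
  e i * e j * g i = g i * (e i * e j) /\ e i * e j * g j = g j * (e i * e j).
Proof.
move=> ij; have hl : pos_hi i = pos_lo j by apply/val_inj; rewrite /= ij.
have fix_ (i1 : 'I_n.-1) (x : 'I_n) : x != i1 :> nat -> x != i1.+1 :> nat -> sr i1 x = x.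
  by move=> x1 x2; rewrite /simple_refl tpermD // -val_eqE /= eq_sym.
split; apply: (color_idem_ext d_gt0 Y Z) => f; rewrite -[RHS]mulrA idem_e2_color.
  rewrite -mulrA (g_color_idem Y Z) mulrA idem_e2_color -scalerAl -scalerAr.
  rewrite (g_color_idem Y Z) /= -hl /simple_refl tpermL tpermR -/(sr i).
  rewrite (fix_ i (pos_hi j)) /= ?ij; [|by clear; lia|by clear; lia].
  by case: eqVneq => [->|].
rewrite -mulrA (g_color_idem Y Z) mulrA idem_e2_color -scalerAl -scalerAr.
rewrite (g_color_idem Y Z) /= hl /simple_refl tpermL tpermR -/(sr j).
rewrite (fix_ j (pos_lo i)) /= ?ij; [|by clear; lia|by clear; lia].
rewrite (eq_sym (f (pos_hi j))).
by case: (f (pos_lo j) =P f (pos_hi j)) => [->|_]; rewrite ?andbT ?andbF.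
Qed.

End ThreeColors.

Section CosetMapMorph.
Variables (K : comNzRingType) (A A' B B' : algType K) (q qi dinv : K) (d n : nat).
Variables (g : 'I_n.-1 -> A) (t : 'I_n -> A) (zeta : 'I_d -> K).
Variables (mu : Comp d n) (pi : 'I_(nb_cosets mu) -> 'S_n).
Variables (al : {lrmorphism B -> A}) (al' : {lrmorphism B' -> A'}).
Variables (h : {lrmorphism A -> A'}) (p : B -> B').
Hypothesis hp : forall x, h (al x) = al' (p x).

Lemma coset_map_morph N : h (coset_map q qi dinv g t zeta pi al N) =
  coset_map q qi dinv (fun i => h (g i)) (fun j => h (t j)) zeta pi al' (map_mx p N).
Proof.
have hV i : h (g_inv q qi dinv d g t i) =
    g_inv q qi dinv d (fun i => h (g i)) (fun j => h (t j)) i.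
  by rewrite /g_inv linearZ rmorphB /= linearZ /= idem_e_morph.
rewrite /coset_map rmorph_sum; apply: eq_bigr => k _.
rewrite rmorph_sum; apply: eq_bigr => l _; rewrite !rmorphM /= hp mxE.
congr (_ * _ * _).
  rewrite /cosetl linearZ rmorphM /= color_idem_morph rmorph_prod.
  by congr (_ *: (_ * _)).
rewrite /cosetr linearZ rmorphM /= color_idem_morph; congr (_ *: (_ * _)).
by rewrite rmorph_prod; apply: eq_bigr => i _; apply: hV.
Qed.

End CosetMapMorph.

Section PsiFormula.
Variables (F : numFieldType) (d n : nat) (d_gt0 : (0 < d)%N) (mu : Comp d n).
Local Notation K := (laurent_ring F).
Local Notation q := (qvar F : K).
Variables (A : algType K) (dinv : K) (g : 'I_n.-1 -> A) (t : 'I_n -> A).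
Hypothesis Y : yokonuma_rels q d dinv g t.
Variables (pi : 'I_(nb_cosets mu) -> 'S_n) (pi_enum : coset_enum pi).
Variables (B C : algType K) (hx : 'I_n -> B) (G : 'I_n.-1 -> C) (iota : {lrmorphism B -> C}).
Hypothesis G_far : forall i j : 'I_n.-1, (i.+1 < j)%N || (j.+1 < i)%N -> G i * G j = G j * G i.
Hypothesis G_braid : forall i j : 'I_n.-1, j = i.+1 :> nat -> G i * G j * G i = G j * G i * G j.
Hypothesis iota_hx : forall r, r \in young_gens mu -> iota (hx (pos_lo r)) = G r.
Local Notation sr := (@simple_refl n).
Local Notation act := (pact pi_enum).
Variable rho : {lrmorphism A -> matalg B (nb_cosets_gt0 pi_enum)}.
Hypothesis rho_g : forall i, rho (g i) = coset_T q pi_enum hx i.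

Let qexpD a b : qexp F (a + b) = (qexp F a : K) * qexp F b.
Proof. by apply/val_inj; rewrite /= expfzDr // tofrac_eq0 polyX_eq0. Qed.

(** Induction on the length of [w], with one letter [s_i] split off on the left. Increasing colors
    raise the exponent by 1, decreasing colors leave it unchanged, and [conj_perm] is the same in
    both cases; for equal colors [conj_perm] gains a letter and the exponent does not change. *)
Lemma psi_column w l : exists2 x : B, rho (wprod g w) *m ev l 1 = ev (act w l) x &
  iota x = (qexp F (psi_exponent pi (act w l) l w) : K) *:
    wprod G (conj_perm pi (act w l) l w).
Proof.
move: {2}(perm_length _) (erefl (perm_length w)) => r; elim: r w => [|r IH] w wr.
  have w1 : w = 1%g.
    by apply: asc_all_id => i; apply/negPn/negP => /perm_length_desc; rewrite wr.
  exists 1; rewrite w1 pact1 ?(wprod1 (yr_far Y) (yr_braid Y)) ?rmorph1 ?one_mul_ev //.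
  have c1 : conj_perm pi l l 1%g = 1%g by rewrite /conj_perm /pcomp mul1g mulgV.
  have := psi_exponentE d_gt0 pi l l 1%g; rewrite /dbl_exponent c1 => e0.
  have -> : psi_exponent pi l l 1%g = 0 by move: e0; clear; lia.
  rewrite (wprod1 G_far G_braid) ?rmorph1.
  by rewrite (_ : qexp F 0 = 1) ?scale1r //; apply/val_inj; rewrite /= expr0z.
have [/asc_all_id w1|/existsNP[i /negP ni]] := pselect (forall i, asc i w).
  by move: wr; rewrite w1 perm_length1.
pose w' := pcomp (sr i) w.
have wE : w = pcomp (sr i) w' by rewrite /w' pcompsK.
have asc' : asc i w' by rewrite /w' asc_simple.
have w'r : perm_length w' = r by move: wr; rewrite (perm_length_desc ni) => -[].
have [x x1 x2] := IH w' w'r; set k := act w' l in x1 x2.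
have kE : act w l = act (sr i) k by rewrite wE pact_comp.
have rE : rho (wprod g w) *m ev l 1 = coset_rep q 0 pi_enum hx i *m ev k x.
  by rewrite wE (wprod_asc (yr_far Y) (yr_braid Y)) // rmorphM /= matalgM -mulmxA x1 rho_g.
have lw : perm_length w = r.+1 by [].
have col_k p : col pi k p = col pi l (w'^-1%g p) by rewrite col_pact.
clearbody k w'; case: (ltngtP (col pi k (pos_lo i)) (col pi k (pos_hi i))) => [lt|gt|/val_inj eq].
- have pE : pi (act (sr i) k) = pcomp (sr i) (pi k).
    by apply: pi_pact_ne; rewrite neq_ltn lt.
  exists ((q : K) *: x); first by rewrite rE kE; apply: coset_rep_lt.
  have cE : conj_perm pi (act w l) l w = conj_perm pi k l w'.
    by rewrite /conj_perm kE pE wE pcompV simple_reflV -!pcompA pcompsK.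
  have := psi_exponentE d_gt0 pi (act w l) l w; have := psi_exponentE d_gt0 pi k l w'.
  rewrite /dbl_exponent cE kE pE (perm_length_asc (asc_col_lt lt)) lw w'r => e1 e2.
  have -> : psi_exponent pi (act (sr i) k) l w = 1 + psi_exponent pi k l w'.
    by move: e1 e2; clear; lia.
  by rewrite linearZ /= x2 qexpD scalerA.
- have pE : pi (act (sr i) k) = pcomp (sr i) (pi k).
    by apply: pi_pact_ne; rewrite neq_ltn gt orbT.
  have lt' : (col pi (act (sr i) k) (pos_lo i) < col pi (act (sr i) k) (pos_hi i))%N.
    by rewrite !col_pact simple_reflV /simple_refl tpermL tpermR.
  have gt' : ~~ asc i (pi k) by have := asc_col_lt lt'; rewrite pE asc_simple.
  exists x; first by rewrite rE kE coset_rep_gt // scale0r ev0 addr0.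
  have cE : conj_perm pi (act w l) l w = conj_perm pi k l w'.
    by rewrite /conj_perm kE pE wE pcompV simple_reflV -!pcompA pcompsK.
  have := psi_exponentE d_gt0 pi (act w l) l w; have := psi_exponentE d_gt0 pi k l w'.
  rewrite /dbl_exponent cE kE pE (perm_length_desc gt') lw w'r => e1 e2.
  have -> : psi_exponent pi (act (sr i) k) l w = psi_exponent pi k l w'.
    by move: e1 e2; clear; lia.
  by rewrite x2.
- have [r0 r0J [rl rh pE]] := pi_simple_eq pi_enum eq.
  have kk : act (sr i) k = k by apply: pact_eq.
  exists (hx (pos_lo r0) * x).
    by rewrite rE kE kk (coset_rep_eq _ _ _ _ _ eq) /coset_x rl.
  pose v := conj_perm pi k l w'.
  have cE : conj_perm pi (act w l) l w = pcomp (sr r0) v.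
    rewrite /v /conj_perm kE kk wE !pcompA; congr (pcomp (pcomp _ _) _).
    apply: (mulgI (pi k)); rewrite /pcomp mulgA mulKVg.
    by have -> : (pi k * sr i)%g = (sr r0 * pi k)%g := pE; rewrite mulgK.
  (* Otherwise [pi_l], being increasing on blocks, would contradict the ascent of [w'] at [i]. Thus
     the product of the [G] along [v] is lengthened by one factor. *)
  have vasc : asc r0 v.
    have lo : pi k (pos_lo r0) = pos_lo i by rewrite rl permKV.
    have hi : pi k (pos_hi r0) = pos_hi i by rewrite rh permKV.
    rewrite /asc /v /conj_perm !pcompV !pcompE invgK lo hi.
    set a := w'^-1%g (pos_lo i); set b := w'^-1%g (pos_hi i).
    have ab : (a < b)%N := asc'.
    have bE : blk mu ((pi l)^-1%g b) = blk mu ((pi l)^-1%g a).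
      by move: eq; rewrite !col_k.
    case: (ltngtP ((pi l)^-1%g a) ((pi l)^-1%g b)) => // [ba|/val_inj/perm_inj E].
      by have := pi_increasing pi_enum l bE ba; rewrite !permKV ltnNge ltnW.
    by move: ab; rewrite E ltnn.
  have eqs := psi_exponentE d_gt0 pi (act w l) l w; have := psi_exponentE d_gt0 pi k l w'.
  move: eqs; rewrite /dbl_exponent cE -/v kE kk (perm_length_asc vasc) lw w'r => e2 e1.
  have -> : psi_exponent pi k l w = psi_exponent pi k l w'.
    by move: e1 e2; clear; lia.
  rewrite rmorphM /= iota_hx // x2 -scalerAr; congr (_ *: _).
  by rewrite (wprod_asc G_far G_braid).
Qed.

End PsiFormula.

Section CosetIso.
Variables (F : numFieldType) (d n : nat) (mu : Comp d n).
Local Notation K := (laurent_ring F).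
Local Notation q := (qvar F : K).
Local Notation J := (young_gens mu).
Variables (B : algType K) (pB : {lrmorphism Htens F mu -> B}).
Hypothesis pB_surj : forall y, exists x, pB x = y.
Local Notation hx := (block_gen pB).
Variables (A : algType K) (qi dinv : K) (g : 'I_n.-1 -> A) (t : 'I_n -> A).
Variable zeta : 'I_d -> K.
Hypotheses (qiP : q * qi = 1) (d_gt0 : (0 < d)%N).
Hypotheses (Y : yokonuma_rels q d dinv g t) (Z : root_family dinv zeta).
Local Notation E := (color_idem dinv t zeta).
Local Notation E1 := (E (blk mu)).
Hypothesis A_ind : forall P : A -> Prop, lin_closed P -> P 1 ->
  (forall i x, P x -> P (g i * x)) -> (forall j x, P x -> P (t j * x)) -> forall x, P x.
Variable al : {lrmorphism B -> A}.
Hypothesis alE : forall r, r \in J -> al (hx (pos_lo r)) = corner E1 (1 - E1) (g r).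
Variables (pi : 'I_(nb_cosets mu) -> 'S_n) (pi_enum : coset_enum pi).
Variable rho : {lrmorphism A -> matalg B (nb_cosets_gt0 pi_enum)}.
Hypothesis rho_g : forall i, rho (g i) = coset_T q pi_enum hx i.
Hypothesis rho_t : forall p, rho (t p) = coset_D B zeta pi_enum p.
Local Notation cmap := (coset_map q qi dinv g t zeta pi al).
Local Notation Emu := (\sum_k E (col pi k)).

Let al_E := block_al_E pB_surj Y Z alE.

Lemma coset_iso_rho N : rho (cmap N) = N.
Proof.
apply: (rho_coset_map Z (block_gen_quad pB) (block_gen_far pB) (block_gen_braid pB)
  qiP d_gt0 Y rho_g rho_t al_E).
exact: (block_rho_al pB_surj Z alE rho_g rho_t).
Qed.

(** A generator multiplies the image of [cmap] on the left through its own matrix, so the case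
    [y = 1] propagates by left multiplications. *)
Lemma coset_iso_idem y : y * Emu = cmap (rho y).
Proof.
have al_hx := block_al_hx Y Z alE.
move: y; apply: A_ind => [||i x IH|p x IH].
- split=> [|c u v uE vE].
    by rewrite mul0r raddf0 coset_map0.
  by rewrite mulrDl -scalerAl uE vE -coset_mapZ -coset_mapD linearP.
- by rewrite mul1r rmorph1; exact/esym/(coset_map1 qiP d_gt0 Y Z pi al).
- by rewrite -mulrA IH (g_coset_map qiP Y Z pi_enum al_E al_hx) rmorphM /= rho_g.
- by rewrite -mulrA IH (t_coset_map qi Y Z pi al) rmorphM /= rho_t.
Qed.

Lemma coset_idem_comm y : Emu * y = y * Emu.
Proof.
move: y; apply: A_ind => [||i x IH|p x IH].
- split=> [|c u v uE vE]; first by rewrite mul0r mulr0.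
  by rewrite mulrDl mulrDr -scalerAl -scalerAr uE vE.
- by rewrite mul1r mulr1.
- by rewrite mulrA (coset_idem_g Y Z pi_enum) -mulrA IH mulrA.
- by rewrite mulrA (coset_idem_t Y Z) -mulrA IH mulrA.
Qed.

Lemma coset_map_idem N : Emu * cmap N = cmap N.
Proof.
rewrite -(coset_map1 qiP d_gt0 Y Z pi al).
by rewrite -(coset_mapM qiP d_gt0 Y Z pi_enum al_E) mul1mx.
Qed.

End CosetIso.

(** * The blocks of Y and FTL *)

Lemma morph_mul_ev (K : comNzRingType) (A B : algType K) (N : nat) (N_gt0 : (0 < N)%N)
  (rho : {lrmorphism A -> matalg B N_gt0}) x y k a :
  rho (x * y) *m ev k a = rho x *m (rho y *m ev k a).
Proof. by rewrite rmorphM /= matalgM -mulmxA. Qed.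

Lemma morph_add_ev (K : comNzRingType) (A B : algType K) (N : nat) (N_gt0 : (0 < N)%N)
  (rho : {lrmorphism A -> matalg B N_gt0}) x y (k : 'I_N) a :
  rho (x + y) *m ev k a = rho x *m ev k a + rho y *m ev k a.
Proof. by rewrite rmorphD /=; apply: mulmxDl. Qed.

Section SteinbergKill.
Variables (K : comNzRingType) (B A : algType K) (q dinv : K) (d n : nat).
Variables (zeta : 'I_d -> K) (Z : root_family dinv zeta) (d_gt0 : (0 < d)%N).
Variables (mu : Comp d n) (pi : 'I_(nb_cosets mu) -> 'S_n).
Hypothesis pi_enum : coset_enum pi.
Variable hx : 'I_n -> B.
Variables (g : 'I_n.-1 -> A) (t : 'I_n -> A).
Hypothesis Y : yokonuma_rels q d dinv g t.
Variable rho : {lrmorphism A -> matalg B (nb_cosets_gt0 pi_enum)}.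
Hypothesis rho_g : forall i, rho (g i) = coset_T q pi_enum hx i.
Hypothesis rho_t : forall p, rho (t p) = coset_D B zeta pi_enum p.
Hypothesis hx_steinberg : forall r r', r \in young_gens mu -> r' \in young_gens mu ->
  r' = r.+1 :> nat -> steinberg (hx (pos_lo r)) (hx (pos_lo r')) = 0.
Local Notation e := (idem_e d dinv t).

Lemma rho_steinberg (i j : 'I_n.-1) : j = i.+1 :> nat ->
  rho (e i * e j * steinberg (g i) (g j)) = 0.
Proof.
move=> ij; have [Ci Cj] := idem_e2_g d_gt0 Y Z ij.
have eE i1 k a : rho (e i1) *m ev k a =
    ev k ((col pi k (pos_lo i1) == col pi k (pos_hi i1))%:R *: a).
  rewrite idem_e_morph (_ : (fun p => _) = coset_D B zeta pi_enum); last exact/funext.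
  exact: idem_e_ev.
(* The idempotents are moved to the right, where they act first and leave only colorings that are
   constant on the three points. *)
rewrite (steinberg_comm Ci Cj); apply: mx_ev => k; rewrite [RHS]mul0mx.
rewrite !morph_mul_ev !eE.
have [ei|] := eqVneq (col pi k (pos_lo i)) (col pi k (pos_hi i)); last first.
  by rewrite scale0r ev0 mulmx0.
have [ej|] := eqVneq (col pi k (pos_lo j)) (col pi k (pos_hi j)); last first.
  by rewrite scale0r scaler0 ev0 mulmx0.
have [r rJ [rl rh xr]] := coset_xE pi_enum hx (congr1 val ei).
have [r' rJ' [rl' rh' xr']] := coset_xE pi_enum hx (congr1 val ej).
have gE i1 a : col pi k (pos_lo i1) = col pi k (pos_hi i1) ->
    rho (g i1) *m ev k a = ev k (coset_x pi hx k i1 * a).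
  by move=> eq; rewrite rho_g; apply: coset_rep_eq.
rewrite /steinberg !morph_add_ev !morph_mul_ev !(gE _ _ ei) !(gE _ _ ej) !(gE _ _ ei) !morph_mul_ev.
rewrite (gE _ _ ej) (gE _ _ ei) rmorph1 one_mul_ev !scale1r -!evD.
set x := coset_x _ _ _ i; set y := coset_x _ _ _ j.
have rr : r' = r.+1 :> nat.
  have hl : pos_lo j = pos_hi i by apply/val_inj; rewrite /= ij.
  by have /(congr1 val) : pos_lo r' = pos_hi r by rewrite rh rl' hl.
have : steinberg x y = 0 by rewrite /x /y xr xr'; apply: hx_steinberg.
by rewrite /steinberg !mulr1 -(mulrA x y x) => ->; rewrite ev0.
Qed.

End SteinbergKill.

Section Concrete.
Variables (F : numFieldType) (d n : nat) (d_gt0 : (0 < d)%N).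
Local Notation K := (laurent_ring F).
Local Notation q := (qvar F : K).
Local Notation qi := (qexp F (-1) : K).
Local Notation dinv := (lconst d%:R^-1 : K).
Local Notation dinvP := (laurent_dinvP F d_gt0).
Local Notation Yq := (Yq F n d_gt0).
Local Notation FTLq := (FTLq F n d_gt0).
Variables (zeta : 'I_d -> K) (Z : root_family dinv zeta).
Implicit Types (i : 'I_n.-1) (p : 'I_n).

Definition gY i : Yq := yg q dinvP i.
Definition tY p : Yq := yt q dinvP p.

Definition ftlM : {lrmorphism Yq -> FTLq} :=
  (qproj (ftl_proper q n dinvP) : {lrmorphism YH q n dinvP -> FTL q n dinvP}).
Local Notation gF := (fun i => ftlM (gY i)).
Local Notation tF := (fun p => ftlM (tY p)).

Lemma qvarK : q * qi = 1.
Proof.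
by apply/val_inj; rewrite /= -[X in X * _]expr1z -expfzDr ?tofrac_eq0 ?polyX_eq0.
Qed.

Lemma Yq_rels : yokonuma_rels q d dinv gY tY.
Proof. exact: yh_rels. Qed.

Lemma FTLq_rels : yokonuma_rels q d dinv gF tF.
Proof. exact: yokonuma_rels_morph Yq_rels. Qed.

Lemma Yq_ind (P : Yq -> Prop) : lin_closed P -> P 1 ->
  (forall i x, P x -> P (gY i * x)) -> (forall p x, P x -> P (tY p * x)) -> forall x, P x.
Proof. exact: yh_ind_left. Qed.

Lemma ftlM_surj y : exists x, ftlM x = y.
Proof. by exists (qrepr (X_proper := ftl_proper q n dinvP) y); apply: qreprK. Qed.

Lemma surj_ind (A A' : algType K) (h : {lrmorphism A -> A'}) (g : 'I_n.-1 -> A)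
  (t : 'I_n -> A) : (forall y, exists x, h x = y) ->
  (forall P : A -> Prop, lin_closed P -> P 1 -> (forall i x, P x -> P (g i * x)) ->
    (forall p x, P x -> P (t p * x)) -> forall x, P x) ->
  forall P : A' -> Prop, lin_closed P -> P 1 -> (forall i x, P x -> P (h (g i) * x)) ->
    (forall p x, P x -> P (h (t p) * x)) -> forall x, P x.
Proof.
move=> surj ind P [P0 lP] P1 Pg Pt y; have [x <-] := surj y.
apply: (ind (fun x => P (h x))) => [||i z Pz|p z Pz].
- by split=> [|c u v Pu Pv]; [rewrite raddf0 | rewrite linearP; apply: lP].
- by rewrite rmorph1.
- by rewrite rmorphM; apply: Pg.
- by rewrite rmorphM; apply: Pt.
Qed.

Lemma FTLq_ind (P : FTLq -> Prop) : lin_closed P -> P 1 ->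
  (forall i x, P x -> P (gF i * x)) -> (forall p x, P x -> P (tF p * x)) -> forall x, P x.
Proof. exact: surj_ind ftlM_surj Yq_ind P. Qed.

Lemma morph_ftl_rel (A A' : algType K) (h : {lrmorphism A -> A'}) (t : 'I_n -> A) x y i j :
  h (idem_e d dinv t i * idem_e d dinv t j * steinberg x y) =
  idem_e d dinv (fun p => h (t p)) i * idem_e d dinv (fun p => h (t p)) j *
  steinberg (h x) (h y).
Proof. by rewrite rmorphM rmorphM /= steinberg_morph !idem_e_morph. Qed.

Lemma FTLq_steinberg (i j : 'I_n.-1) : i = 0%N :> nat -> j = 1%N :> nat ->
  idem_e d dinv tF i * idem_e d dinv tF j * steinberg (gF i) (gF j) = 0.
Proof.
move=> i0 j1; have H := qproj_rel0 (ftl_proper q n dinvP) (FTLrel q dinvP i0 j1).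
exact: etrans (esym (morph_ftl_rel ftlM tY (gY i) (gY j) i j)) H.
Qed.

Variables (mu : Comp d n) (pi : 'I_(nb_cosets mu) -> 'S_n) (pi_enum : coset_enum pi).
Local Notation HT := (Htens F mu).
Local Notation TT := (TLmu F mu).
Local Notation J := (young_gens mu).
Local Notation N0 := (nb_cosets_gt0 pi_enum).
Definition idH : {lrmorphism HT -> HT} := idfun.
Local Notation hxH := (block_gen idH).
Local Notation hxT := (block_gen (tproj F mu)).

Lemma rhoY_exists : exists rho : {lrmorphism Yq -> matalg HT N0},
  (forall i, rho (gY i) = coset_T q pi_enum hxH i) /\
  (forall p, rho (tY p) = coset_D HT zeta pi_enum p).
Proof.
exact: (yh_lift dinvP (coset_rels Z pi_enum (block_gen_quad idH) (block_gen_far idH)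
  (block_gen_braid idH))).
Qed.

Lemma hxTE b (a : 'I_(part mu b).-1) :
  hxT (pos_lo (blk_gen a)) = tl_slot F mu b (tlp F mu b (hgen q a)).
Proof. by rewrite /block_gen htens_genE tproj_slot. Qed.

Lemma hxT_steinberg r r' : r \in J -> r' \in J -> r' = r.+1 :> nat ->
  steinberg (hxT (pos_lo r)) (hxT (pos_lo r')) = 0.
Proof.
move=> /young_blk_gen[b [a ->]] /young_blk_gen[b' [a' ->]] rr.
have bb : b = b'.
  by rewrite -(blk_gen_hi a) -(blk_gen_lo a'); congr blk; apply/val_inj; rewrite /= -rr.
subst b'; rewrite !hxTE.
have aa : a' = a.+1 :> nat by move: rr => /=; clear; lia.
have H := tl_steinberg qvarK aa.
have sl0 : tl_slot F mu b 0 = 0 by exact: raddf0.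
exact: etrans (esym (steinberg_morph (tl_slot F mu b) _ _)) (etrans (congr1 (tl_slot F mu b) H) sl0).
Qed.

Lemma rhoF_exists : exists rho : {lrmorphism FTLq -> matalg TT N0},
  (forall i, rho (gF i) = coset_T q pi_enum hxT i) /\
  (forall p, rho (tF p) = coset_D TT zeta pi_enum p).
Proof.
have [rho [rho_g rho_t]] := yh_lift dinvP (coset_rels Z pi_enum
  (block_gen_quad (tproj F mu)) (block_gen_far (tproj F mu)) (block_gen_braid (tproj F mu))).
have [|h hE] := @quotalg_lift K _ _ (ftl_proper q n dinvP) _ rho.
  move=> _ [i j i0 j1].
  apply: (rho_steinberg Z d_gt0 Yq_rels rho_g rho_t hxT_steinberg).
  by rewrite i0 j1.
exists h; split=> [i|p].
  exact: etrans (hE _) (rho_g i).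
exact: etrans (hE _) (rho_t p).
Qed.

End Concrete.

Lemma morph_comp_eq (K : comNzRingType) (A B B' C : algType K)
  (f : {lrmorphism B -> C}) (h : {lrmorphism A -> B})
  (f' : {lrmorphism B' -> C}) (h' : {lrmorphism A -> B'}) (G : A -> Prop) :
  (forall P : A -> Prop, lin_closed P -> P 1 ->
    (forall a x, G a -> P x -> P (a * x)) -> forall x, P x) ->
  (forall a, G a -> f (h a) = f' (h' a)) -> forall x, f (h x) = f' (h' x).
Proof.
move=> ind fG; apply: ind => [||a x Ga E]; last by rewrite !rmorphM /= E fG.
- by split=> [|c u v uE vE]; rewrite ?raddf0 // !linearP /= uE vE.
- by rewrite !rmorph1.
Qed.

Lemma corner_morph (K : comNzRingType) (A A' : algType K) (h : {lrmorphism A -> A'}) e x :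
  h (corner e (1 - e) x) = corner (h e) (1 - h e) (h x).
Proof. by rewrite /corner !rmorphB /= rmorphM rmorph1. Qed.

Section PhiMap.
Variables (F : numFieldType) (d n : nat) (d_gt0 : (0 < d)%N).
Local Notation K := (laurent_ring F).
Local Notation q := (qvar F : K).
Local Notation qi := (qexp F (-1) : K).
Local Notation dinv := (lconst d%:R^-1 : K).
Local Notation Yq := (Yq F n d_gt0).
Local Notation FTLq := (FTLq F n d_gt0).
Variables (xi : 'I_d -> F) (xi_inj : injective xi).
Local Notation zeta := (fun c => lconst (xi c) : K).
Hypothesis Z : root_family dinv zeta.
Variables (mu : Comp d n) (pi : 'I_(nb_cosets mu) -> 'S_n) (pi_enum : coset_enum pi).
Local Notation HT := (Htens F mu).
Local Notation TT := (TLmu F mu).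
Local Notation J := (young_gens mu).
Local Notation N0 := (nb_cosets_gt0 pi_enum).
Local Notation gY := (@gY F d n d_gt0).
Local Notation tY := (@tY F d n d_gt0).
Local Notation ftlM := (@ftlM F d n d_gt0).
Local Notation gF := (fun i => ftlM (gY i)).
Local Notation tF := (fun p => ftlM (tY p)).
Local Notation YR := (Yq_rels F n d_gt0).
Local Notation FR := (FTLq_rels F n d_gt0).
Local Notation EY := (color_idem dinv tY zeta).
Local Notation EF := (color_idem dinv tF zeta).
Local Notation hxH := (block_gen (idH F mu)).
Local Notation hxT := (block_gen (tproj F mu)).
Implicit Types (k l : 'I_(nb_cosets mu)).

Let alY_ex : exists al : {lrmorphism HT -> Yq}, forall r, r \in J ->
  al (hxH (pos_lo r)) = corner (EY (blk mu)) (1 - EY (blk mu)) (gY r).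
Proof. exact: corner_lift YR Z mu. Qed.
Definition alY := sval (cid alY_ex).
Let alYE := svalP (cid alY_ex).

Let alF_ex : exists al : {lrmorphism TT -> FTLq}, forall r, r \in J ->
  al (hxT (pos_lo r)) = corner (EF (blk mu)) (1 - EF (blk mu)) (gF r).
Proof.
have st := steinberg_color (qvarK F) d_gt0 FR Z (@FTLq_steinberg F d n d_gt0).
exact: (corner_lift_tl FR Z mu st).
Qed.
Definition alF := sval (cid alF_ex).
Let alFE := svalP (cid alF_ex).

Lemma ftlM_alY x : ftlM (alY x) = alF (tproj F mu x).
Proof.
pose G (a : HT) := exists2 r, r \in J & a = htens_gen F mu (pos_lo r).
refine (morph_comp_eq (f := ftlM) (h := alY) (f' := alF) (h' := tproj F mu) (G := G) _ _ x).
  by move=> P lP P1 Pg; apply: htens_ind => // r y rJ; apply: Pg; exists r.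
move=> _ [r rJ ->]; apply: etrans (congr1 ftlM (alYE rJ)) _.
apply: etrans (corner_morph ftlM _ _) _; apply: etrans (esym (alFE rJ)).
by have -> : ftlM (EY (blk mu)) = EF (blk mu) := color_idem_morph ftlM _ _ _ _.
Qed.

Definition rhoY := sval (cid (rhoY_exists d_gt0 Z pi_enum)).
Let rhoY_g := (svalP (cid (rhoY_exists d_gt0 Z pi_enum))).1.
Let rhoY_t := (svalP (cid (rhoY_exists d_gt0 Z pi_enum))).2.
Definition rhoF := sval (cid (rhoF_exists d_gt0 Z pi_enum)).
Let rhoF_g := (svalP (cid (rhoF_exists d_gt0 Z pi_enum))).1.
Let rhoF_t := (svalP (cid (rhoF_exists d_gt0 Z pi_enum))).2.

(** Explicit candidates, [phiY] for [Phi] and [phi0] for [phi]; [PhiE] and [phiE] identify them with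
    the chosen maps, the first one through [Hiso]. *)
Definition phiY (N : 'M[HT]_(nb_cosets mu)) : Yq := coset_map q qi dinv gY tY zeta pi alY N.
Definition phi0 (N : 'M[TT]_(nb_cosets mu)) : FTLq := coset_map q qi dinv gF tF zeta pi alF N.

Let idH_surj (y : HT) : exists x, idH F mu x = y. Proof. by exists y. Qed.

Lemma rhoY_phiY N : rhoY (phiY N) = N.
Proof. exact: (coset_iso_rho idH_surj (qvarK F) d_gt0 YR Z alYE rhoY_g rhoY_t). Qed.

Lemma rhoF_phi0 N : rhoF (phi0 N) = N.
Proof. exact: (coset_iso_rho (@tproj_surj F d n mu) (qvarK F) d_gt0 FR Z alFE rhoF_g rhoF_t). Qed.

Lemma E_E k : E_ d_gt0 xi pi k = EY (col pi k).
Proof.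
rewrite /E_ /idem_chi /color_idem; apply: eq_bigr => p _; rewrite /root_proj /chi /act_chi.
by rewrite chi1E.
Qed.

Lemma EmuE : Emu d_gt0 xi pi = \sum_k EY (col pi k).
Proof. by rewrite /Emu; apply: eq_bigr => k _; apply: E_E. Qed.

Lemma phiY_rhoY y : y * Emu d_gt0 xi pi = phiY (rhoY y).
Proof.
rewrite EmuE; exact: (coset_iso_idem idH_surj (qvarK F) d_gt0 YR Z (@Yq_ind F d n d_gt0)
  alYE rhoY_g rhoY_t).
Qed.

Lemma Emu_comm y : Emu d_gt0 xi pi * y = y * Emu d_gt0 xi pi.
Proof. rewrite EmuE; exact: (coset_idem_comm YR Z (@Yq_ind F d n d_gt0) pi_enum). Qed.

Lemma phiY_Emu N : Emu d_gt0 xi pi * phiY N = phiY N.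
Proof. rewrite EmuE; exact: (coset_map_idem idH_surj (qvarK F) d_gt0 YR Z alYE pi_enum). Qed.

Lemma ftlM_Emu : ftlM (Emu d_gt0 xi pi) = \sum_k EF (col pi k).
Proof.
by rewrite EmuE raddf_sum; apply: eq_bigr => k _; apply: (color_idem_morph ftlM).
Qed.

Lemma phi0_rhoF y : y * ftlM (Emu d_gt0 xi pi) = phi0 (rhoF y).
Proof.
rewrite ftlM_Emu; exact: (coset_iso_idem (@tproj_surj F d n mu) (qvarK F) d_gt0 FR Z
  (@FTLq_ind F d n d_gt0) alFE rhoF_g rhoF_t).
Qed.

Lemma phi0_Emu N : ftlM (Emu d_gt0 xi pi) * phi0 N = phi0 N.
Proof.
rewrite ftlM_Emu.
exact: (coset_map_idem (@tproj_surj F d n mu) (qvarK F) d_gt0 FR Z alFE pi_enum).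
Qed.

Lemma phi0M M N : phi0 (M *m N) = phi0 M * phi0 N.
Proof.
exact: (coset_mapM (qvarK F) d_gt0 FR Z pi_enum
  (block_al_E (@tproj_surj F d n mu) FR Z alFE)).
Qed.

Lemma ftlM_phiY N : ftlM (phiY N) = phi0 (map_mx (tproj F mu) N).
Proof. exact: coset_map_morph ftlM_alY N. Qed.

Lemma rhoY_color f k a :
  rhoY (EY f) *m ev k a = ev k ([forall p, f p == col pi k p]%:R *: a).
Proof.
exact: (rho_color_idem Z (block_gen_quad (idH F mu)) (block_gen_far (idH F mu))
  (block_gen_braid (idH F mu)) rhoY_t).
Qed.

Lemma rhoF_color f k a :
  rhoF (EF f) *m ev k a = ev k ([forall p, f p == col pi k p]%:R *: a).
Proof.
exact: (rho_color_idem Z (block_gen_quad (tproj F mu)) (block_gen_far (tproj F mu))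
  (block_gen_braid (tproj F mu)) rhoF_t).
Qed.

Lemma rhoY_gw (w : 'S_n) l :
  exists2 x, rhoY (wprod gY w) *m ev l 1 = ev (pact pi_enum w l) x &
  Hiso F mu x = (qexp F (psi_exponent pi (pact pi_enum w l) l w) : K) *:
    Hw F (conj_perm pi (pact pi_enum w l) l w).
Proof.
exact: (psi_column d_gt0 YR (@hgen_far K q n) (@hgen_braid K q n) (@Hiso_gen F d n mu)
  rhoY_g w l).
Qed.

End PhiMap.

Lemma map_mx_morph_lin (K : comNzRingType) (A B C : algType K) (N : nat) (N_gt0 : (0 < N)%N)
  (iota : {lrmorphism B -> C}) (rho : {lrmorphism A -> matalg B N_gt0}) c x y :
  map_mx iota (rho (c *: x + y)) =
  map_mx (fun u => c *: u) (map_mx iota (rho x)) + map_mx iota (rho y).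
Proof.
by rewrite linearP; apply/matrixP => i j; rewrite !mxE linearP.
Qed.

Lemma mul_linl (K : comNzRingType) (A : algType K) (e : A) c x y :
  e * (c *: x + y) = c *: (e * x) + e * y.
Proof. by rewrite mulrDr -scalerAr. Qed.

(** * Identification of [Psi], [Phi] and [phi] *)

Section PhiUnique.
Variables (F : numFieldType) (d n : nat) (d_gt0 : (0 < d)%N).
Local Notation K := (laurent_ring F).
Local Notation dinv := (lconst d%:R^-1 : K).
Local Notation Yq := (Yq F n d_gt0).
Local Notation FTLq := (FTLq F n d_gt0).
Variables (xi : 'I_d -> F) (xi_inj : injective xi).
Local Notation zeta := (fun c => lconst (xi c) : K).
Hypothesis Z : root_family dinv zeta.
Variables (mu : Comp d n) (pi : 'I_(nb_cosets mu) -> 'S_n) (pi_enum : coset_enum pi).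
Local Notation HT := (Htens F mu).
Local Notation TT := (TLmu F mu).
Local Notation gY := (@gY F d n d_gt0).
Local Notation tY := (@tY F d n d_gt0).
Local Notation ftlM := (@ftlM F d n d_gt0).
Local Notation EY := (color_idem dinv tY zeta).
Local Notation rhoY := (rhoY d_gt0 Z pi_enum).
Local Notation phiY := (phiY d_gt0 Z pi).
Local Notation phi0 := (phi0 d_gt0 Z pi).
Local Notation Em := (Emu d_gt0 xi pi).
Local Notation act := (pact pi_enum).
Implicit Types (k l : 'I_(nb_cosets mu)).

Let PsiM (y : Yq) : 'M[Hq F n]_(nb_cosets mu) := map_mx (Hiso F mu) (rhoY y).

Lemma rhoY_E_gw k (w : 'S_n) l : rhoY (E_ d_gt0 xi pi k * wprod gY w) *m ev l 1 =
  if k == act w l then rhoY (wprod gY w) *m ev l 1 else 0.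
Proof.
rewrite E_E morph_mul_ev; have [x -> _] := rhoY_gw d_gt0 Z pi_enum w l.
rewrite rhoY_color; case: eqP => [<-|ne].
  by rewrite (_ : [forall p, _]) ?scale1r //; apply/forallP => p.
rewrite (_ : [forall p, _] = false) ?scale0r ?ev0 //; apply/negbTE/negP => /forallP E.
by apply: ne; apply: (col_inj pi_enum) => p; apply/eqP.
Qed.

Lemma chi_pact k l (w : 'S_n) : act_chi w (chi xi pi l) = chi xi pi k -> k = act w l.
Proof.
move=> E; apply: (col_inj pi_enum) => p; rewrite col_pact; apply: xi_inj.
by have := congr1 (@^~ p) E; rewrite /act_chi /chi /act_chi !chi1E => ->.
Qed.

Lemma is_Psi_PsiM : is_Psi xi pi PsiM.
Proof.
split=> [c x y _ _|k l w /chi_pact kE].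
  exact: map_mx_morph_lin (Hiso F mu) rhoY c x y.
apply/matrixP => i j; rewrite !mxE.
have wE : ygw (qvar F : K) (laurent_dinvP F d_gt0) w = wprod gY w by [].
have := congr1 (fun v : 'cV[HT]_(nb_cosets mu) => v i 0) (rhoY_E_gw k w j).
rewrite mulmx_ev mulr1 wE => ->.
case: (eqVneq j l) => [->|jl].
  rewrite -kE eqxx andbT; have [x -> xE] := rhoY_gw d_gt0 Z pi_enum w l.
  rewrite -kE in xE *; rewrite mxE raddfMn /= xE.
  by case: (i == k); rewrite ?mulr1 ?mulr0.
rewrite andbF mulr0; case: eqP => [E|_]; last by rewrite mxE raddf0.
case/negP: jl; apply/eqP; rewrite -(pact1 pi_enum j) -(pact1 pi_enum l) -(mulgV w).
by rewrite -[(w * w^-1)%g]/(pcomp w^-1%g w) !pact_comp -kE -E.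
Qed.

Lemma Yq_color_span y : color_span dinv gY tY zeta y.
Proof.
have YR := Yq_rels F n d_gt0.
move: y; apply: Yq_ind; first exact: color_span_lin.
- exact: (color_span1 d_gt0 YR Z).
- by move=> i x; apply: (color_span_g YR Z).
- by move=> p x; apply: (color_span_t YR Z).
Qed.

Lemma EmuY_Emu y : EmuY xi pi (Em * y : Yq).
Proof. by exists y. Qed.

Lemma Emu_col k : Em * EY (col pi k) = EY (col pi k).
Proof.
have YR := Yq_rels F n d_gt0.
rewrite EmuE mulr_suml (bigD1 k) //= big1 ?addr0 => [|l lk].
  exact: (color_idem_idem YR Z).
have [p np] : exists p, col pi l p != col pi k p.
  apply/existsP; rewrite -negb_forall; apply: contra lk => /forallP lf.
  by apply/eqP/(col_inj pi_enum) => p; apply/eqP.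
exact: (color_idem_orth YR Z np).
Qed.

Lemma Emu_other f : (forall k, f <> col pi k) -> Em * EY f = 0.
Proof.
have YR := Yq_rels F n d_gt0.
move=> nf; rewrite EmuE mulr_suml; apply: big1 => l _.
have [p np] : exists p, col pi l p != f p.
  apply/existsP; rewrite -negb_forall; apply/negP => /forallP lf.
  by apply: (nf l); apply/funext => p; rewrite (eqP (lf p)).
exact: (color_idem_orth YR Z np).
Qed.

(** The products of a color idempotent and some [g_w] span Y. Multiplication by [E_mu] either kills
    the idempotent or fixes it, and in the latter case the value is the prescribed one. *)
Lemma is_Psi_unique f y : is_Psi xi pi f -> f (Em * y) = PsiM (Em * y).
Proof.
move=> [fl fb]; have [Pl Pb] := is_Psi_PsiM.
have f0 : f 0 = 0.
  have := fl (-1) _ _ (EmuY_Emu 0) (EmuY_Emu 0).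
  rewrite mulr0 scaler0 addr0 => ->; apply/matrixP => i j; rewrite !mxE.
  by rewrite scaleN1r addNr.
have P0 : PsiM 0 = 0 by rewrite /PsiM raddf0; apply/matrixP => i j; rewrite !mxE raddf0.
pose P (y : Yq) := f (Em * y) = PsiM (Em * y).
refine (@Yq_color_span y P _ _) => [|h w]; rewrite /P.
  split=> [|c u v uE vE]; first by rewrite mulr0 f0 P0.
  have fE := fl c _ _ (EmuY_Emu u) (EmuY_Emu v).
  have PE := Pl c _ _ (EmuY_Emu u) (EmuY_Emu v).
  have uv := congr2 (fun M N => scale_mat c M + N) (uE : f _ = _) (vE : f _ = _).
  by rewrite mul_linl; exact: etrans fE (etrans uv (esym PE)).
rewrite mulrA; case: (pselect (exists k, h = col pi k)) => [[k ->]|nk]; last first.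
  by rewrite Emu_other ?mul0r ?f0 ?P0 // => k hk; apply: nk; exists k.
rewrite Emu_col -E_E.
pose l := act w^-1%g k.
have kl : act_chi w (chi xi pi l) = chi xi pi k.
  apply/funext => p; rewrite /act_chi /chi /act_chi !chi1E; congr (xi _).
  by rewrite -!/(col pi _ _) /l col_pact invgK permKV.
exact: etrans (fb k l w kl) (esym (Pb k l w kl)).
Qed.

Lemma PsiE y : Psi xi pi (Em * y : Yq) = PsiM (Em * y).
Proof. by apply: is_Psi_unique; exact: (xgetI (fun=> 0) is_Psi_PsiM). Qed.

(** [Phi] picks some preimage in E_mu Y. Any such [y] equals [phiY (rhoY y)], and [rhoY y] is
    determined by its image under the injective [Hiso]. *)
Lemma PhiE N : Phi d_gt0 xi pi (map_mx (Hiso F mu) N) = phiY N.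
Proof.
have S : [set y : Yq | EmuY xi pi y /\ Psi xi pi y = map_mx (Hiso F mu) N] (phiY N).
  split; first by exists (phiY N) => //; apply: (phiY_Emu d_gt0 Z pi_enum).
  by rewrite -(phiY_Emu d_gt0 Z pi_enum) PsiE (phiY_Emu d_gt0 Z pi_enum) /PsiM rhoY_phiY.
have [[z _ zE] zP] := xgetI 0 S; rewrite -/(Phi d_gt0 xi pi _) in zE zP.
set y := Phi _ _ _ _ in zE zP *.
have yE : Em * y = y.
  rewrite -zE [X in _ * X](Emu_comm Z pi_enum) (phiY_rhoY Z pi_enum).
  by rewrite (phiY_Emu d_gt0 Z pi_enum) -(phiY_rhoY Z pi_enum) (Emu_comm Z pi_enum).
rewrite -yE (Emu_comm Z pi_enum) (phiY_rhoY Z pi_enum); congr phiY.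
move: zP; rewrite -{1}yE PsiE yE /PsiM => /matrixP H; apply/matrixP => i j.
by have := H i j; rewrite !mxE => /(Hiso_inj pi_enum).
Qed.

Let pick_mx (A B : Type) (h : A -> B) (P : B -> Prop) (M : 'M[B]_(nb_cosets mu)) :
  (forall y, P y -> exists x, h x = y) -> (forall i j, P (M i j)) ->
  exists N, M = map_mx h N.
Proof.
move=> surj PM; pose N := \matrix_(i, j) sval (cid (surj _ (PM i j))).
by exists N; apply/matrixP => i j; rewrite !mxE; case: cid.
Qed.

Lemma map_rho (N : 'M[HT]_(nb_cosets mu)) :
  map_mx (@rho F d n mu) (map_mx (Hiso F mu) N) = map_mx (tproj F mu) N.
Proof. by apply/matrixP => i j; rewrite !mxE (rhoE pi_enum). Qed.

Lemma is_phi_phi0 : is_phi xi pi phi0.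
Proof.
have FR := FTLq_rels F n d_gt0.
split=> [M|c M N||M N|M MH].
- by exists (phi0 M); rewrite // -[RHS](phi0_Emu d_gt0 Z pi_enum).
- exact: etrans (coset_mapD _ _ _ _ _ _ _ _ _ _)
    (congr1 (+%R^~ _) (coset_mapZ _ _ _ _ _ _ _ _ _ _)).
- exact: etrans (coset_map1 (qvarK F) d_gt0 FR Z pi _) (esym (ftlM_Emu d_gt0 xi pi)).
- exact: phi0M.
- have [N ->] := pick_mx (@Hmu_Hiso F d n mu) MH.
  by rewrite map_rho PhiE; apply/esym/(ftlM_phiY d_gt0 Z pi).
Qed.

(** The clause of [is_phi] on matrices with entries in H^mu determines every value, because each
    matrix over TL^mu lifts to the tensor product of the Hecke algebras, whose image in H_n lies in
    H^mu. *)
Lemma phiE T : phi d_gt0 xi pi T = phi0 T.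
Proof.
have [_ _ _ _ P5] := is_phi_phi0.
have [_ _ _ _ Q5] := xgetI (fun=> 0) is_phi_phi0; rewrite -/(phi d_gt0 xi pi) in Q5.
have [N ->] := pick_mx (fun y _ => tproj_surj y) (fun i j => I : (fun=> True) (T i j)).
have NH i j : @Hmu F d n mu (map_mx (Hiso F mu) N i j) by rewrite mxE; apply: Hiso_Hmu.
by rewrite -map_rho Q5 // P5.
Qed.

End PhiUnique.

(** * Decomposition into blocks *)

Section Roots.
Variables (F : numFieldType) (d : nat) (xi : 'I_d -> F).
Hypotheses (d_gt0 : (0 < d)%N) (xi_inj : injective xi) (xi_root : forall i, xi i ^+ d = 1).

Let d_neq0 : d%:R != 0 :> F. Proof. by rewrite Num.Theory.pnatr_eq0 -lt0n. Qed.

Lemma root_orth a b :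
  d%:R^-1 * (\sum_(s < d) xi a ^+ s * xi b ^+ (d - s)) = (a == b)%:R.
Proof.
case: (eqVneq a b) => [->|ab].
  rewrite (eq_bigr (fun=> 1)) => [|s _]; last first.
    by rewrite -exprD subnKC ?xi_root // ltnW.
  by rewrite sumr_const card_ord mulVf.
have ne : xi b - xi a != 0 by rewrite subr_eq0 (inj_eq xi_inj) eq_sym.
have -> : \sum_(s < d) xi a ^+ s * xi b ^+ (d - s) =
    xi b * (\sum_(s < d) xi b ^+ (d.-1 - s) * xi a ^+ s).
  rewrite mulr_sumr; apply: eq_bigr => s _; rewrite mulrA -exprS mulrC; congr (_ ^+ _ * _).
  by move: (ltn_ord s); clear; lia.
have /eqP := subrXX (xi b) (xi a) d.
by rewrite !xi_root subrr eq_sym mulf_eq0 (negPf ne) /= => /eqP->; rewrite !mulr0.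
Qed.

Lemma root_dual (s : 'I_d) : d%:R^-1 * (\sum_c xi c ^+ s) = (s == 0%N :> nat)%:R.
Proof.
(* [root_orth] says that [Q] is a right inverse of [P]. A right inverse of a square matrix is also a
   left inverse, and the row of index 0 of that second product is the claim. *)
pose P : 'M[F]_d := \matrix_(a, s) (d%:R^-1 * xi a ^+ s).
pose Q : 'M[F]_d := \matrix_(s, b) xi b ^+ (d - s).
have PQ : P *m Q = 1%:M.
  apply/matrixP => a b; rewrite !mxE -root_orth mulr_sumr.
  by apply: eq_bigr => r _; rewrite !mxE mulrA.
have /matrixP/(_ (Ordinal d_gt0) s) := mulmx1C PQ.
rewrite !mxE -val_eqE eq_sym /= => <-; rewrite mulr_sumr; apply: eq_bigr => c _.
by rewrite !mxE subn0 xi_root mul1r.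
Qed.

Lemma root_family_roots :
  root_family (lconst d%:R^-1 : laurent_ring F) (fun c => lconst (xi c) : laurent_ring F).
Proof.
split=> [c|a b|s].
- by rewrite -rmorphXn xi_root rmorph1.
- rewrite -(rmorph_nat (@lconst F)) -root_orth rmorphM rmorph_sum; congr (_ * _).
  by apply: eq_bigr => s _; rewrite rmorphM !rmorphXn.
- rewrite -(rmorph_nat (@lconst F)) -root_dual rmorphM rmorph_sum; congr (_ * _).
  by apply: eq_bigr => c _; rewrite rmorphXn.
Qed.

End Roots.

Section Colorings.
Variables (d n : nat).
Implicit Types (f : 'I_n -> 'I_d) (mu : Comp d n) (c : 'I_d).

Let cnt f c : nat := (\sum_p (f p == c))%N.

Let cnt_perm f c (w : 'S_n) : cnt (fun p => f (w p)) c = cnt f c.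
Proof. by rewrite /cnt [RHS](reindex_inj (@perm_inj _ w)). Qed.

Let cnt_sum f : (\sum_c cnt f c = n)%N.
Proof.
rewrite exchange_big -[RHS]card_ord -sum1_card; apply: eq_bigr => p _.
by rewrite (bigD1 (f p)) //= eqxx big1 // => c; rewrite eq_sym => /negPf->.
Qed.

Let cnt_le f c : (cnt f c < n.+1)%N.
Proof. by rewrite ltnS -[leqRHS](cnt_sum f) (bigD1 c) //= leq_addr. Qed.

Let cnt_blk mu c : cnt (blk mu) c = part mu c.
Proof.
transitivity (\sum_(psum mu c <= p < psum mu c.+1) 1)%N; last first.
  by rewrite sum_nat_const_nat muln1 psumS addKn.
rewrite (big_nat_widen _ _ n) ?psum_le_n // (big_nat_widenl _ 0) // big_mkord /cnt.
rewrite [RHS]big_mkcond; apply: eq_bigr => p _ /=.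
have -> : (blk mu p == c) = (psum mu c <= p < psum mu c.+1)%N.
  by apply/eqP/idP => [<-|/blk_unique //]; apply: blkP.
by rewrite andbC; case: andP.
Qed.

(** [mu] records how often each color is used; two colorings with the same counts differ by a
    permutation of the points. *)
Lemma color_blk f : exists mu (w : 'S_n), forall p, f p = blk mu (w^-1%g p).
Proof.
pose m : {ffun 'I_d -> 'I_n.+1} := [ffun c => Ordinal (cnt_le f c)].
have mP : (\sum_i m i == n)%N.
  by rewrite -[X in _ == X](cnt_sum f); apply/eqP/eq_bigr => c _; rewrite ffunE.
pose mu : Comp d n := exist _ m mP.
have cE c : cnt f c = cnt (blk mu) c by rewrite cnt_blk /part /= ffunE.
have countE h c : count_mem c [seq h p | p <- enum 'I_n] = cnt h c.
  rewrite count_map -sum1_count big_enum_cond big_mkcond /=.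
  by apply: eq_bigr => p _; case: (h p == c).
have : perm_eq [tuple f p | p < n] [tuple blk mu p | p < n].
  by apply/allP => c _ /=; rewrite !countE cE.
case/tuple_permP => w fw; exists mu, w^-1%g => p; rewrite invgK.
have /(congr1 (fun s => tnth s p)) := val_inj fw; by rewrite !tnth_mktuple.
Qed.

Variables (pi : forall mu : Comp d n, 'I_(nb_cosets mu) -> 'S_n).
Arguments pi mu _ : clear implicits.
Hypothesis pi_enum : forall mu : Comp d n, coset_enum (pi mu).

Lemma color_surj f : exists mu k, f = col (pi mu) k.
Proof.
have [mu [w fw]] := color_blk f; have [k /forallP kw] := col_surj (pi_enum mu) w.
by exists mu, k; apply/funext => p; rewrite fw (eqP (kw p)).
Qed.

Lemma col_comp mu mu' k k' : col (pi mu) k = col (pi mu') k' -> mu = mu'.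
Proof.
move=> E; apply/val_inj/ffunP => c; apply/val_inj; rewrite /= -/(part mu c) -/(part mu' c).
have H m l : cnt (col (pi m) l) c = part m c by rewrite -cnt_blk (cnt_perm _ _ (pi m l)^-1%g).
by rewrite -!(H _ k) -!(H _ k') E H.
Qed.

End Colorings.

(** * A basis assembled from matrix blocks *)

Section BlockBasis.
Variables (K : comNzRingType) (V : lmodType K) (M : finType) (m : M -> nat).
Variables (B : M -> algType K) (J : M -> finType) (b : forall mu, J mu -> B mu).
Variables (phi : forall mu, 'M[B mu]_(m mu) -> V) (rho : forall mu, V -> 'M[B mu]_(m mu)).
Hypothesis phi_lin : forall mu (c : K) N N',
  phi (map_mx (fun x : B mu => c *: x) N + N') = c *: phi N + phi N'.
Hypothesis rho_lin : forall mu c u v,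
  rho mu (c *: u + v) = map_mx (fun x : B mu => c *: x) (rho mu u) + rho mu v.
Hypothesis phiK : forall mu N, rho mu (phi N) = N.
Hypothesis phi_ne : forall mu mu' (N : 'M[B mu']_(m mu')), mu != mu' -> rho mu (phi N) = 0.
Hypothesis phi_sum : forall v, v = \sum_mu phi (rho mu v).
Hypothesis b_spans : forall mu, spans (fun x : B mu => exists f, x = b f).
Hypothesis b_free : forall mu, is_free (@b mu).

Definition block_index : finType := {mu : M & ('I_(m mu) * 'I_(m mu) * J mu)%type}.
Definition block_family (x : block_index) : V :=
  phi (b (tagged x).2 *: delta_mx (tagged x).1.1 (tagged x).1.2).

Let phiD mu (N N' : 'M[B mu]_(m mu)) : phi (N + N') = phi N + phi N'.
Proof.
rewrite -[phi N]scale1r -phi_lin; congr (phi (_ + _)).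
by apply/matrixP => i j; rewrite !mxE scale1r.
Qed.

Let phi0 mu : phi (0 : 'M[B mu]_(m mu)) = 0.
Proof. by apply: (addrI (phi (0 : 'M[B mu]_(m mu)))); rewrite -phiD !addr0. Qed.

Lemma block_family_spans : spans (fun v => exists x, v = block_family x).
Proof.
move=> P lP Pe v; rewrite (phi_sum v); apply: lin_closed_sum => // mu _.
rewrite [rho mu v]matrix_sum_delta.
have PD N N' : P (phi N) -> P (phi N') -> P (phi (N + N' : 'M[B mu]_(m mu))).
  by move=> PN PN'; rewrite phiD; apply: lin_closedD.
have P0 : P (phi (0 : 'M[B mu]_(m mu))) by rewrite phi0; case: lP.
apply: (big_ind (fun N => P (phi N))) => // k _; apply: (big_ind (fun N => P (phi N))) => // l _.
apply: (b_spans (mu := mu) (P := fun x => P (phi (x *: delta_mx k l)))) => [|_ [f ->]].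
  split=> [|c x y Px Py]; first by rewrite scale0r.
  have -> : (c *: x + y) *: delta_mx k l =
      map_mx (fun x => c *: x) (x *: delta_mx k l) + y *: delta_mx k l :> 'M[B mu]_(m mu).
    by apply/matrixP => i j; rewrite !mxE mulrDl scalerAl.
  by rewrite phi_lin; case: lP => _; apply.
by apply: Pe; exists (Tagged (fun mu => ('I_(m mu) * 'I_(m mu) * J mu)%type) (k, l, f)).
Qed.

(** Applying [rho mu] kills the other blocks, and the entry at [(k, l)] leaves a relation between
    the basis elements of [B mu]. *)
Lemma block_family_free : is_free block_family.
Proof.
move=> c c0 [mu [[k l] f]].
pose L v := rho mu v k l.
have Llin a u v : L (a *: u + v) = a *: L u + L v by rewrite /L rho_lin !mxE.
have L0 : L 0 = 0.
  by have := Llin (-1) 0 0; rewrite scaler0 addr0 => ->; rewrite scaleN1r addNr.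
have LS : L (\sum_x c x *: block_family x) = \sum_x c x *: L (block_family x).
  by apply: (big_rec2 (fun x y => L x = y)) => // x u v _ <-; apply: Llin.
pose T mu := ('I_(m mu) * 'I_(m mu) * J mu)%type.
pose G (mu' : M) (y : T mu') := c (Tagged T y) *: L (block_family (Tagged T y)).
have SG : \sum_x c x *: L (block_family x) = \sum_mu' \sum_(y : T mu') G mu' y.
  rewrite (sig_big_dep _ _ (fun mu' (y : T mu') => G mu' y)) /=.
  by apply: eq_big => // -[mu' y] _.
move: LS; rewrite c0 L0 SG (bigD1 mu) //= [X in _ + X]big1 ?addr0 => [S0|mu' ne]; last first.
  apply: big1 => y _; rewrite /G /L /block_family /= phi_ne 1?eq_sym // mxE.
  by rewrite scaler0.
have GE (y : T mu) : G mu y =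
    c (Tagged T y) *: (b y.2 *+ ((k == y.1.1) && (l == y.1.2))).
  by rewrite /G /L /block_family /= phiK !mxE mulr_natr.
have S1 : \sum_(y : T mu) G mu y = \sum_f' c (Tagged T (k, l, f')) *: b f'.
  rewrite (eq_bigr _ (fun y _ => GE y)).
  rewrite (eq_bigr (fun y : T mu => c (Tagged T (y.1, y.2)) *:
    (b y.2 *+ ((k == y.1.1) && (l == y.1.2))))) => [|[y1 y2] _ //].
  rewrite -(pair_bigA _ (fun kl f' => c (Tagged T (kl, f')) *:
    (b f' *+ ((k == kl.1) && (l == kl.2))))) /=.
  rewrite (bigD1 (k, l)) //= [X in _ + X]big1 ?addr0.
    by apply: eq_bigr => f' _; rewrite !eqxx.
  move=> [k' l'] ne; apply: big1 => f' _ /=.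
  by rewrite (_ : _ && _ = false) ?scaler0 //; apply: contraNF ne => /andP[/eqP-> /eqP->].
by apply: (b_free (c := fun f' => c (Tagged T (k, l, f')))); rewrite -S1 -S0.
Qed.

Lemma card_block_index : #|block_index| = (\sum_mu m mu ^ 2 * #|J mu|)%N.
Proof.
rewrite card_tagged sumnE big_map big_enum /=; apply: eq_bigr => mu _.
by rewrite !card_prod !card_ord mulnn.
Qed.

End BlockBasis.

Lemma morph_mul0 (K : comNzRingType) (A B : algType K) (f : {lrmorphism A -> B}) x y :
  f x = 0 -> f (x * y) = 0.
Proof. by rewrite rmorphM /= => ->; rewrite mul0r. Qed.

Lemma mul_morph_sum (K : comNzRingType) (A B : algType K) (f : {lrmorphism A -> B})
  (I : finType) (x : I -> A) v : \sum_i x i = 1 -> \sum_i v * f (x i) = v.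
Proof. by move=> x1; rewrite -mulr_sumr -raddf_sum x1 /= rmorph1 mulr1. Qed.

Section FTLBasis.
Variables (F : numFieldType) (d n : nat) (d_gt0 : (0 < d)%N).
Local Notation K := (laurent_ring F).
Local Notation q := (qvar F : K).
Local Notation FTLq := (FTLq F n d_gt0).
Variables (xi : 'I_d -> F) (xi_inj : injective xi) (xi_root : forall i, xi i ^+ d = 1).
Variables (pi : forall mu : Comp d n, 'I_(nb_cosets mu) -> 'S_n).
Arguments pi mu _ : clear implicits.
Hypothesis pi_enum : forall mu : Comp d n, coset_enum (pi mu).
Local Notation ftlM := (@ftlM F d n d_gt0).

Let Z := root_family_roots d_gt0 xi_inj xi_root.
Local Notation rho mu := (rhoF d_gt0 Z (pi_enum mu)).
Local Notation ph mu := (@phi F d n d_gt0 xi mu (pi mu)).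
Local Notation ph0 mu := (@phi0 F d n d_gt0 xi Z mu (pi mu)).
Local Notation Em mu := (Emu d_gt0 xi (pi mu)).

Let phE mu N : ph mu N = ph0 mu N.
Proof. exact: (phiE d_gt0 xi_inj Z (pi_enum mu)). Qed.

(** Every coloring comes from exactly one [mu], so each color idempotent is fixed by one [E_mu] and
    killed by the others. *)
Lemma Emu_sum : \sum_mu Em mu = 1.
Proof.
have YR := Yq_rels F n d_gt0.
apply: (color_idem_ext d_gt0 YR Z) => f.
have [mu [k fk]] := color_surj pi_enum f.
rewrite mul1r mulr_suml (bigD1 mu) //= fk (Emu_col d_gt0 Z (pi_enum mu)) big1 ?addr0 // => mu' ne.
apply: (Emu_other d_gt0 Z) => k' E; case/negP: ne; apply/eqP.
exact/esym/(col_comp E).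
Qed.

Let rho_Emu mu mu' : mu != mu' -> rho mu (ftlM (Em mu')) = 0.
Proof.
move=> ne; rewrite ftlM_Emu raddf_sum; apply: big1 => k' _.
apply: mx_ev => k; rewrite mul0mx.
apply: etrans (rhoF_color d_gt0 Z (pi_enum mu) _ k 1) _.
rewrite (_ : [forall p, _] = false) ?scale0r ?ev0 //; apply/negbTE/negP => /forallP E.
by case/negP: ne; apply/eqP/(@col_comp _ _ pi _ _ k k')/funext => p; rewrite (eqP (E p)).
Qed.

Local Notation Jm mu := ({dffun forall i : 'I_d, 'I_(catalan (part mu i))} : finType).

Let tlb (mu : Comp d n) (i : 'I_d) : 'I_(catalan (part mu i)) -> TLpart F mu i :=
  @tl_basis K q (part mu i).

Let tlb_spans mu i : spans (fun x : TLpart F mu i => exists k, x = tlb k).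
Proof. exact: (@tl_basis_spans K q _ (qvarK F) (part mu i)). Qed.

Let tlb_free mu i : is_free (@tlb mu i).
Proof. exact: (@tl_basis_free K q (part mu i)). Qed.

Definition TL_tensor (mu : Comp d n) (f : Jm mu) : TLmu F mu := TLtens (fun i => tlb (f i)).

Let TL_tensor_spans mu : spans (fun x : TLmu F mu => exists f : Jm mu, x = TL_tensor f).
Proof.
exact: (@tens_basis_spans K d (TLpart F mu) (TLpart_aug F mu)
  (fun i => catalan (part mu i)) (@tlb mu) (tlb_spans (mu := mu))).
Qed.

Let TL_tensor_free mu : is_free (@TL_tensor mu).
Proof.
exact: (@tens_basis_free K d (TLpart F mu) (TLpart_aug F mu)
  (fun i => catalan (part mu i)) (@tlb mu) (tlb_spans (mu := mu)) (tlb_free (mu := mu))).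
Qed.

Let m (mu : Comp d n) := nb_cosets mu.

Let ph_lin mu (c : K) (N N' : 'M[TLmu F mu]_(m mu)) :
  ph mu (map_mx (fun x : TLmu F mu => c *: x) N + N') = c *: ph mu N + ph mu N'.
Proof. by rewrite !phE; have [_ P2 _ _ _] := is_phi_phi0 d_gt0 xi_inj Z (pi_enum mu); apply: P2. Qed.

Let rho_lin mu (c : K) u v : rho mu (c *: u + v) =
  map_mx (fun x : TLmu F mu => c *: x) (rho mu u) + rho mu v :> 'M[TLmu F mu]_(m mu).
Proof. exact: (linearP (rho mu) c u v). Qed.

Let phK mu (N : 'M[TLmu F mu]_(m mu)) : rho mu (ph mu N) = N :> 'M[TLmu F mu]_(m mu).
Proof. by rewrite phE rhoF_phi0. Qed.

Let ph_ne mu mu' (N : 'M[TLmu F mu']_(m mu')) : mu != mu' ->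
  rho mu (ph mu' N) = 0 :> 'M[TLmu F mu]_(m mu).
Proof.
move=> ne; rewrite phE -(phi0_Emu d_gt0 Z (pi_enum mu')).
exact: (morph_mul0 (f := rho mu) _ (rho_Emu ne)).
Qed.

Let ph_sum v : v = \sum_mu ph mu (rho mu v).
Proof.
rewrite -[LHS](mul_morph_sum ftlM v Emu_sum); apply: eq_bigr => mu _.
by rewrite phE (phi0_rhoF Z (pi_enum mu)).
Qed.

Lemma FTL_basis :
  is_basis (V := FTLq)
    [set x | exists (mu : Comp d n) (b : forall i, TLpart F mu i)
                    (k l : 'I_(nb_cosets mu)),
       (forall i, TLpart_basis (b i)) /\ x = ph mu (TLtens b *: delta_mx k l)]
  /\ free_of_rank FTLq
       (\sum_(mu : Comp d n) nb_cosets mu ^ 2 * \prod_(i < d) catalan (part mu i))%N.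
Proof.
have sp := block_family_spans ph_lin ph_sum TL_tensor_spans.
have fr := block_family_free rho_lin phK ph_ne TL_tensor_free.
have [B R] := is_basis_family sp fr; split; last first.
  move: R; rewrite card_block_index; congr free_of_rank.
  apply: eq_bigr => mu _; rewrite card_dep_ffun foldrE big_map big_enum /=.
  by congr (_ * _)%N; apply: eq_bigr => i _; rewrite card_ord.
congr is_basis: B; apply/seteqP; split=> x /=.
  move=> [[mu [[k l] f]] ->]; exists mu, (fun i => tlb (f i)), k, l; split=> // i.
  by apply/jones_basisE; exists (f i).
move=> [mu [b [k [l [bJ ->]]]]].
pose f : Jm mu := [ffun i => sval (cid (iffLR (jones_basisE _) (bJ i)))].
exists (Tagged (fun mu => ('I_(m mu) * 'I_(m mu) * Jm mu)%type) (k, l, f)).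
have -> : b = (fun i => tlb (f i)) by apply/functional_extensionality_dep => i;
  rewrite ffunE; case: cid.
by [].
Qed.

End FTLBasis.
Theorem proposition4p8 (R : realType) (d n : nat)
  (d_gt0 : (0 < d)%N) (n_gt0 : (0 < n)%N)
  (xi : 'I_d -> R[i]) (xi_inj : injective xi) (xi_root : forall i, xi i ^+ d = 1)
  (pi : forall mu : Comp d n, 'I_(nb_cosets mu) -> 'S_n)
  (pi_enum : forall mu : Comp d n, coset_enum (pi mu)) :
  is_basis (V := FTLq R[i] n d_gt0)
    [set x | exists (mu : Comp d n) (b : forall i, TLpart R[i] mu i)
                    (k l : 'I_(nb_cosets mu)),
       (forall i, TLpart_basis (b i)) /\
       x = phi d_gt0 xi (pi mu) (TLtens b *: delta_mx k l)]
  /\ free_of_rank (FTLq R[i] n d_gt0)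
       (\sum_(mu : Comp d n)
          nb_cosets mu ^ 2 * \prod_(i < d) catalan (part mu i))%N.
Proof. exact: (FTL_basis d_gt0 xi_inj xi_root pi_enum). Qed.
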